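(* Let $(M,\omega)$ be a compact Hermitian manifold of complex dimension $n$, with metric $g$ associated to $\omega$, let $F$ be a smooth real function on $M$, and let $\varphi$ be a smooth real function on $M$ with $\sup_M\varphi=0$ such that $\omega'=\omega+\sqrt{-1}\partial\overline{\partial}\varphi$ is a Hermitian metric (with associated metric $g'$) satisfying $$(\omega+\sqrt{-1}\partial\overline{\partial}\varphi)^n=e^F\omega^n .$$ Then $$\mathrm{tr}_{g}\,g'\le C e^{A(\varphi-\inf_M\varphi)}$$ on $M$, for uniform constants $C,A$, i.e. constants depending only on $(M,\omega)$, $\sup_MF$ and $\inf_M\Delta F$.
   Context: A Hermitian metric $g$ is identified with its associated real positive $(1,1)$ form, locally $\omega=\sqrt{-1}\,g_{i\overline{j}}\,dz_i\wedge d\overline{z}_j$. $\mathrm{tr}_g\,g'=g^{\overline{j}i}g'_{i\overline{j}}$, where $g^{\overline{j}i}$ is the inverse matrix of $g_{i\overline{j}}$, and $\Delta F=g^{\overline{j}i}\partial_i\partial_{\overline{j}}F$ is the complex Laplacian of $g$. *)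

(* Defs.v *)
From HB Require Import structures.
From mathcomp Require Import all_boot all_order all_algebra all_fingroup.
From mathcomp Require Import all_classical all_reals all_analysis.
From mathcomp Require Import complex.

Set Implicit Arguments.
Unset Strict Implicit.
Unset Printing Implicit Defensive.

Import Order.TTheory GRing.Theory Num.Theory.
Import numFieldNormedType.Exports.

Local Open Scope classical_set_scope.
Local Open Scope ring_scope.
Local Open Scope complex_scope.

(** ** Smooth functions on open subsets of a normed space *)

(* The set U is always an open set below, so continuity and derivability at the
   points of U only involve the values of f on U. *)
Fixpoint Ck (R : realType) (V : normedModType R) (k : nat) (U : set V)
    (f : V -> R) : Prop :=
  (forall z, U z -> {for z, continuous f}) /\
  match k with
  | 0 => True
  | k'.+1 => forall v : V,
      (forall z, U z -> derivable f z v) /\ Ck k' U ('D_v f)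
  end.

Definition smooth (R : realType) (V : normedModType R) (U : set V)
    (f : V -> R) : Prop := forall k, Ck k U f.

Definition csmooth (R : realType) (V : normedModType R) (U : set V)
    (f : V -> R[i]) : Prop :=
  smooth U (fun z => complex.Re (f z)) /\ smooth U (fun z => complex.Im (f z)).

(** ** Complex calculus on C^n *)

(* C^n is R^n * R^n, the pair (x, y) standing for x + i y. *)
Notation Cn R n := ('rV[R]_n * 'rV[R]_n)%type.

Definition zcoord (R : realType) n (z : Cn R n) (k : 'I_n) : R[i] :=
  z.1 ord0 k +i* z.2 ord0 k.

Definition cderive (R : realType) (V : normedModType R) (v : V)
    (f : V -> R[i]) (z : V) : R[i] :=
  ('D_v (fun w => complex.Re (f w)) z) +i* ('D_v (fun w => complex.Im (f w)) z).

(* d/dz_k = (d/dx_k - i d/dy_k) / 2 *)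
Definition dz (R : realType) n (k : 'I_n) (f : Cn R n -> R[i])
    (z : Cn R n) : R[i] :=
  2%:R^-1 * (cderive (delta_mx ord0 k, 0) f z
             - 'i%C * cderive (0, delta_mx ord0 k) f z).

(* d/d\bar z_k = (d/dx_k + i d/dy_k) / 2 *)
Definition dzbar (R : realType) n (k : 'I_n) (f : Cn R n -> R[i])
    (z : Cn R n) : R[i] :=
  2%:R^-1 * (cderive (delta_mx ord0 k, 0) f z
             + 'i%C * cderive (0, delta_mx ord0 k) f z).

Definition holomorphic (R : realType) n (U : set (Cn R n))
    (f : Cn R n -> R[i]) : Prop :=
  csmooth U f /\ forall k z, U z -> dzbar k f z = 0.

(** ** Complex manifolds *)

(* The maps are total; only their restrictions to [dom] and [img] matter. *)
Record chart (R : realType) (n : nat) (M : topologicalType) := Chart {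
  dom : set M;
  img : set (Cn R n);
  to_c : M -> Cn R n;
  of_c : Cn R n -> M;
  dom_open : open dom;
  img_open : open img;
  to_c_img : forall x, dom x -> img (to_c x);
  of_c_dom : forall z, img z -> dom (of_c z);
  to_cK : forall x, dom x -> of_c (to_c x) = x;
  of_cK : forall z, img z -> to_c (of_c z) = z;
  to_c_continuous : forall x, dom x -> {for x, continuous to_c};
  of_c_continuous : forall z, img z -> {for z, continuous of_c}
}.

Definition overlap (R : realType) n (M : topologicalType)
    (c d : chart R n M) : set (Cn R n) :=
  [set z | img c z /\ dom d (of_c c z)].

(* k-th component of the change of coordinates from c to d *)
Definition transition (R : realType) n (M : topologicalType)
    (c d : chart R n M) (k : 'I_n) (z : Cn R n) : R[i] :=
  zcoord (to_c d (of_c c z)) k.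

(* Second countability is not required: it is automatic for compact M. *)
Record complex_manifold (R : realType) (n : nat) (M : topologicalType) :=
  ComplexManifold {
  atlas : set (chart R n M);
  manifold_hausdorff : hausdorff_space M;
  atlas_cover : forall x : M, exists2 c, atlas c & dom c x;
  atlas_holomorphic : forall c d, atlas c -> atlas d ->
    forall k, holomorphic (overlap c d) (transition c d k)
}.

Definition smooth_fun (R : realType) n (M : topologicalType)
    (X : complex_manifold R n M) (f : M -> R) : Prop :=
  forall c, atlas X c -> smooth (img c) (fun z => f (of_c c z)).

(** ** Hermitian metrics *)

(* Coefficients h_{i \bar j} in each chart, as functions of the coordinates. *)
Definition tensor11 (R : realType) n (M : topologicalType) : Type :=
  chart R n M -> Cn R n -> 'M[R[i]]_n.

Record hermitian_metric (R : realType) n (M : topologicalType)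
    (X : complex_manifold R n M) (g : tensor11 R n M) : Prop :=
  HermitianMetric {
  metric_smooth : forall c, atlas X c ->
    forall i j, csmooth (img c) (fun z => g c z i j);
  metric_hermitian : forall c, atlas X c -> forall z, img c z ->
    forall i j, g c z j i = (g c z i j)^*%C;
  metric_positive : forall c, atlas X c -> forall z, img c z ->
    forall u : 'rV[R[i]]_n, u != 0 ->
    0 < \sum_i \sum_j g c z i j * u ord0 i * (u ord0 j)^*%C;
  metric_compatible : forall c d, atlas X c -> atlas X d ->
    forall z, overlap c d z -> forall i j,
    g c z i j = \sum_k \sum_l dz i (transition c d k) z
                  * (dz j (transition c d l) z)^*%C
                  * g d (to_c d (of_c c z)) k l
}.

Definition add_tensor (R : realType) n (M : topologicalType)
    (g h : tensor11 R n M) : tensor11 R n M := fun c z => g c z + h c z.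

(* The coefficients of sqrt(-1) ddbar f : the matrix of d_i d_{\bar j} f. *)
Definition ddbar (R : realType) n (M : topologicalType) (f : M -> R) :
    tensor11 R n M := fun c z =>
  \matrix_(i, j) dz i (dzbar j (fun w => (f (of_c c w))%:C)) z.

(* Pointwise quantities are computed in a chosen chart of the atlas around each
   point; by the tensor transformation law, those below do not depend on it. *)
Definition chart_at (R : realType) n (M : topologicalType)
    (X : complex_manifold R n M) (x : M) : chart R n M :=
  s2val (cid2 (atlas_cover X x)).

Definition at_point (R : realType) n (M : topologicalType)
    (X : complex_manifold R n M) (h : tensor11 R n M) (x : M) : 'M[R[i]]_n :=
  h (chart_at X x) (to_c (chart_at X x) x).

(* g^{\bar j i} h_{i \bar j}; it is real when g and h are Hermitian, so that
   taking the real part loses nothing. *)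
Definition metric_trace (R : realType) n (M : topologicalType)
    (X : complex_manifold R n M) (g h : tensor11 R n M) (x : M) : R :=
  complex.Re (\sum_i \sum_j invmx (at_point X g x) j i * at_point X h x i j).

Definition laplacian (R : realType) n (M : topologicalType)
    (X : complex_manifold R n M) (g : tensor11 R n M) (f : M -> R) : M -> R :=
  metric_trace X g (@ddbar R n M f).

(** ** Exterior powers of the fundamental form *)

(* Complex-valued forms on a tangent space, which is identified with C^n by
   v |-> (dz_1 v, ..., dz_n v). *)
Definition form (R : realType) (n k : nat) : Type :=
  ('I_k -> 'rV[R[i]]_n) -> R[i].

Definition wedge (R : realType) n k l (a : form R n k) (b : form R n l) :
    form R n (k + l) := fun v =>
  (k`! * l`!)%N%:R^-1 *
  \sum_(s : 'S_(k + l)) (-1) ^+ s * a (fun i => v (s (lshift l i)))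
                                  * b (fun j => v (s (rshift k j))).

Definition dz_form (R : realType) n (i : 'I_n) : form R n 1 :=
  fun v => v ord0 ord0 i.

Definition dzbar_form (R : realType) n (i : 'I_n) : form R n 1 :=
  fun v => (v ord0 ord0 i)^*%C.

(* sqrt(-1) h_{i \bar j} dz_i /\ d\bar z_j *)
Definition fundamental_form (R : realType) n (h : 'M[R[i]]_n) : form R n 2 :=
  fun v => \sum_i \sum_j 'i%C * h i j
             * wedge (@dz_form R n i) (@dzbar_form R n j) v.

Fixpoint wedge_pow (R : realType) n (a : form R n 2) (k : nat) :
    form R n (k * 2) :=
  match k return form R n (k * 2) with
  | 0 => fun _ => 1
  | k'.+1 => wedge a (@wedge_pow R n a k')
  end.

Arguments wedge_pow {R n} a k.

(* Main.v *)
Require Import Defs.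
From HB Require Import structures.
From mathcomp Require Import all_boot all_order all_algebra all_fingroup.
From mathcomp Require Import all_classical all_reals all_analysis.
From mathcomp Require Import complex sesquilinear spectral.
From mathcomp Require Import ring lra zify.

Set Implicit Arguments.
Unset Strict Implicit.
Unset Printing Implicit Defensive.

Import Order.TTheory GRing.Theory Num.Theory.
Import numFieldNormedType.Exports.

Local Open Scope classical_set_scope.
Local Open Scope ring_scope.
Local Open Scope complex_scope.

(* Let S = tr_g g' and let x0 be a maximum point of
     Q = ln S - A phi + 1 / (phi - inf phi + 1).
   In a frame at x0 in which g is the identity and g' is diagonal with entries
   l_p, the operator D |-> sum_p D_p D_pbar / l_p applied to ln S is bounded
   below, using the Laplacian of ln det g' = F + ln det g, by
   -C (1 + tr_g' g) up to a term coupling the gradient of S with the torsion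
   of g.  The term 1 / (phi - inf phi + 1), a trick of Phong and Sturm, has a
   Hessian quadratic in the gradient of phi, which absorbs this coupling unless
   S(x0)^2 <= C (phi(x0) - inf phi + 1)^3.  Otherwise Q having a maximum bounds
   tr_g' g = sum 1/l_p, hence S = sum l_p because prod l_p = e^F.  In all cases
   S(x0) <= C (phi(x0) - inf phi + 1)^2, and Q <= Q(x0) gives the estimate. *)

(** If g were Kahler, coordinates could be chosen at x0 in which the first derivatives of g vanish.
    Torsion forbids this, so they stay and are only bounded. The frame is a constant linear change P
    of the coordinates, so derivations along its vectors have constant coefficients and commute. As
    g' - g = ddbar phi, antisymmetrized derivatives of g' equal those of g, which is how bounds on g
    reach derivatives of g'. The constant is A = N1 + N2 + 2, where N1 and N2 gather the torsion and
    second derivatives of g in front of tau = sum 1/l_p and of S tau; 1 pays for the gradient terms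
    and 1 remains to bound tau. As A >= 2, the quadratic bound S(x0) <= C y^2, y = phi(x0) - inf phi
    + 1, becomes exponential: ln (y^2) <= 2 (y - 1) <= A (phi(x0) - inf phi). Uniformity rests on
    one K that bounds the diagonal of g^-1 and the first and mixed second derivatives of g at every
    point, in a chart depending on the point. The equation between wedge powers of alternating forms
    is turned into one between determinants by evaluating it on a real basis. *)

(** * Closure properties of smooth real functions *)

Section SmoothFunctions.
Variables (R : realType) (V : normedModType R) (U : set V).
Hypothesis oU : open U.
Implicit Types (f g : V -> R) (z v w : V) (k : nat).

Lemma near_open z (P : V -> Prop) : U z -> (forall w, U w -> P w) ->
  \forall w \near z, P w.
Proof.
by move=> Uz UP; apply: filterS UP _; exact: open_nbhs_nbhs.
Qed.

Lemma derive_ext f g z v : U z -> (forall w, U w -> f w = g w) ->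
  'D_v f z = 'D_v g z.
Proof. by move=> Uz fg; apply: near_eq_derive; exact: near_open. Qed.

Lemma Ck_ext k f g : (forall z, U z -> f z = g z) -> Ck k U f -> Ck k U g.
Proof.
elim: k f g => [|k IH] f g fg /= [cf Df]; split => //.
- move=> z Uz; have := cf z Uz; rewrite /prop_for /continuous_at (fg z Uz).
  by apply: cvg_trans; apply: near_eq_cvg; exact: near_open.
- move=> z Uz; have := cf z Uz; rewrite /prop_for /continuous_at (fg z Uz).
  by apply: cvg_trans; apply: near_eq_cvg; exact: near_open.
- move=> v; have [df Cf] := Df v; split.
    move=> z Uz; apply: near_eq_derivable (df z Uz).
    exact: near_open.
  by apply: IH Cf => z Uz; exact: derive_ext.
Qed.

Lemma CkS k f : Ck k.+1 U f -> Ck k U f.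
Proof.
elim: k f => [|k IH] f [cf Df]; split => //.
by move=> v; have [df Cf] := Df v; split => //; exact: IH.
Qed.

Lemma Ck_cst k (a : R) : Ck k U (fun=> a).
Proof.
elim: k a => [|k IH] a; (split; first by move=> z _; exact: cst_continuous) => //.
move=> v; split; first by move=> z _; exact: derivable_cst.
apply: Ck_ext (IH 0) => z Uz; by rewrite derive_cst.
Qed.

Lemma CkD k f g : Ck k U f -> Ck k U g -> Ck k U (fun z => f z + g z).
Proof.
elim: k f g => [|k IH] f g [cf Df] [cg Dg]; split => //.
- by move=> z Uz; apply: cvgD; [exact: cf | exact: cg].
- by move=> z Uz; apply: cvgD; [exact: cf | exact: cg].
- move=> v; have [df Cf] := Df v; have [dg Cg] := Dg v; split.
    by move=> z Uz; apply: derivableD; [exact: df | exact: dg].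
  apply: Ck_ext (IH _ _ Cf Cg) => z Uz.
  by rewrite (deriveD (df z Uz) (dg z Uz)).
Qed.

Lemma CkM k f g : Ck k U f -> Ck k U g -> Ck k U (fun z => f z * g z).
Proof.
elim: k f g => [|k IH] f g Cf' Cg'; move: (Cf') (Cg') => [cf Df] [cg Dg]; split => //.
- by move=> z Uz; apply: cvgM; [exact: cf | exact: cg].
- by move=> z Uz; apply: cvgM; [exact: cf | exact: cg].
- move=> v; have [df Cf] := Df v; have [dg Cg] := Dg v; split.
    by move=> z Uz; apply: derivableM; [exact: df | exact: dg].
  apply: Ck_ext (CkD (IH _ _ (CkS Cf') Cg) (IH _ _ (CkS Cg') Cf)) => z Uz.
  by rewrite (deriveM (df z Uz) (dg z Uz)).
Qed.

Lemma CkV k f : (forall z, U z -> f z != 0) -> Ck k U f ->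
  Ck k U (fun z => (f z)^-1).
Proof.
move=> f0; elim: k => [|k IH] Cf'; move: (Cf') => [cf Df]; split => //.
- by move=> z Uz; apply: cvgV; [exact: f0 | exact: cf].
- by move=> z Uz; apply: cvgV; [exact: f0 | exact: cf].
- move=> v; have [df Cf] := Df v; split.
    by move=> z Uz; apply: derivableV; [exact: f0 | exact: df].
  have Ci := IH (CkS Cf').
  apply: Ck_ext (CkM (Ck_cst _ (-1)) (CkM (CkM Ci Ci) Cf)) => z Uz.
  by rewrite (deriveV (f0 z Uz) (df z Uz)) expr2 invfM mulN1r scaleNr.
Qed.

Lemma smooth_continuous f z : smooth U f -> U z -> {for z, continuous f}.
Proof. by move=> sf; have [cf _] := sf 0%N; exact: cf. Qed.

Lemma smooth_derivable f z v : smooth U f -> U z -> derivable f z v.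
Proof. by move=> sf; have [_ /(_ v)[df _]] := sf 1%N; exact: df. Qed.

Lemma smooth_derive f v : smooth U f -> smooth U ('D_v f).
Proof. by move=> sf k; have [_ /(_ v)[]] := sf k.+1. Qed.

Lemma smooth_ext f g : (forall z, U z -> f z = g z) -> smooth U f -> smooth U g.
Proof. by move=> fg sf k; apply: Ck_ext fg (sf k). Qed.

Lemma smooth_cst (a : R) : smooth U (fun=> a).
Proof. by move=> k; exact: Ck_cst. Qed.

Lemma smoothD f g : smooth U f -> smooth U g -> smooth U (fun z => f z + g z).
Proof. by move=> sf sg k; exact: CkD. Qed.

Lemma smoothM f g : smooth U f -> smooth U g -> smooth U (fun z => f z * g z).
Proof. by move=> sf sg k; exact: CkM. Qed.

Lemma smoothN f : smooth U f -> smooth U (fun z => - f z).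
Proof.
move=> sf; apply: smooth_ext (smoothM (smooth_cst (-1)) sf) => z _.
by rewrite mulN1r.
Qed.

Lemma smoothB f g : smooth U f -> smooth U g -> smooth U (fun z => f z - g z).
Proof. by move=> sf sg; apply: smoothD => //; exact: smoothN. Qed.

Lemma smoothV f : (forall z, U z -> f z != 0) -> smooth U f ->
  smooth U (fun z => (f z)^-1).
Proof. by move=> f0 sf k; exact: CkV. Qed.

Lemma derive_line f v z : 'D_1 (fun h : R => f (h *: v + z)) 0 = 'D_v f z.
Proof.
rewrite /derive; set g1 := fun h => h^-1 *: _; set g2 := fun h => h^-1 *: _.
suff -> : g1 = g2 by [].
by apply/funext => h; rewrite /g1 /g2 /= addr0 scale0r add0r [_%:A]mulr1.
Qed.

(** [Ck] only provides directional derivatives. Along the line t v + z everything is a function of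
    one real variable, where derivability gives differentiability and the usual chain rule
    applies. *)
Lemma smooth_derivable_comp (phi : R -> R) (dphi : R -> R) f v z :
  smooth U f -> U z -> is_derive (f z) 1 phi (dphi (f z)) ->
  is_derive z v (phi \o f) (dphi (f z) * 'D_v f z).
Proof.
move=> sf Uz dphi1.
pose q (t : R) := f (t *: v + z).
have q0 : q 0 = f z by rewrite /q scale0r add0r.
have dq : derivable q 0 1 by exact: (derivable1P f z v).1 (smooth_derivable sf Uz).
have Dq : 'D_1 q 0 = 'D_v f z by exact: derive_line.
have dphiq : derivable phi (q 0) 1 by rewrite q0; case: dphi1.
have dc : derivable (phi \o q) 0 1.
  apply: (derivable1_diffP _ _).2; apply: differentiable_comp.
    exact: (derivable1_diffP _ _).1.
  exact: (derivable1_diffP _ _).1.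
split; first by apply/(derivable1P (phi \o f) z v).
rewrite -derive_line -/(phi \o q).
rewrite -derive1E (derive1_comp dq dphiq) 2!derive1E Dq q0.
by case: dphi1 => _ ->.
Qed.

Lemma smooth_expR f : smooth U f -> smooth U (fun z => expR (f z)).
Proof.
move=> sf k; have ce z : U z -> {for z, continuous (fun z => expR (f z))}.
  move=> Uz; apply: continuous_comp; first exact: smooth_continuous sf Uz.
  exact: continuous_expR.
elim: k => [//|k IH]; split; first exact: ce.
have De z v : U z -> is_derive z v (expR \o f) (expR (f z) * 'D_v f z).
  by move=> Uz; exact: (smooth_derivable_comp v sf Uz (is_derive_expR _)).
move=> v; split; first by move=> z Uz; have [] := De z v Uz.
apply: Ck_ext (CkM IH (smooth_derive v sf k)) => z Uz.
by have [_ /= <-] := De z v Uz.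
Qed.

Lemma derive_comp_expR f z v : smooth U f -> U z ->
  'D_v (fun w => expR (f w)) z = expR (f z) * 'D_v f z.
Proof. by move=> sf Uz; have [] := smooth_derivable_comp v sf Uz (is_derive_expR _). Qed.

Lemma derive_comp_ln f z v : smooth U f -> U z -> 0 < f z ->
  'D_v (fun w => ln (f w)) z = (f z)^-1 * 'D_v f z.
Proof.
by move=> sf Uz f0; have [] := smooth_derivable_comp v sf Uz (is_derive1_ln f0).
Qed.

Lemma smooth_ln f : (forall z, U z -> 0 < f z) -> smooth U f ->
  smooth U (fun z => ln (f z)).
Proof.
move=> f0 sf k; have cl z : U z -> {for z, continuous (fun z => ln (f z))}.
  move=> Uz; apply: continuous_comp; first exact: smooth_continuous sf Uz.
  by apply: continuous_ln; exact: f0.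
(* No induction on k: the derivative of ln f is f^-1 times that of f, whose smoothness is already
   known. *)
case: k => [//|k]; split; first exact: cl.
move=> v; split.
  move=> z Uz.
  by have [] := smooth_derivable_comp v sf Uz (is_derive1_ln (f0 z Uz)).
apply: Ck_ext (CkM (smoothV _ sf k) (smooth_derive v sf k)) => z Uz.
  by rewrite derive_comp_ln //; exact: f0.
by rewrite gt_eqF // f0.
Qed.

End SmoothFunctions.

(** * Mean value theorem along lines and symmetry of second derivatives *)

Section MeanValue.
Variables (R : realType) (V : normedModType R) (U : set V).
Hypothesis oU : open U.
Implicit Types (f g : V -> R) (z v w : V).

Lemma is_derive_line f z v (t : R) : derivable f (t *: v + z) v ->
  is_derive t 1 (fun s : R => f (s *: v + z)) ('D_v f (t *: v + z)).
Proof.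
move=> df; have E : (fun h : R => f (h *: v + (t *: v + z))) =
    (fun h : R => (fun s : R => f (s *: v + z)) (h *: 1 + t)).
  by apply/funext => h; rewrite [h *: 1]mulr1 scalerDl addrA.
split.
  apply/(derivable1P (fun s : R => f (s *: v + z)) t 1).
  by rewrite -E; exact: (derivable1P f _ v).1.
by rewrite -(derive_line (fun s : R => f (s *: v + z))) -E derive_line.
Qed.

Lemma is_derive_mull (a x : R) : is_derive x 1 ( *%R a) a.
Proof.
have : is_derive x (1 : R) (a *: (id : R -> R)) (a *: (1 : R)).
  by apply: is_deriveZ.
by rewrite [a *: 1]mulr1.
Qed.

Lemma derive_scale f z v (a : R) : derivable f z v ->
  'D_(a *: v) f z = a * 'D_v f z.
Proof.
move=> df; pose q (t : R) := f (t *: v + z); pose l (t : R) := a * t.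
have l0 : l 0 = 0 by rewrite /l mulr0.
have il : is_derive (0 : R) (1 : R) l a.
  exact: is_derive_mull.
have dq : derivable q (l 0) 1 by rewrite l0; exact: (derivable1P f z v).1.
rewrite -(derive_line f (a *: v)).
have -> : (fun h : R => f (h *: (a *: v) + z)) = q \o l.
  by apply/funext => h; rewrite /q /l /= scalerA mulrC.
have dl : derivable l 0 1 by case: il.
rewrite -derive1E (derive1_comp dl dq) 2!derive1E l0.
have -> : 'D_1 l 0 = a by case: il.
by rewrite /q derive_line mulrC.
Qed.

Lemma derivable_scale f z v (a : R) : derivable f z v -> derivable f z (a *: v).
Proof.
move=> df; pose q (t : R) := f (t *: v + z); pose l (t : R) := a * t.
have l0 : l 0 = 0 by rewrite /l mulr0.
have il : is_derive (0 : R) (1 : R) l a.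
  exact: is_derive_mull.
have dq : derivable q (l 0) 1 by rewrite l0; exact: (derivable1P f z v).1.
apply/(derivable1P f z (a *: v)).
have -> : (fun h : R => f (h *: (a *: v) + z)) = q \o l.
  by apply/funext => h; rewrite /q /l /= scalerA mulrC.
apply: (derivable1_diffP _ _).2; apply: differentiable_comp.
  by apply: (derivable1_diffP _ _).1; case: il.
exact: (derivable1_diffP _ _).1.
Qed.

Lemma mean_value_line_open f z v (a : R) : smooth U f ->
  (forall t : R, 0 <= t <= 1 -> U ((t * a) *: v + z)) ->
  exists2 t : R, 0 < t < 1 &
    f (a *: v + z) - f z = a * 'D_v f ((t * a) *: v + z).
Proof.
move=> sf Useg.
pose q (s : R) := f (s *: (a *: v) + z).
have dq (s : R) : 0 <= s <= 1 ->
    is_derive s 1 q (a * 'D_v f ((s * a) *: v + z)).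
  move=> s01; have Us := Useg s s01.
  rewrite -derive_scale; last exact: smooth_derivable Us.
  rewrite -scalerA; apply: is_derive_line; rewrite scalerA.
  by apply: derivable_scale; exact: smooth_derivable Us.
have [| | |c] := @MVT R q (fun s => a * 'D_v f ((s * a) *: v + z)) 0 1.
- exact: ltr01.
- by move=> s; rewrite in_itv /= => /andP[/ltW s0 /ltW s1]; apply: dq; rewrite s0.
- apply: derivable_within_continuous => s; rewrite in_itv /= => s01.
  by case: (dq s s01).
rewrite in_itv /= => c01 E; exists c => //.
by move: E; rewrite /q scale1r scale0r add0r subr0 mulr1.
Qed.

Lemma mean_value_line f z v (a : R) : smooth U f ->
  (forall t : R, 0 <= t <= 1 -> U ((t * a) *: v + z)) ->
  exists2 t : R, 0 <= t <= 1 &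
    f (a *: v + z) - f z = a * 'D_v f ((t * a) *: v + z).
Proof.
move=> sf Useg; have [t /andP[/ltW t0 /ltW t1] E] := mean_value_line_open sf Useg.
by exists t => //; rewrite t0.
Qed.

(** Apply the mean value theorem to a |-> f(a v + s w + z) - f(a v + z), then in direction w to the
    derivative so obtained. The left side is symmetric in v and w, so comparing the two orders
    proves [Schwarz]. *)
Lemma second_difference f z v w (s : R) : smooth U f -> 0 < s ->
  (forall a b : R, 0 <= a <= s -> 0 <= b <= s -> U (a *: v + (b *: w + z))) ->
  exists a b : R, [/\ 0 <= a <= s, 0 <= b <= s &
    f (s *: v + (s *: w + z)) - f (s *: v + z) - (f (s *: w + z) - f z)
      = s ^+ 2 * 'D_w ('D_v f) (b *: w + (a *: v + z))].
Proof.
move=> sf s0 Uab.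
have scale_seg (t : R) : 0 <= t <= 1 -> 0 <= t * s <= s.
  move=> /andP[t0 t1]; have s0' := ltW s0.
  by rewrite (mulr_ge0 t0 s0') ler_piMl.
have Ua0 a : 0 <= a <= s -> U (a *: v + z).
  move=> as1; have := Uab a 0 as1; rewrite scale0r add0r; apply.
  by rewrite lexx ltW.
pose q (a : R) := f (a *: v + (s *: w + z)) - f (a *: v + z).
pose dq (a : R) := 'D_v f (a *: v + (s *: w + z)) - 'D_v f (a *: v + z).
have isd (a : R) : 0 <= a <= s -> is_derive a 1 q (dq a).
  move=> as1; apply: is_deriveB; apply: is_derive_line.
    by apply: (smooth_derivable sf); apply: Uab => //; rewrite lexx ltW.
  by apply: (smooth_derivable sf); exact: Ua0.
have [| | |a] := @MVT_segment R q dq 0 s.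
- exact: ltW.
- by move=> a; rewrite in_itv /= => /andP[/ltW a0 /ltW a1]; apply: isd; rewrite a0.
- apply: derivable_within_continuous => a; rewrite in_itv /= => a01.
  by case: (isd a a01).
rewrite in_itv /= subr0 => a01 E.
have [t t01 E2] : exists2 t : R, 0 <= t <= 1 &
  'D_v f (s *: w + (a *: v + z)) - 'D_v f (a *: v + z)
   = s * 'D_w ('D_v f) ((t * s) *: w + (a *: v + z)).
  apply: (mean_value_line (smooth_derive v sf)) => t t01.
  by rewrite addrCA; apply: Uab => //; exact: scale_seg.
exists a, (t * s); split => //.
  exact: scale_seg.
move: E; rewrite /q /dq scale0r !add0r => ->.
by rewrite addrCA E2 expr2; ring.
Qed.

Lemma Schwarz f z v w : smooth U f -> U z -> 'D_v ('D_w f) z = 'D_w ('D_v f) z.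
Proof.
move=> sf Uz.
(* Treating the two mixed derivatives as arbitrary functions keeps unification
   from unfolding them. *)
suff mixed_eq (A B : V -> R) : smooth U A -> smooth U B ->
    (forall s : R, 0 < s ->
      (forall a b : R, 0 <= a <= s -> 0 <= b <= s -> U (a *: v + (b *: w + z))) ->
      exists a b : R, [/\ 0 <= a <= s, 0 <= b <= s &
        f (s *: v + (s *: w + z)) - f (s *: v + z) - (f (s *: w + z) - f z)
          = s ^+ 2 * B (b *: w + (a *: v + z))]) ->
    (forall s : R, 0 < s ->
      (forall a b : R, 0 <= a <= s -> 0 <= b <= s -> U (a *: w + (b *: v + z))) ->
      exists a b : R, [/\ 0 <= a <= s, 0 <= b <= s &
        f (s *: w + (s *: v + z)) - f (s *: w + z) - (f (s *: v + z) - f z)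
          = s ^+ 2 * A (b *: v + (a *: w + z))]) -> A z = B z.
  apply: (mixed_eq ('D_v ('D_w f)) ('D_w ('D_v f))).
  - by do 2!apply: smooth_derive.
  - by do 2!apply: smooth_derive.
  - by move=> s; apply: second_difference.
  - by move=> s; apply: second_difference.
move=> sw sv D1 D2.
suff H (e : R) : 0 < e -> `|A z - B z| <= e.
  apply/eqP; rewrite -subr_eq0 -normr_le0; apply/ler_addgt0Pr => e e0.
  by rewrite add0r; exact: H.
move=> e0.
have e2 : 0 < e / 2 by rewrite divr_gt0.
have : \forall p \near z, [/\ U p, `|A z - A p| < e / 2 & `|B z - B p| < e / 2].
  have /cvgrPdist_lt/(_ _ e2) c1 := smooth_continuous sw Uz.
  have /cvgrPdist_lt/(_ _ e2) c2 := smooth_continuous sv Uz.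
  have c3 : \forall p \near z, U p by exact: open_nbhs_nbhs.
  exact: (filterS3 _ (fun p Up H1 H2 => And3 Up H1 H2) c3 c1 c2).
case/nbhs_normP => r /= r0 rP.
(* Small enough that the parallelogram with sides s v and s w at z lies within r of z; the added 1
   covers v = w = 0. *)
pose s := r / (2 * (`|v| + `|w| + 1)).
have nvw : 0 < `|v| + `|w| + 1 by rewrite ltr_wpDl // addr_ge0.
have s0 : 0 < s by rewrite divr_gt0 // mulr_gt0.
have near_z (a b : R) : 0 <= a <= s -> 0 <= b <= s ->
    [/\ U (a *: v + (b *: w + z)),
     `|A z - A (a *: v + (b *: w + z))| < e / 2
    & `|B z - B (a *: v + (b *: w + z))| < e / 2].
  move=> /andP[a0 a1] /andP[b0 b1]; apply: rP => /=.
  rewrite addrA opprD addrCA subrr addr0 normrN (le_lt_trans (ler_normD _ _)) //.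
  rewrite !normrZ !ger0_norm //.
  apply: (@le_lt_trans _ _ (s * `|v| + s * `|w|)).
    by rewrite lerD // ler_wpM2r.
  rewrite -mulrDr /s; apply: (@lt_le_trans _ _ (s * (`|v| + `|w| + 1))).
    by rewrite ltr_pM2l // ltrDl.
  have -> : s * (`|v| + `|w| + 1) = r / 2 by rewrite /s; field; rewrite gt_eqF.
  by lra.
have [|a [b [as1 bs1 E1]]] := D1 s s0.
  by move=> a b as1 bs1; case: (near_z a b as1 bs1).
have [|a' [b' [as2 bs2 E2]]] := D2 s s0.
  by move=> a' b' as2 bs2; rewrite addrCA; case: (near_z b' a' bs2 as2).
(* Both orders expand the same second difference, so A and B take a common value at two points close
   to z. *)
have E : A (b' *: v + (a' *: w + z)) = B (b *: w + (a *: v + z)).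
  apply: (@mulfI _ (s ^+ 2)); first by rewrite expf_neq0 // gt_eqF.
  have r4 (a1 a2 a3 a4 : R) : a1 - a2 - (a3 - a4) = a1 - a3 - (a2 - a4) by ring.
  by rewrite -E1 -E2 addrCA r4.
have [_ _ H1] := near_z a b as1 bs1.
have [_ H2 _] := near_z b' a' bs2 as2.
rewrite addrCA -E in H1.
have H3 := ler_distD (A (b' *: v + (a' *: w + z))) (A z) (B z).
apply: (le_trans H3); rewrite [leRHS]splitr; apply: lerD; first exact: ltW.
by rewrite distrC ltW.
Qed.

End MeanValue.

(** * Chain rule for maps given in coordinates, and derivative tests at a maximum *)

Section ChainRule.
Variables (R : realType) (V : normedModType R) (U : set V).
Hypothesis oU : open U.
Implicit Types (f g : V -> R) (z v w : V).

(** A difference quotient whose step a and base point p both vary, completed by the derivative where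
    the step vanishes. It converges because directional derivatives are continuous, and takes the
    place of Frechet differentiability in the chain rule. *)
Lemma difference_quotient_cvg f z v (D : V -> R) (a : R -> R) (p : R -> V) :
  smooth U f -> D = 'D_v f -> U z -> a x @[x --> (0 : R)^'] --> (0 : R) ->
  p x @[x --> (0 : R)^'] --> z ->
  (if a x == 0 then D (p x) else (a x)^-1 * (f (a x *: v + p x) - f (p x)))
    @[x --> (0 : R)^'] --> D z.
Proof.
move=> sf ED Uz a0 pz.
have mvt w (t : R) : (forall s : R, 0 <= s <= 1 -> U ((s * t) *: v + w)) ->
    exists2 s : R, 0 <= s <= 1 &
    f (t *: v + w) - f w = t * D ((s * t) *: v + w).
  by rewrite ED; exact: mean_value_line.
have cD : {for z, continuous D}.
  by rewrite ED; exact: smooth_continuous (smooth_derive v sf) Uz.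
move: D cD mvt {ED} => D cD mvt.
apply/cvgrPdist_lt => e e0.
have : \forall y \near z, U y /\ `|D z - D y| < e.
  have /cvgrPdist_lt/(_ _ e0) c1 := cD.
  have c2 : \forall y \near z, U y by exact: open_nbhs_nbhs.
  exact: filterI c2 c1.
case/nbhs_normP => r /= r0 rP.
have r2 : 0 < r / 2 by rewrite divr_gt0.
have pr : \forall x \near (0 : R)^', `|z - p x| < r / 2.
  by move/cvgrPdist_lt: pz; exact.
have ar : \forall x \near (0 : R)^', `|0 - a x| < r / 2 / (`|v| + 1).
  by move/cvgrPdist_lt: a0; apply; rewrite divr_gt0 // ltr_wpDl.
apply: filterS2 pr ar => x pr ar.
have near_z (t : R) : 0 <= t <= 1 ->
    U ((t * a x) *: v + p x) /\ `|D z - D ((t * a x) *: v + p x)| < e.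
  move=> /andP[t0 t1]; apply: rP => /=.
  rewrite [_ + p x]addrC opprD addrA (le_lt_trans (ler_normB _ _)) //.
  rewrite [r]splitr ltrD // normrZ normrM (ger0_norm t0).
  move: ar; rewrite sub0r normrN ltr_pdivlMr ?ltr_wpDl // => /(le_lt_trans _); apply.
  rewrite ler_pM ?mulr_ge0 // ?ler_piMl //.
  by rewrite lerDl.
case: eqP => [ax0|/eqP ax0].
  have [_] : U ((0 * a x) *: v + p x) /\ `|D z - D ((0 * a x) *: v + p x)| < e.
    by apply: near_z; rewrite lexx ler01.
  by rewrite mul0r scale0r add0r.
have [t t01 ->] := mvt (p x) (a x) (fun t t01 => (near_z t t01).1).
by rewrite mulKf //; case: (near_z t t01).
Qed.

(** Move along one direction e k at a time: the increment telescopes into quotients in a single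
    direction, each based at the partial sum over the remaining directions. *)
Lemma curve_cvg (I : Type) (s : seq I) f z (e : I -> V) (a : I -> R -> R)
    (da : I -> R) :
  smooth U f -> U z -> (forall k, a k 0 = 0) ->
  (forall k, is_derive (0 : R) (1 : R) (a k) (da k)) ->
  h^-1 * (f (\sum_(k <- s) a k h *: e k + z) - f z) @[h --> (0 : R)^'] -->
    \sum_(k <- s) da k * 'D_(e k) f z.
Proof.
move=> sf Uz a0 Da.
have ac k : a k x @[x --> (0 : R)^'] --> (0 : R).
  have : {for 0, continuous (a k)}.
    apply: differentiable_continuous; apply: (derivable1_diffP _ _).1.
    by case: (Da k).
  by move=> /continuous_withinNx; rewrite a0.
have pc (s' : seq I) : (\sum_(k <- s') a k h *: e k + z) @[h --> (0 : R)^'] --> z.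
  rewrite -[X in _ --> X]add0r; apply: cvgD; last exact: cvg_cst.
  elim: s' => [|k s' IH].
    by under eq_fun do rewrite big_nil; exact: cvg_cst.
  have H1 : (a k h *: e k) @[h --> (0 : R)^'] --> (0 : V).
    by rewrite -(scale0r (e k)); apply: cvgZr_tmp.
  have H2 := cvgD H1 IH; rewrite addr0 in H2.
  under eq_fun do rewrite big_cons.
  exact: H2.
have dc k : h^-1 * a k h @[h --> (0 : R)^'] --> da k.
  have [dk <-] := Da k.
  have : h^-1 *: (a k (h *: 1 + 0) - a k 0) @[h --> (0 : R)^'] --> 'D_1 (a k) (0 : R).
    exact: dk.
  by under eq_fun do rewrite addr0 a0 subr0 [_ *: 1]mulr1.
elim: s => [|k s IH].
  rewrite big_nil; under eq_fun do rewrite big_nil add0r subrr mulr0.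
  exact: cvg_cst.
rewrite big_cons.
have H := cvgD (cvgM (dc k)
  (difference_quotient_cvg sf (erefl ('D_(e k) f)) Uz (ac k) (pc s))) IH.
suff E (h : R) : h^-1 * (f (\sum_(j <- k :: s) a j h *: e j + z) - f z) =
  (h^-1 * a k h) * (if a k h == 0 then 'D_(e k) f (\sum_(j <- s) a j h *: e j + z)
    else (a k h)^-1 * (f (a k h *: e k + (\sum_(j <- s) a j h *: e j + z)) -
                       f (\sum_(j <- s) a j h *: e j + z)))
  + h^-1 * (f (\sum_(j <- s) a j h *: e j + z) - f z).
  by under eq_fun do rewrite E; exact: H.
rewrite big_cons -addrA; set p := \sum_(j <- s) _ + z.
case: eqP => [ak0|/eqP ak0]; first by rewrite ak0 mulr0 mul0r scale0r !add0r.
by rewrite mulrA mulfK // -mulrDr subrKA.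
Qed.

Lemma is_derive_curve (I : finType) f z (e : I -> V) (a : I -> R -> R)
    (da : I -> R) :
  smooth U f -> U z -> (forall k, a k 0 = 0) ->
  (forall k, is_derive (0 : R) (1 : R) (a k) (da k)) ->
  is_derive (0 : R) (1 : R) (fun t => f (\sum_k a k t *: e k + z))
    (\sum_k da k * 'D_(e k) f z).
Proof.
move=> sf Uz a0 Da; have H := @curve_cvg I (index_enum I) f z e a da sf Uz a0 Da.
pose G t := f (\sum_k a k t *: e k + z).
have G0 : G 0 = f z.
  by rewrite /G big1 ?add0r // => k _; rewrite a0 scale0r.
have {}H : h^-1 *: (G (h *: 1 + 0) - G 0) @[h --> (0 : R)^'] -->
    \sum_k da k * 'D_(e k) f z.
  by rewrite G0 /G; under eq_fun do rewrite addr0 [_ *: 1]mulr1.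
split; first by apply/cvg_ex; eexists; exact: H.
exact: (cvg_lim _ H).
Qed.

Lemma is_derive_comp_sum (I : finType) (W : normedModType R) f (e : I -> V)
    (tau : I -> W -> R) (dtau : I -> R) (b : V) (w u : W) :
  smooth U f -> U (\sum_k tau k w *: e k + b) ->
  (forall k, is_derive w u (tau k) (dtau k)) ->
  is_derive w u (fun x => f (\sum_k tau k x *: e k + b))
    (\sum_k dtau k * 'D_(e k) f (\sum_k tau k w *: e k + b)).
Proof.
move=> sf Uz Dt.
pose a k (t : R) := tau k (t *: u + w) - tau k w.
have a0 k : a k 0 = 0 by rewrite /a scale0r add0r subrr.
have Da k : is_derive (0 : R) (1 : R) (a k) (dtau k).
  have [dk <-] := Dt k.
  rewrite -[X in is_derive _ _ _ X]subr0; apply: is_deriveB.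
    rewrite -derive_line; apply: derivableP.
    exact: (derivable1P (tau k) w u).1.
have := is_derive_curve e sf Uz a0 Da.
have -> : (fun t => f (\sum_k a k t *: e k + (\sum_k tau k w *: e k + b))) =
   (fun t : R => (fun x => f (\sum_k tau k x *: e k + b)) (t *: u + w)).
  apply/funext => t; rewrite addrA -big_split /=; congr (f (_ + _)).
  by apply: eq_bigr => k _; rewrite /a -scalerDl subrK.
move=> [dH vH]; split; first exact/derivable1P.
by rewrite -derive_line.
Qed.

Lemma derive_sum_dir (I : finType) f z (e : I -> V) (c : I -> R) :
  smooth U f -> U z ->
  'D_(\sum_k c k *: e k) f z = \sum_k c k * 'D_(e k) f z.
Proof.
move=> sf Uz; rewrite -derive_line.
have -> : (fun h : R => f (h *: (\sum_k c k *: e k) + z)) =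
    (fun h : R => f (\sum_k (c k * h) *: e k + z)).
  apply/funext => t; congr (f (_ + _)).
  by rewrite scaler_sumr; apply: eq_bigr => k _; rewrite scalerA mulrC.
have H : is_derive (0 : R) (1 : R) (fun t => f (\sum_k (c k * t) *: e k + z))
    (\sum_k c k * 'D_(e k) f z).
  apply: (is_derive_curve (a := fun k t => c k * t) e sf Uz) => k; first by rewrite mulr0.
  exact: is_derive_mull.
by case: H.
Qed.

Lemma derive_at_max f z v : smooth U f -> U z -> (forall w, U w -> f w <= f z) ->
  'D_v f z = 0.
Proof.
move=> sf Uz fz.
have : \forall t \near (0 : R), U (t *: v + z).
  have : {for 0, continuous (fun t : R => t *: v + z)}.
    apply: cvgD; last exact: cvg_cst.
    by apply: cvgZr_tmp.
  apply; rewrite /= scale0r add0r; exact: open_nbhs_nbhs.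
case/nbhs_normP => r /= r0 rP.
rewrite -derive_line -derive1E.
have inU (t : R) : t \in `]- r, r[ -> U (t *: v + z).
  by rewrite in_itv /= => tr; apply: rP => /=; rewrite sub0r normrN ltr_norml.
have r00 : (0 : R) \in `](- r), r[%R by rewrite in_itv /= oppr_lt0 r0.
have [_ H] : is_derive (0 : R) 1 (fun t : R => f (t *: v + z)) 0.
  apply: (@derive1_at_max R _ (- r) r) => //.
  - by rewrite ge0_cp // ltW.
  - move=> t /inU Ut.
    by case: (is_derive_line (smooth_derivable (v := v) sf Ut)).
  - by move=> t /inU Ut; rewrite scale0r add0r; exact: fz.
by rewrite derive1E.
Qed.

(** The first derivative vanishes at z, so a positive second derivative, which stays positive
    nearby, would by two mean value steps give f(a v + z) > f z. *)
Lemma derive2_at_max f z v : smooth U f -> U z -> (forall w, U w -> f w <= f z) ->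
  'D_v ('D_v f) z <= 0.
Proof.
move=> sf Uz fz; rewrite leNgt; apply/negP => D2.
have D0 := derive_at_max v sf Uz fz.
have mvt1 (t : R) := @mean_value_line_open _ _ U f z v t sf.
have mvt2 (t : R) := @mean_value_line_open _ _ U _ z v t (smooth_derive v sf).
have cD := smooth_continuous (smooth_derive v (smooth_derive v sf)) Uz.
suff contra (D1 E : V -> R) : D1 z = 0 -> 0 < E z -> {for z, continuous E} ->
    (forall a : R, (forall t : R, 0 <= t <= 1 -> U ((t * a) *: v + z)) ->
      exists2 t : R, 0 < t < 1 & f (a *: v + z) - f z = a * D1 ((t * a) *: v + z)) ->
    (forall a : R, (forall t : R, 0 <= t <= 1 -> U ((t * a) *: v + z)) ->
      exists2 t : R, 0 < t < 1 & D1 (a *: v + z) - D1 z = a * E ((t * a) *: v + z)) ->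
    False.
  exact: (contra ('D_v f) ('D_v ('D_v f)) D0 D2 cD mvt1 mvt2).
move=> {mvt1 mvt2 cD D0 D2} D0 Ez cE mvt1 mvt2.
have : \forall p \near z, U p /\ `|E z - E p| < E z.
  have /cvgrPdist_lt/(_ _ Ez) c1 := cE.
  have c2 : \forall y \near z, U y by exact: open_nbhs_nbhs.
  exact: filterI c2 c1.
case/nbhs_normP => r /= r0 rP.
pose a := r / 2 / (`|v| + 1).
have v1 : 0 < `|v| + 1 by rewrite ltr_wpDl.
have a0 : 0 < a by rewrite !divr_gt0.
have near_z (t : R) : 0 <= t <= a -> U (t *: v + z) /\ 0 < E (t *: v + z).
  move=> /andP[t0 ta]; have [] : U (t *: v + z) /\ `|E z - E (t *: v + z)| < E z.
    apply: rP => /=; rewrite opprD addrCA subrr addr0 normrN normrZ ger0_norm //.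
    apply: (@le_lt_trans _ _ (a * (`|v| + 1))).
      by rewrite ler_pM // lerDl.
    by rewrite /a divfK ?gt_eqF // ltr_pdivrMr // ltr_pMr // ltr1n.
  move=> Ut; rewrite ltr_norml => /andP[_ H]; split => //.
  by rewrite ltrBlDr ltrDl in H.
have seg (b : R) : 0 <= b <= a -> forall t : R, 0 <= t <= 1 -> 0 <= t * b <= a.
  move=> /andP[b0 ba] t /andP[t0 t1]; rewrite mulr_ge0 //=.
  by rewrite (le_trans _ ba) // ler_piMl.
have aa : 0 <= a <= a by rewrite lexx ltW.
have [t t01 E1] : exists2 t : R, 0 < t < 1 &
    f (a *: v + z) - f z = a * D1 ((t * a) *: v + z).
  by apply: mvt1 => t t01; case: (near_z _ (seg _ aa t t01)).
have [t0 t1] := andP t01.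
have ta : 0 <= t * a <= a by apply: seg => //; rewrite !ltW.
have [u /andP[u0 u1] E2] : exists2 u : R, 0 < u < 1 &
    D1 ((t * a) *: v + z) - D1 z = (t * a) * E ((u * (t * a)) *: v + z).
  by apply: mvt2 => u u01; case: (near_z _ (seg _ ta u u01)).
have Eu : 0 < E ((u * (t * a)) *: v + z).
  by apply: (near_z _ _).2; apply: seg => //; rewrite !ltW.
have Ua : U (a *: v + z) by case: (near_z _ aa).
have := fz _ Ua; rewrite -subr_le0 E1 leNgt => /negP; apply.
by move: E2; rewrite D0 subr0 => ->; rewrite !mulr_gt0.
Qed.

End ChainRule.

(** * Complex-valued smooth functions and first-order operators *)

Section ComplexCalculus.
Variables (R : realType) (V : normedModType R) (U : set V).
Hypothesis oU : open U.
Local Notation C := R[i].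
Implicit Types (f g : V -> C) (z v w : V).

Lemma csmooth_ext f g : (forall z, U z -> f z = g z) -> csmooth U f -> csmooth U g.
Proof.
move=> fg [sr si]; split.
  by apply: smooth_ext sr => // z Uz; rewrite fg.
by apply: smooth_ext si => // z Uz; rewrite fg.
Qed.

Lemma csmooth_cst (c : C) : csmooth U (fun=> c).
Proof. by split; exact: smooth_cst. Qed.

Lemma csmooth_real (f : V -> R) : smooth U f -> csmooth U (fun z => (f z)%:C).
Proof. by move=> sf; split => //; exact: smooth_cst. Qed.

Lemma ReD (x y : C) : complex.Re (x + y) = complex.Re x + complex.Re y.
Proof. by case: x y => [a b] [c d]. Qed.

Lemma ImD (x y : C) : complex.Im (x + y) = complex.Im x + complex.Im y.
Proof. by case: x y => [a b] [c d]. Qed.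

Lemma ReM (x y : C) : complex.Re (x * y) =
  complex.Re x * complex.Re y - complex.Im x * complex.Im y.
Proof. by case: x y => [a b] [c d]. Qed.

Lemma ImM (x y : C) : complex.Im (x * y) =
  complex.Re x * complex.Im y + complex.Im x * complex.Re y.
Proof. by case: x y => [a b] [c d]. Qed.

Lemma csmoothD f g : csmooth U f -> csmooth U g -> csmooth U (fun z => f z + g z).
Proof.
move=> [fr fi] [gr gi]; split.
  by apply: smooth_ext (smoothD oU fr gr) => // z _; rewrite ReD.
by apply: smooth_ext (smoothD oU fi gi) => // z _; rewrite ImD.
Qed.

Lemma csmoothM f g : csmooth U f -> csmooth U g -> csmooth U (fun z => f z * g z).
Proof.
move=> [fr fi] [gr gi]; split.
  apply: smooth_ext (smoothB oU (smoothM oU fr gr) (smoothM oU fi gi)) => // z _.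
  by rewrite ReM.
apply: smooth_ext (smoothD oU (smoothM oU fr gi) (smoothM oU fi gr)) => // z _.
by rewrite ImM.
Qed.

Lemma csmoothN f : csmooth U f -> csmooth U (fun z => - f z).
Proof.
move=> sf; apply: csmooth_ext (csmoothM (csmooth_cst (-1)) sf) => z _.
by rewrite mulN1r.
Qed.

Lemma csmooth_conj f : csmooth U f -> csmooth U (fun z => (f z)^*).
Proof.
move=> [fr fi]; split; first by apply: smooth_ext fr => // z _; case: (f z).
by apply: smooth_ext (smoothN oU fi) => // z _; case: (f z).
Qed.

Lemma csmoothV f : (forall z, U z -> f z != 0) -> csmooth U f ->
  csmooth U (fun z => (f z)^-1).
Proof.
move=> f0 [fr fi].
pose n2 z := complex.Re (f z) * complex.Re (f z) + complex.Im (f z) * complex.Im (f z).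
have n20 z : U z -> n2 z != 0.
  move=> /f0; apply: contraNneq; rewrite /n2; case: (f z) => a b /= /eqP.
  rewrite -!expr2 paddr_eq0 ?sqr_ge0 // !sqrf_eq0 => /andP[/eqP-> /eqP->].
  exact: eqxx.
have sn := smoothV oU n20 (smoothD oU (smoothM oU fr fr) (smoothM oU fi fi)).
split.
  apply: smooth_ext (smoothM oU fr sn) => // z _.
  by rewrite /n2; case: (f z) => a b /=; rewrite -!expr2.
apply: smooth_ext (smoothM oU (smoothN oU fi) sn) => // z _.
by rewrite /n2; case: (f z) => a b /=; rewrite -!expr2 mulNr.
Qed.

Lemma csmooth_sum (I : Type) (r : seq I) (P : pred I) (F : I -> V -> C) :
  (forall i, csmooth U (F i)) -> csmooth U (fun z => \sum_(i <- r | P i) F i z).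
Proof.
move=> sF; elim: r => [|i r IH].
  by apply: csmooth_ext (csmooth_cst 0) => z _; rewrite big_nil.
case Pi : (P i).
  by apply: csmooth_ext (csmoothD (sF i) IH) => z _; rewrite big_cons Pi.
by apply: csmooth_ext IH => z _; rewrite big_cons Pi.
Qed.

Lemma csmooth_prod (I : Type) (r : seq I) (P : pred I) (F : I -> V -> C) :
  (forall i, csmooth U (F i)) -> csmooth U (fun z => \prod_(i <- r | P i) F i z).
Proof.
move=> sF; elim: r => [|i r IH].
  by apply: csmooth_ext (csmooth_cst 1) => z _; rewrite big_nil.
case Pi : (P i).
  by apply: csmooth_ext (csmoothM (sF i) IH) => z _; rewrite big_cons Pi.
by apply: csmooth_ext IH => z _; rewrite big_cons Pi.
Qed.

Lemma csmooth_cderive f v : csmooth U f -> csmooth U (cderive v f).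
Proof. by move=> [fr fi]; split; apply: smooth_derive. Qed.

Lemma cderive_ext f g z v : U z -> (forall w, U w -> f w = g w) ->
  cderive v f z = cderive v g z.
Proof.
move=> Uz fg; rewrite /cderive; congr (_ +i* _).
  by apply: (derive_ext oU _ Uz) => w /fg ->.
by apply: (derive_ext oU _ Uz) => w /fg ->.
Qed.

Lemma cderive_cst (c : C) z v : cderive v (fun=> c) z = 0.
Proof. by rewrite /cderive !derive_cst. Qed.

Lemma cderiveD f g z v : csmooth U f -> csmooth U g -> U z ->
  cderive v (fun w => f w + g w) z = cderive v f z + cderive v g z.
Proof.
move=> [fr fi] [gr gi] Uz; rewrite /cderive.
have -> : (fun w => complex.Re (f w + g w)) =
    (fun w => complex.Re (f w)) + (fun w => complex.Re (g w)).
  by apply/funext => w; rewrite ReD.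
have -> : (fun w => complex.Im (f w + g w)) =
    (fun w => complex.Im (f w)) + (fun w => complex.Im (g w)).
  by apply/funext => w; rewrite ImD.
by rewrite !deriveD //; exact: smooth_derivable Uz.
Qed.

Lemma cderiveM f g z v : csmooth U f -> csmooth U g -> U z ->
  cderive v (fun w => f w * g w) z = cderive v f z * g z + f z * cderive v g z.
Proof.
move=> [fr fi] [gr gi] Uz; rewrite /cderive.
have -> : (fun w => complex.Re (f w * g w)) =
    (fun w => complex.Re (f w)) * (fun w => complex.Re (g w))
    - (fun w => complex.Im (f w)) * (fun w => complex.Im (g w)).
  by apply/funext => w; rewrite ReM.
have -> : (fun w => complex.Im (f w * g w)) =
    (fun w => complex.Re (f w)) * (fun w => complex.Im (g w))
    + (fun w => complex.Im (f w)) * (fun w => complex.Re (g w)).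
  by apply/funext => w; rewrite ImM.
have d1 := smooth_derivable (v := v) fr Uz.
have d2 := smooth_derivable (v := v) fi Uz.
have d3 := smooth_derivable (v := v) gr Uz.
have d4 := smooth_derivable (v := v) gi Uz.
rewrite (deriveB (derivableM d1 d3) (derivableM d2 d4)).
rewrite (deriveD (derivableM d1 d4) (derivableM d2 d3)).
rewrite (deriveM d1 d3) (deriveM d2 d4) (deriveM d1 d4) (deriveM d2 d3).
move: ('D_v _ z) ('D_v _ z) ('D_v _ z) ('D_v _ z) => a b c d.
case: (f z) (g z) => [x y] [x' y'] /=.
by congr (_ +i* _); rewrite /GRing.scale /=; ring.
Qed.

Lemma cderive_conj f z v : csmooth U f -> U z ->
  cderive v (fun w => (f w)^*) z = (cderive v f z)^*.
Proof.
move=> [fr fi] Uz; rewrite /cderive /=; congr (_ +i* _).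
  by apply: (derive_ext oU _ Uz) => w _; case: (f w).
rewrite -(deriveN (smooth_derivable (v := v) fi Uz)).
apply: (derive_ext oU _ Uz) => w _.
by rewrite -[RHS]/(- complex.Im (f w)); case: (f w).
Qed.

Lemma cderive_exp (f : V -> R) z v : smooth U f -> U z ->
  cderive v (fun w => (expR (f w))%:C) z =
  (expR (f z))%:C * cderive v (fun w => (f w)%:C) z.
Proof.
move=> sf Uz; rewrite /cderive /= (derive_comp_expR v sf Uz) !derive_cst.
by apply/eqP; rewrite eq_complex /= !mulr0 !mul0r subr0 addr0 !eqxx.
Qed.

Lemma cderiveC f z v w : csmooth U f -> U z ->
  cderive v (cderive w f) z = cderive w (cderive v f) z.
Proof.
move=> [fr fi] Uz; have Er := Schwarz oU v w fr Uz; have Ei := Schwarz oU v w fi Uz.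
by rewrite /cderive /= Er Ei.
Qed.

(** The interface through which the matrix calculus sees d/dz and d/dzbar, so that their formulas
    need not be unfolded there. The field [der_exp] is present because the equation contains e^F. *)
Record derivation (D : (V -> C) -> V -> C) : Prop := Derivation {
  der_csmooth : forall f, csmooth U f -> csmooth U (D f);
  der_ext : forall f g z, U z -> (forall w, U w -> f w = g w) -> D f z = D g z;
  der_cst : forall (c : C) z, D (fun=> c) z = 0;
  derD : forall f g z, csmooth U f -> csmooth U g -> U z ->
    D (fun w => f w + g w) z = D f z + D g z;
  derM : forall f g z, csmooth U f -> csmooth U g -> U z ->
    D (fun w => f w * g w) z = D f z * g z + f z * D g z;
  der_exp : forall (f : V -> R) z, smooth U f -> U z ->
    D (fun w => (expR (f w))%:C) z = (expR (f z))%:C * D (fun w => (f w)%:C) z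
}.

(** The common shape of d/dz and d/dzbar, in a coordinate or along a complex vector: two real
    directions with constants such as 1/2 and -i/2. *)
Definition cdir (a b : C) (v w : V) (f : V -> C) (z : V) : C :=
  a * cderive v f z + b * cderive w f z.

Lemma cdir_derivation a b v w : derivation (cdir a b v w).
Proof.
split.
- move=> f sf; apply: csmoothD; apply: csmoothM; first exact: csmooth_cst.
  + exact: csmooth_cderive.
  + exact: csmooth_cst.
  + exact: csmooth_cderive.
- move=> f g z Uz fg; rewrite /cdir (cderive_ext v Uz fg).
  by rewrite (cderive_ext w Uz fg).
- by move=> c z; rewrite /cdir !cderive_cst !mulr0 addr0.
- by move=> f g z sf sg Uz; rewrite /cdir !cderiveD //; ring.
- by move=> f g z sf sg Uz; rewrite /cdir !cderiveM //; ring.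
- by move=> f z sf Uz; rewrite /cdir !cderive_exp //; ring.
Qed.

Lemma cderive_cdir a b v w f z x : csmooth U f -> U z ->
  cderive x (cdir a b v w f) z =
  a * cderive x (cderive v f) z + b * cderive x (cderive w f) z.
Proof.
move=> sf Uz; rewrite /cdir.
have sv := csmooth_cderive v sf; have sw := csmooth_cderive w sf.
rewrite (cderiveD x (csmoothM (csmooth_cst a) sv) (csmoothM (csmooth_cst b) sw) Uz).
rewrite (cderiveM x (csmooth_cst a) sv Uz) (cderiveM x (csmooth_cst b) sw Uz).
rewrite (cderive_cst a z x) (cderive_cst b z x).
move: (cderive x (cderive v f) z) (cderive x (cderive w f) z) => X Y.
by rewrite 2!mul0r 2!add0r.
Qed.

(** Constant coefficients leave only second derivatives, to which [Schwarz] applies; this is why a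
    constant frame produces no commutators. *)
Lemma cdirC a b v w a' b' v' w' f z : csmooth U f -> U z ->
  cdir a b v w (cdir a' b' v' w' f) z = cdir a' b' v' w' (cdir a b v w f) z.
Proof.
move=> sf Uz; rewrite {1 3}/cdir.
have E x := cderive_cdir a' b' v' w' x sf Uz.
have E' x := cderive_cdir a b v w x sf Uz.
rewrite !E !E'.
rewrite (cderiveC v v' sf Uz) (cderiveC v w' sf Uz).
rewrite (cderiveC w v' sf Uz) (cderiveC w w' sf Uz).
move: (cderive v' _ z) (cderive v' _ z) (cderive w' _ z) (cderive w' _ z).
by move=> x1 x2 x3 x4; ring.
Qed.

Lemma cdir_conj a b v w f z : csmooth U f -> U z ->
  cdir a b v w (fun x => (f x)^*) z = (cdir a^* b^* v w f z)^*.
Proof.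
move=> sf Uz; rewrite /cdir (cderive_conj v sf Uz) (cderive_conj w sf Uz).
by rewrite rmorphD !rmorphM /= !conjcK.
Qed.

End ComplexCalculus.

(** * Derivatives of inverses, traces and determinants of matrix functions *)

Section MatrixDerivation.
Variables (R : realType) (V : normedModType R) (U : set V).
Hypothesis oU : open U.
Local Notation C := R[i].
Implicit Types (f g : V -> C) (z : V).

Definition msmooth m n (A : V -> 'M[C]_(m, n)) : Prop :=
  forall i j, csmooth U (fun z => A z i j).

Definition mder (D : (V -> C) -> V -> C) m n (A : V -> 'M[C]_(m, n)) (z : V) :
  'M[C]_(m, n) := \matrix_(i, j) D (fun w => A w i j) z.

Lemma mderE (D : (V -> C) -> V -> C) m n (A : V -> 'M[C]_(m, n)) z i j :
  mder D A z i j = D (fun w => A w i j) z.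
Proof. by rewrite mxE. Qed.

Lemma mxtraceN n (A : 'M[C]_n) : \tr (- A) = - \tr A.
Proof. exact: raddfN. Qed.

Lemma msmoothM m n p (A : V -> 'M[C]_(m, n)) (B : V -> 'M[C]_(n, p)) :
  msmooth A -> msmooth B -> msmooth (fun z => A z *m B z).
Proof.
move=> sA sB i j.
apply: (csmooth_ext oU (f := fun z => \sum_k A z i k * B z k j)).
  by move=> z _; rewrite mxE.
by apply: csmooth_sum => // k; apply: csmoothM.
Qed.

Lemma msmooth_cst m n (A : 'M[C]_(m, n)) : msmooth (fun=> A).
Proof. by move=> i j; exact: csmooth_cst. Qed.

Lemma csmooth_tr n (A : V -> 'M[C]_n) : msmooth A -> csmooth U (fun z => \tr (A z)).
Proof. by move=> sA; rewrite /mxtrace; apply: csmooth_sum. Qed.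

Lemma csmooth_det n (A : V -> 'M[C]_n) : msmooth A -> csmooth U (fun z => \det (A z)).
Proof.
move=> sA; rewrite /determinant; apply: csmooth_sum => // s.
by apply: csmoothM => //; [exact: csmooth_cst | apply: csmooth_prod].
Qed.

Lemma msmooth_inv n (A : V -> 'M[C]_n) : (forall z, U z -> A z \in unitmx) ->
  msmooth A -> msmooth (fun z => invmx (A z)).
Proof.
move=> uA sA i j.
apply: (csmooth_ext oU (f := fun z => (\det (A z))^-1 *
   ((-1) ^+ (j + i) * \det (row' j (col' i (A z)))))).
  by move=> z Uz; rewrite /invmx uA // !mxE.
apply: csmoothM => //.
  apply: (csmoothV oU _ (csmooth_det sA)) => z /uA.
  by rewrite unitmxE unitfE.
apply: csmoothM => //; first exact: csmooth_cst.
apply: csmooth_det => k l; apply: csmooth_ext (sA (lift j k) (lift i l)) => // z _.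
by rewrite !mxE.
Qed.

Section OneDerivation.
Variables (D : (V -> C) -> V -> C) (hD : derivation U D).

Lemma msmooth_mder m n (A : V -> 'M[C]_(m, n)) : msmooth A -> msmooth (mder D A).
Proof.
move=> sA i j; apply: csmooth_ext (der_csmooth hD (sA i j)) => // z _.
by rewrite mxE.
Qed.

Lemma mder_ext m n (A B : V -> 'M[C]_(m, n)) z : U z ->
  (forall w, U w -> A w = B w) -> mder D A z = mder D B z.
Proof.
move=> Uz AB; apply/matrixP => i j; rewrite !mxE.
by apply: (der_ext hD Uz) => w /AB ->.
Qed.

Lemma der_sum (I : Type) (r : seq I) (P : pred I) (F : I -> V -> C) z :
  (forall i, csmooth U (F i)) -> U z ->
  D (fun w => \sum_(i <- r | P i) F i w) z = \sum_(i <- r | P i) D (F i) z.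
Proof.
move=> sF Uz; elim: r => [|i r IH].
  rewrite big_nil -[RHS](der_cst hD 0 z); apply: (der_ext hD Uz) => w _.
  by rewrite big_nil.
rewrite big_cons; case: ifP => Pi.
  have sS : csmooth U (fun w => \sum_(j <- r | P j) F j w) by apply: csmooth_sum.
  rewrite -IH -(derD hD (sF i) sS Uz).
  by apply: (der_ext hD Uz) => w _; rewrite big_cons Pi.
by rewrite -IH; apply: (der_ext hD Uz) => w _; rewrite big_cons Pi.
Qed.

Lemma derZ (c : C) f z : csmooth U f -> U z ->
  D (fun w => c * f w) z = c * D f z.
Proof.
move=> sf Uz; rewrite (derM hD (csmooth_cst oU c) sf Uz) (der_cst hD c z).
by rewrite mul0r add0r.
Qed.

Lemma derN f z : csmooth U f -> U z -> D (fun w => - f w) z = - D f z.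
Proof.
move=> sf Uz; rewrite -[RHS]mulN1r -(derZ (-1) sf Uz).
by apply: (der_ext hD Uz) => w _; rewrite mulN1r.
Qed.

Lemma der_tr n (A : V -> 'M[C]_n) z : msmooth A -> U z ->
  D (fun w => \tr (A w)) z = \tr (mder D A z).
Proof.
move=> sA Uz; rewrite /mxtrace der_sum //.
by apply: eq_bigr => i _; rewrite mxE.
Qed.

Lemma mderM m n p (A : V -> 'M[C]_(m, n)) (B : V -> 'M[C]_(n, p)) z :
  msmooth A -> msmooth B -> U z ->
  mder D (fun w => A w *m B w) z = mder D A z *m B z + A z *m mder D B z.
Proof.
move=> sA sB Uz; apply/matrixP => i j; rewrite !mxE -big_split /=.
transitivity (D (fun w => \sum_k A w i k * B w k j) z).
  by apply: (der_ext hD Uz) => w _; rewrite mxE.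
rewrite der_sum //; last by move=> k; apply: csmoothM.
by apply: eq_bigr => k _; rewrite (derM hD (sA i k) (sB k j) Uz) !mxE.
Qed.

Lemma mder_cst m n (A : 'M[C]_(m, n)) z : mder D (fun=> A) z = 0.
Proof. by apply/matrixP => i j; rewrite !mxE (der_cst hD). Qed.

Lemma mderN m n (A : V -> 'M[C]_(m, n)) z : msmooth A -> U z ->
  mder D (fun w => - A w) z = - mder D A z.
Proof.
move=> sA Uz; apply/matrixP => i j; rewrite !mxE -(derN (sA i j) Uz).
by apply: (der_ext hD Uz) => w _; rewrite mxE.
Qed.

Lemma mder_inv n (A : V -> 'M[C]_n) z : (forall w, U w -> A w \in unitmx) ->
  msmooth A -> U z ->
  mder D (fun w => invmx (A w)) z =
    - (invmx (A z) *m mder D A z *m invmx (A z)).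
Proof.
move=> uA sA Uz; have sI := msmooth_inv uA sA.
have H : mder D (fun w => invmx (A w) *m A w) z = 0.
  rewrite -(mder_cst (1%:M : 'M[C]_n) z); apply: mder_ext => // w Uw.
  by rewrite mulVmx // uA.
rewrite (mderM sI sA Uz) in H.
have {}H : mder D (fun w => invmx (A w)) z *m A z = - (invmx (A z) *m mder D A z).
  by apply/eqP; rewrite -addr_eq0 H.
by rewrite -[LHS](mulmxK (uA _ Uz)) H mulNmx.
Qed.

(** Jacobi's formula. Differentiating the Leibniz products gives a sum of determinants in which one
    row is differentiated; expanding each along that row produces the cofactors. *)
Lemma der_det n (A : V -> 'M[C]_n) z : msmooth A -> U z ->
  D (fun w => \det (A w)) z = \tr (\adj (A z) *m mder D A z).
Proof.
move=> sA Uz.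
have sp (s : 'S_n) : csmooth U (fun w => \prod_i A w i (s i)) by exact: csmooth_prod.
rewrite /determinant der_sum; last 2 first.
- by move=> s; apply: csmoothM => //; exact: csmooth_cst.
- exact: Uz.
have prodD (r : seq 'I_n) (F : 'I_n -> V -> C) : uniq r ->
    (forall i, csmooth U (F i)) ->
    D (fun w => \prod_(i <- r) F i w) z =
    \sum_(i <- r) \prod_(j <- r) (if j == i then D (F i) z else F j z).
  move=> ur sF; elim: r ur => [_|i r IH /= /andP[ir ur]].
    rewrite big_nil -[RHS](der_cst hD 1 z); apply: (der_ext hD Uz) => w _.
    by rewrite big_nil.
  have sP : csmooth U (fun w => \prod_(j <- r) F j w) by exact: csmooth_prod.
  transitivity (D (fun w => F i w * \prod_(j <- r) F j w) z).
    by apply: (der_ext hD Uz) => w _; rewrite big_cons.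
  rewrite (derM hD (sF i) sP Uz) IH // big_cons big_cons eqxx; congr (_ + _).
    congr (_ * _); rewrite big_seq [RHS]big_seq; apply: eq_bigr => j jr.
    by case: eqP => // ji; rewrite -ji jr in ir.
  rewrite mulr_sumr big_seq [RHS]big_seq; apply: eq_bigr => j jr.
  rewrite big_cons; case: eqP => // ij; by rewrite ij jr in ir.
transitivity (\sum_i \det (\matrix_(k, j) if k == i then mder D A z k j else A z k j)).
  transitivity (\sum_(s : 'S_n) \sum_i (-1) ^+ s *
      \prod_j (if j == i then mder D A z j (s j) else A z j (s j))).
    apply: eq_bigr => s _; rewrite (derZ _ (sp s) Uz) -mulr_sumr; congr (_ * _).
    rewrite prodD; last 2 first.
    - exact: index_enum_uniq.
    - by move=> i.
    apply: eq_bigr => i _; apply: eq_bigr => j _.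
    by case: eqP => // ->; rewrite mxE.
  rewrite exchange_big /=; apply: eq_bigr => i _; apply: eq_bigr => s _.
  by congr (_ * _); apply: eq_bigr => j _; rewrite !mxE.
rewrite mxtrace_mulC /mxtrace; apply: eq_bigr => i _.
rewrite (expand_det_row _ i) mxE; apply: eq_bigr => j _.
rewrite !mxE eqxx; congr (_ * _).
rewrite /cofactor; congr (_ * \det _); apply/matrixP => k l; rewrite !mxE.
by rewrite eq_sym (negbTE (neq_lift _ _)).
Qed.

(** Differentiate det h = e^F det g itself and cancel det h: this gives d log det h - d log det g
    without a complex logarithm. *)
Lemma der_log_det n (h g : V -> 'M[C]_n) (F : V -> R) z :
  (forall w, U w -> h w \in unitmx) -> (forall w, U w -> g w \in unitmx) ->
  msmooth h -> msmooth g -> smooth U F ->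
  (forall w, U w -> \det (h w) = (expR (F w))%:C * \det (g w)) -> U z ->
  D (fun w => (F w)%:C) z =
    \tr (invmx (h z) *m mder D h z) - \tr (invmx (g z) *m mder D g z).
Proof.
move=> uh ug sh sg sF E Uz.
have adjE (A : 'M[C]_n) : A \in unitmx -> \adj A = \det A *: invmx A.
  move=> uA; have dA0 : \det A != 0 by move: uA; rewrite unitmxE unitfE.
  by rewrite /invmx uA scalerA divff // scale1r.
have sE : csmooth U (fun w => (expR (F w))%:C).
  exact (csmooth_real oU (smooth_expR oU sF)).
have H : D (fun w => \det (h w)) z = D (fun w => (expR (F w))%:C * \det (g w)) z.
  exact (der_ext hD Uz E).
rewrite (derM hD sE (csmooth_det sg) Uz) (der_exp hD sF Uz) in H.
rewrite !der_det // !adjE ?uh ?ug // -!scalemxAl !mxtraceZ in H.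
have dh0 : \det (h z) != 0 by move: (uh z Uz); rewrite unitmxE unitfE.
apply: (mulfI dh0); rewrite mulrBr H; move: (E z Uz) => ->.
move: (D _ z) => X; ring.
Qed.

End OneDerivation.

Section TwoDerivations.
Variables (D D' : (V -> C) -> V -> C).
Hypotheses (hD : derivation U D) (hD' : derivation U D').

(** The place where the equation enters the estimate: it trades the traced second derivatives of g'
    for those of F, and leaves a term quadratic in the first derivatives of g' whose sign is
    favourable. *)
Lemma der2_log_det n (h g : V -> 'M[C]_n) (F : V -> R) z :
  (forall w, U w -> h w \in unitmx) -> (forall w, U w -> g w \in unitmx) ->
  msmooth h -> msmooth g -> smooth U F ->
  (forall w, U w -> \det (h w) = (expR (F w))%:C * \det (g w)) -> U z ->
  D (D' (fun w => (F w)%:C)) z =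
    \tr (invmx (h z) *m mder D (mder D' h) z)
    - \tr (invmx (h z) *m mder D h z *m invmx (h z) *m mder D' h z)
    - (\tr (invmx (g z) *m mder D (mder D' g) z)
    - \tr (invmx (g z) *m mder D g z *m invmx (g z) *m mder D' g z)).
Proof.
move=> uh ug sh sg sF E Uz.
have trD (A : V -> 'M[C]_n) : (forall w, U w -> A w \in unitmx) -> msmooth A ->
    msmooth (fun w => invmx (A w) *m mder D' A w) /\
    D (fun w => \tr (invmx (A w) *m mder D' A w)) z =
    \tr (invmx (A z) *m mder D (mder D' A) z)
    - \tr (invmx (A z) *m mder D A z *m invmx (A z) *m mder D' A z).
  move=> uA sA; have sI := msmooth_inv uA sA; have sD := msmooth_mder hD' sA.
  have sM := msmoothM sI sD; split=> //.
  rewrite (der_tr hD sM Uz) (mderM hD sI sD Uz) (mder_inv hD uA sA Uz).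
  by rewrite mxtraceD mulNmx mxtraceN addrC.
have [sMh <-] := trD h uh sh; have [sMg <-] := trD g ug sg.
have sTh := csmooth_tr sMh; have sTg := csmooth_tr sMg.
rewrite -(derN hD sTg Uz) -(derD hD sTh (csmoothN oU sTg) Uz).
by apply: (der_ext hD Uz) => w Uw; exact: (der_log_det hD').
Qed.

Lemma der_trace_inv n (h g : V -> 'M[C]_n) z :
  (forall w, U w -> g w \in unitmx) -> msmooth h -> msmooth g ->
  U z -> g z = 1%:M ->
  D (fun w => \tr (invmx (g w) *m h w)) z = \tr (mder D h z) - \tr (mder D g z *m h z).
Proof.
move=> ug sh sg Uz gz; have sI := msmooth_inv ug sg.
rewrite (der_tr hD (msmoothM sI sh) Uz) (mderM hD sI sh Uz) (mder_inv hD ug sg Uz).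
by rewrite gz invmx1 !mul1mx mulmx1 mxtraceD mulNmx mxtraceN addrC.
Qed.

(** The normalization g = 1 holds at the single point z, so it may be used only after both
    differentiations of g^-1 h. *)
Lemma der2_trace_inv n (h g : V -> 'M[C]_n) z :
  (forall w, U w -> g w \in unitmx) -> msmooth h -> msmooth g ->
  U z -> g z = 1%:M ->
  let a := mder D g z in let b := mder D' g z in
  let c := mder D (mder D' g) z in
  D (D' (fun w => \tr (invmx (g w) *m h w))) z =
    \tr ((a *m b + b *m a - c) *m h z) - \tr (b *m mder D h z)
    - \tr (a *m mder D' h z) + \tr (mder D (mder D' h) z).
Proof.
move=> ug sh sg Uz gz a b c; have sI := msmooth_inv ug sg.
have sD'h := msmooth_mder hD' sh; have sD'g := msmooth_mder hD' sg.
have s1 := msmoothM sI sD'g; have s2 := msmoothM s1 sI.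
have s3 := msmoothM s2 sh; have s4 := msmoothM sI sD'h.
have sN : msmooth (fun w => - (invmx (g w) *m mder D' g w *m invmx (g w) *m h w)).
  move=> i j; apply: csmooth_ext (csmoothN oU (s3 i j)) => // w _.
  by rewrite [RHS]mxE.
transitivity (D (fun w => \tr (invmx (g w) *m mder D' h w)
   + \tr (- (invmx (g w) *m mder D' g w *m invmx (g w) *m h w))) z).
  apply: (der_ext hD Uz) => w Uw.
  rewrite (der_tr hD' (msmoothM sI sh) Uw) (mderM hD' sI sh Uw).
  by rewrite (mder_inv hD' ug sg Uw) mxtraceD mulNmx addrC.
rewrite (derD hD (csmooth_tr s4) (csmooth_tr sN) Uz).
rewrite (der_tr hD s4 Uz) (der_tr hD sN Uz) (mderN hD s3 Uz) mxtraceN.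
rewrite (mderM hD sI sD'h Uz) (mderM hD s2 sh Uz) (mderM hD s1 sI Uz).
rewrite (mderM hD sI sD'g Uz) (mder_inv hD ug sg Uz).
rewrite gz invmx1 !mul1mx !mulmx1 -/a -/b -/c.
move: (mder D h z) (mder D' h z) (mder D (mder D' h) z) (h z) => p q r x.
clearbody a b c => {sI sD'h sD'g s1 s2 s3 s4 sN}.
rewrite !mulNmx !mulmxN !mulmxDl !mulNmx !mxtraceD !mxtraceN.
move: (\tr (a *m _)) (\tr (a *m b *m _)) (\tr (b *m a *m _)) (\tr (c *m _)) (\tr (b *m _)).
move=> x1 x2 x3 x4 x5; ring.
Qed.

End TwoDerivations.
End MatrixDerivation.

(** * Real inequalities at the maximum point *)

Section MaximumPrincipleAlgebra.
Variables (R : realFieldType) (n : nat).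
Implicit Types (l : 'I_n -> R) (K A D y : R).

(** The difference of the two sides is a variance: the sum of l i times the squared deviation of x i
    / l i from its weighted mean X / S. *)
Lemma Cauchy_weighted l (x : 'I_n -> R) : (forall i, 0 < l i) ->
  0 < \sum_i l i -> (\sum_i x i) ^+ 2 / (\sum_i l i) <= \sum_i x i ^+ 2 / l i.
Proof.
move=> l0; set S := \sum_i l i; set X := \sum_i x i => S0.
have H : 0 <= \sum_i l i * (x i / l i - X / S) ^+ 2.
  by apply: sumr_ge0 => i _; rewrite mulr_ge0 ?sqr_ge0 // ltW.
have E : \sum_i l i * (x i / l i - X / S) ^+ 2 =
    \sum_i x i ^+ 2 / l i - X ^+ 2 / S.
  transitivity (\sum_i (x i ^+ 2 / l i - 2 * (X / S) * x i + (X / S) ^+ 2 * l i)).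
    by apply: eq_bigr => i _; field; rewrite !gt_eqF.
  rewrite big_split /= sumrB -!mulr_sumr -/X -/S.
  by field; rewrite gt_eqF.
by rewrite -subr_ge0 -E.
Qed.

(* H p i j and a p i j stand for (the real or imaginary parts of) d_p g'_ij and
   d_p g_ij, whose antisymmetrizations in (p, i) agree since g' - g is ddbar
   exact.  Complete the square in H - l a and keep only the diagonal terms,
   whose sum is the gradient s of the trace corrected by the torsion T. *)
Lemma torsion_inequality l (a H : 'I_n -> 'I_n -> 'I_n -> R) K
    (S := \sum_i l i) (tau := \sum_i (l i)^-1)
    (s := fun p => \sum_i (H p i i - a p i i * l i))
    (T := fun p => \sum_i (a p i i - a i p i)) :
  (forall i, 0 < l i) -> 0 < \sum_i l i ->
  (forall p i j, `|a p i j| <= K) ->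
  (forall p i j, H p i j - H i p j = a p i j - a i p j) ->
  \sum_p (l p)^-1 * ((s p - T p) ^+ 2 / S)
    - 4 * K ^+ 2 * n%:R ^+ 2 * tau - n%:R * K ^+ 2 * S * tau <=
  \sum_i \sum_p \sum_j (H i p j) ^+ 2 / (l p * l j)
   - 2 * \sum_p \sum_i \sum_j (l p)^-1 * (a p i j * H p i j).
Proof.
move=> l0 S0 aK Ht.
have a2 p i j : a p i j ^+ 2 <= K ^+ 2.
  by rewrite -[X in X <= _]real_normK ?num_real // lerXn2r ?nnegrE // (le_trans _ (aK p i j)).
have lV0 i : 0 <= (l i)^-1 by rewrite invr_ge0 ltW.
have -> : \sum_i \sum_p \sum_j (H i p j) ^+ 2 / (l p * l j)
   - 2 * \sum_p \sum_i \sum_j (l p)^-1 * (a p i j * H p i j) =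
   \sum_p (l p)^-1 * (\sum_i \sum_j ((H i p j - l j * a p i j) ^+ 2 / l j))
   - \sum_p (l p)^-1 * \sum_i \sum_j (l j * a p i j ^+ 2)
   - \sum_p (l p)^-1 * \sum_i \sum_j (2 * a p i j * (a p i j - a i p j)).
  rewrite exchange_big /= mulr_sumr -!sumrB; apply: eq_bigr => p _.
  rewrite !mulr_sumr -!sumrB; apply: eq_bigr => i _.
  rewrite !mulr_sumr -!sumrB; apply: eq_bigr => j _.
  rewrite -Ht; field; by rewrite !gt_eqF.
have H1 : \sum_p (l p)^-1 * ((s p - T p) ^+ 2 / S) <=
    \sum_p (l p)^-1 * (\sum_i \sum_j ((H i p j - l j * a p i j) ^+ 2 / l j)).
  apply: ler_sum => p _; apply: ler_wpM2l => //.
  have -> : s p - T p = \sum_i (H i p i - l i * a p i i).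
    rewrite /s /T -sumrB; apply: eq_bigr => i _.
    by rewrite -[a p i i - a i p i]Ht; ring.
  apply: (le_trans (Cauchy_weighted _ l0 S0)); apply: ler_sum => i _.
  rewrite (bigD1 i) //= lerDl; apply: sumr_ge0 => j _.
  by rewrite divr_ge0 ?sqr_ge0 // ltW.
have H2 : \sum_p (l p)^-1 * \sum_i \sum_j (l j * a p i j ^+ 2) <=
    n%:R * K ^+ 2 * S * tau.
  rewrite /tau mulr_sumr; apply: ler_sum => p _; rewrite mulrC ler_wpM2r //.
  apply: (@le_trans _ _ (\sum_(i < n) K ^+ 2 * S)).
    apply: ler_sum => i _; rewrite /S mulr_sumr; apply: ler_sum => j _.
    by rewrite mulrC ler_wpM2r // ltW.
  by rewrite sumr_const card_ord -[_ *+ n]mulr_natl mulrA.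
have H3 : \sum_p (l p)^-1 * \sum_i \sum_j (2 * a p i j * (a p i j - a i p j)) <=
    4 * K ^+ 2 * n%:R ^+ 2 * tau.
  rewrite /tau mulr_sumr; apply: ler_sum => p _; rewrite mulrC ler_wpM2r //.
  apply: (@le_trans _ _ (\sum_(i < n) \sum_(j < n) 4 * K ^+ 2)).
    apply: ler_sum => i _; apply: ler_sum => j _.
    have := a2 p i j; have := a2 i p j; have := sqr_ge0 (a p i j + a i p j).
    by rewrite sqrrD; nra.
  rewrite !sumr_const !card_ord -[_ *+ n *+ n]mulrnA -[_ *+ (n * n)]mulr_natr.
  by rewrite natrM expr2.
by lra.
Qed.

(** The equations for sx and sy are the first-order condition at the maximum of Q, and the
    inequality for each p is the second-order condition along a frame vector. In the sum of the
    latter with weights 1 / l p, the coefficient of tau is at least A - N1 - N2 - 1: N1 and N2 come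
    from the lower bound on the weighted sum of LS, divided by S >= 1, and completing the square
    costs 1/2 each for the real and imaginary parts. The choice of A makes this coefficient 1. *)
Lemma maximum_principle_bound l (LS sx sy px py Tx Ty : 'I_n -> R)
    K A D y N0 N1 N2 (S := \sum_i l i) (tau := \sum_i (l i)^-1) :
  (forall i, 0 < l i) -> 1 <= S -> 1 <= y -> 0 <= N0 -> 0 <= N1 -> 0 <= N2 ->
  A = N1 + N2 + 2 ->
  (forall p, sx p = S * ((A + y ^- 2) * px p)) ->
  (forall p, sy p = S * ((A + y ^- 2) * py p)) ->
  (forall p, LS p / S - (sx p ^+ 2 + sy p ^+ 2) / S ^+ 2
     - (A + y ^- 2) * (l p - 1) + 2 * (px p ^+ 2 + py p ^+ 2) / y ^+ 3 <= 0) ->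
  D - N0 - N1 * tau - N2 * S * tau
    + \sum_p (l p)^-1 * ((sx p - Tx p) ^+ 2 / S)
    + \sum_p (l p)^-1 * ((sy p - Ty p) ^+ 2 / S) <= \sum_p (l p)^-1 * LS p ->
  (forall p, `|Tx p| <= K) -> (forall p, `|Ty p| <= K) ->
  (A + 1) ^+ 2 * K ^+ 2 * y ^+ 3 <= S ^+ 2 ->
  tau <= `|D| + N0 + (A + 1) * n%:R.
Proof.
move=> l0 S1 y1 N00 N10 N20 EA Esx Esy HQ HL HTx HTy Hbig.
have S0 : 0 < S by lra.
have y0 : 0 < y by lra.
have A0 : 0 <= A by lra.
have tau0 : 0 <= tau by apply: sumr_ge0 => p _; rewrite invr_ge0 ltW.
have y2 : 0 < y ^- 2 by rewrite invr_gt0 exprn_gt0.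
have y2' : y ^- 2 <= 1 by rewrite invf_le1 ?exprn_gt0 // exprn_ege1.
set B := A + y ^- 2.
have B0 : 0 <= B by rewrite /B; lra.
have BA : B <= A + 1 by rewrite /B; lra.
(* Complete the square in x: the last term, which comes from the Hessian of
   1 / y, pays for the product of s and T. *)
have gradient (s x T : R) : s = S * (B * x) -> `|T| <= K ->
    - 2^-1 <= ((s - T) ^+ 2 - s ^+ 2) / S ^+ 2 + 2 * x ^+ 2 / y ^+ 3.
  move=> -> TK.
  have E : ((S * (B * x) - T) ^+ 2 - (S * (B * x)) ^+ 2) / S ^+ 2
     + 2 * x ^+ 2 / y ^+ 3 =
     2 / y ^+ 3 * (x - B * T * y ^+ 3 / (2 * S)) ^+ 2 + T ^+ 2 / S ^+ 2
     - 2^-1 * ((B ^+ 2 * T ^+ 2 * y ^+ 3) / S ^+ 2).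
    by field; rewrite !gt_eqF.
  rewrite E.
  have q1 : 0 <= 2 / y ^+ 3 * (x - B * T * y ^+ 3 / (2 * S)) ^+ 2.
    by rewrite mulr_ge0 ?sqr_ge0 // divr_ge0 // exprn_ge0 // ltW.
  have q2 : 0 <= T ^+ 2 / S ^+ 2 by rewrite divr_ge0 ?sqr_ge0.
  have q3 : (B ^+ 2 * T ^+ 2 * y ^+ 3) / S ^+ 2 <= 1.
    rewrite ler_pdivrMr ?exprn_gt0 // mul1r; apply: le_trans Hbig.
    apply: ler_wpM2r; first by rewrite exprn_ge0 // ltW.
    apply: ler_pM; rewrite ?sqr_ge0 //.
      by rewrite lerXn2r ?nnegrE //; lra.
    rewrite -[X in X <= _]real_normK ?num_real // lerXn2r ?nnegrE //.
    exact: le_trans TK.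
  by lra.
have key : \sum_p (l p)^-1 * (LS p / S - (sx p ^+ 2 + sy p ^+ 2) / S ^+ 2
     - B * (l p - 1) + 2 * (px p ^+ 2 + py p ^+ 2) / y ^+ 3) <= 0.
  rewrite -oppr_ge0 -sumrN; apply: sumr_ge0 => p _.
  rewrite -mulrN; apply: mulr_ge0; first by rewrite invr_ge0 ltW.
  by rewrite oppr_ge0; exact: HQ.
have low : \sum_p (l p)^-1 * (LS p / S - ((sx p - Tx p) ^+ 2 / S + (sy p - Ty p) ^+ 2 / S) / S
     - B * (l p - 1) - 1) <=
   \sum_p (l p)^-1 * (LS p / S - (sx p ^+ 2 + sy p ^+ 2) / S ^+ 2
     - B * (l p - 1) + 2 * (px p ^+ 2 + py p ^+ 2) / y ^+ 3).
  apply: ler_sum => p _; apply: ler_wpM2l; first by rewrite invr_ge0 ltW.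
  have g1 := gradient _ _ _ (Esx p) (HTx p).
  have g2 := gradient _ _ _ (Esy p) (HTy p).
  have e1 (u v : R) : (u / S + v / S) / S = (u + v) / S ^+ 2.
    by rewrite -mulrDl -mulrA -invfM -expr2.
  by rewrite e1; lra.
have split_sum : \sum_p (l p)^-1 * (LS p / S - ((sx p - Tx p) ^+ 2 / S + (sy p - Ty p) ^+ 2 / S) / S
     - B * (l p - 1) - 1) =
   (\sum_p (l p)^-1 * LS p - \sum_p (l p)^-1 * ((sx p - Tx p) ^+ 2 / S)
      - \sum_p (l p)^-1 * ((sy p - Ty p) ^+ 2 / S)) / S - B * n%:R + B * tau - tau.
  have -> : n%:R = \sum_(p < n) (1 : R) by rewrite sumr_const card_ord.
  rewrite /tau !mulr_sumr -!sumrB mulr_suml -sumrB -big_split -sumrB /=.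
  apply: eq_bigr => p _; field.
  by rewrite !gt_eqF.
have {key low} : (\sum_p (l p)^-1 * LS p - \sum_p (l p)^-1 * ((sx p - Tx p) ^+ 2 / S)
      - \sum_p (l p)^-1 * ((sy p - Ty p) ^+ 2 / S)) / S - B * n%:R + B * tau - tau <= 0.
  by rewrite -split_sum; exact: le_trans low key.
have : (D - N0 - N1 * tau - N2 * S * tau) / S <=
   (\sum_p (l p)^-1 * LS p - \sum_p (l p)^-1 * ((sx p - Tx p) ^+ 2 / S)
      - \sum_p (l p)^-1 * ((sy p - Ty p) ^+ 2 / S)) / S.
  by rewrite ler_pM2r ?invr_gt0 //; lra.
have : - (`|D| + N0 + N1 * tau + N2 * tau) <= (D - N0 - N1 * tau - N2 * S * tau) / S.
  rewrite ler_pdivlMr // mulNr.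
  have D1 : - `|D| * S <= D.
    apply: (@le_trans _ _ (- `|D|)); last by rewrite lerNl -normrN ler_norm.
    by rewrite mulNr lerN2 ler_peMr.
  have h0 : N0 <= N0 * S by rewrite ler_peMr.
  have h1 : N1 * tau <= N1 * tau * S by rewrite ler_peMr // mulr_ge0.
  by move: D1 h0 h1; rewrite !mulrDl mulNr; lra.
have Bn : B * n%:R <= (A + 1) * n%:R by rewrite ler_wpM2r.
have Bt : A * tau <= B * tau by rewrite ler_wpM2r // /B; lra.
move: Bn Bt; rewrite EA; set X := (_ - _ - _) / S.
move: (B * tau) (B * n%:R) => Bt Bn; rewrite !mulrDl; lra.
Qed.

(** Each l i is the product of all of them times the n - 1 inverses of the others, and every inverse
    is at most tau. *)
Lemma trace_le_inverse_trace l P (tau := \sum_i (l i)^-1) :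
  (forall i, 0 < l i) -> \prod_i l i <= P ->
  \sum_i l i <= n%:R * (P * tau ^+ n.-1).
Proof.
move=> l0 lP.
have tau0 : 0 <= tau by apply: sumr_ge0 => p _; rewrite invr_ge0 ltW.
have -> : n%:R * (P * tau ^+ n.-1) = \sum_(i < n) P * tau ^+ n.-1.
  by rewrite sumr_const card_ord mulr_natl.
apply: ler_sum => i _.
have E : l i = (\prod_j l j) * \prod_(j | j != i) (l j)^-1.
  rewrite (bigD1 i) //= -mulrA -big_split /= big1 ?mulr1 // => j _.
  by rewrite divff // gt_eqF.
rewrite E ler_pM //.
- by apply: prodr_ge0 => j _; rewrite ltW.
- by apply: prodr_ge0 => j _; rewrite invr_ge0 ltW.
have -> : n.-1 = #|[pred j : 'I_n | j != i]|.
  by have := cardC1 i; rewrite card_ord => <-; apply: eq_card.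
rewrite -prodr_const; apply: ler_prod => j _.
rewrite invr_ge0 (ltW (l0 j)) /= /tau (bigD1 j) //= lerDl.
by apply: sumr_ge0 => p _; rewrite invr_ge0 ltW.
Qed.

(* Here er and cr are the real parts of the second derivatives d_p d_pbar of g'_ii and
   g_ii; D bounds the Laplacian of F = ln det g' - ln det g and LS p is the
   expansion of d_p d_pbar S in the frame. *)
Lemma laplacian_trace_bound l (ax ay hx hy : 'I_n -> 'I_n -> 'I_n -> R)
    (cr er : 'I_n -> 'I_n -> R) (LS : 'I_n -> R) D k1 k2
    (S := \sum_i l i) (tau := \sum_i (l i)^-1) :
  (forall i, 0 < l i) -> 0 < S ->
  (forall p i j, ax p i j ^+ 2 + ay p i j ^+ 2 <= k1 ^+ 2) -> 0 <= k1 ->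
  (forall p i, `|cr p i| <= k2) ->
  (forall p i j, hx p i j - hx i p j = ax p i j - ax i p j) ->
  (forall p i j, hy p i j - hy i p j = ay p i j - ay i p j) ->
  (forall p i, er p i - er i p = cr p i - cr i p) ->
  D <= \sum_i (\sum_p (l p)^-1 * er i p
    - \sum_p \sum_q (hx i p q ^+ 2 + hy i p q ^+ 2) / (l p * l q)
    - (\sum_p cr i p - \sum_p \sum_q (ax i p q ^+ 2 + ay i p q ^+ 2))) ->
  (forall p, LS p = \sum_i (\sum_j (ax p i j ^+ 2 + ay p i j ^+ 2)
        + \sum_j (ax p j i ^+ 2 + ay p j i ^+ 2) - cr p i) * l i
     - 2 * \sum_i \sum_j (ax p i j * hx p i j + ay p i j * hy p i j)
     + \sum_i er p i) ->
  D - n%:R * (n%:R * k2 + n%:R ^+ 2 * k1 ^+ 2)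
    - (2 * n%:R * k2 + 8 * k1 ^+ 2 * n%:R ^+ 2) * tau
    - (k2 + 2 * n%:R * k1 ^+ 2) * S * tau
    + \sum_p (l p)^-1 *
      ((\sum_i (hx p i i - ax p i i * l i) - \sum_i (ax p i i - ax i p i)) ^+ 2 / S)
    + \sum_p (l p)^-1 *
      ((\sum_i (hy p i i - ay p i i * l i) - \sum_i (ay p i i - ay i p i)) ^+ 2 / S)
  <= \sum_p (l p)^-1 * LS p.
Proof.
move=> l0 S0 a2 k10 ck2 Htx Hty Her HD ELS.
have lV0 i : 0 <= (l i)^-1 by rewrite invr_ge0 ltW.
have tau0 : 0 <= tau by apply: sumr_ge0.
have sq_le (x y : R) : x ^+ 2 + y ^+ 2 <= k1 ^+ 2 -> `|x| <= k1.
  move=> xy; rewrite -(ler_pXn2r (n := 2)) ?nnegrE // real_normK ?num_real //.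
  by apply: le_trans xy; rewrite lerDl sqr_ge0.
have axk p i j : `|ax p i j| <= k1 by apply: sq_le (a2 p i j).
have ayk p i j : `|ay p i j| <= k1.
  by apply: (sq_le _ (ax p i j)); rewrite addrC.
have tx := torsion_inequality l0 S0 axk Htx.
have ty := torsion_inequality l0 S0 ayk Hty.
rewrite -/S -/tau in tx ty.
move: tx ty; set Gx := \sum_p (l p)^-1 * _; set Gy := \sum_p (l p)^-1 * (_ / S).
set Hx := \sum_i \sum_p \sum_j (hx i p j) ^+ 2 / (l p * l j).
set Hy := \sum_i \sum_p \sum_j (hy i p j) ^+ 2 / (l p * l j).
set Cx := \sum_p \sum_i \sum_j (l p)^-1 * (ax p i j * hx p i j).
set Cy := \sum_p \sum_i \sum_j (l p)^-1 * (ay p i j * hy p i j) => tx ty.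
set Er := \sum_p (l p)^-1 * \sum_i er i p.
(* Read as a lower bound on Er: it contains the squares Hx + Hy, which will absorb the products Cx +
   Cy by [tx] and [ty]. *)
have HD' : D <= Er - (Hx + Hy) + n%:R * (n%:R * k2 + n%:R ^+ 2 * k1 ^+ 2).
  apply: (le_trans HD); rewrite !sumrB -!addrA lerD //.
    by rewrite /Er exchange_big le_eqVlt /=; apply/orP; left; apply/eqP; apply: eq_bigr => p _; rewrite mulr_sumr.
  apply: lerD.
    rewrite lerN2 /Hx /Hy -big_split le_eqVlt /=; apply/orP; left; apply/eqP.
    apply: eq_bigr => i _; rewrite -big_split /=; apply: eq_bigr => p _.
    by rewrite -big_split /=; apply: eq_bigr => q _; rewrite mulrDl.
  rewrite -sumrB -sumrN.
  have -> : n%:R * (n%:R * k2 + n%:R ^+ 2 * k1 ^+ 2) =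
     \sum_(i < n) (\sum_(p < n) k2 + \sum_(p < n) \sum_(q < n) k1 ^+ 2).
    rewrite !sumr_const !card_ord -[_ *+ n *+ n]mulrnA -[_ *+ (n * n)]mulr_natl natrM -expr2.
    by rewrite -[k2 *+ n]mulr_natl mulr_natl.
  apply: ler_sum => i _; rewrite opprB addrC -sumrN; apply: lerD.
    by apply: ler_sum => p _; rewrite (le_trans _ (ck2 i p)) // -normrN ler_norm.
  by apply: ler_sum => p _; apply: ler_sum => q _; exact: a2.
(* LS p contains er p i while Er sums er i p; the symmetry [Her] exchanges them at a cost of 2 k2.
   The squares of ax and ay in LS p are nonnegative and are dropped. *)
have HS : Er - (k2 * S + 2 * n%:R * k2) * tau - 2 * (Cx + Cy) <= \sum_p (l p)^-1 * LS p.
  have -> : Er - (k2 * S + 2 * n%:R * k2) * tau - 2 * (Cx + Cy) =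
    \sum_p (l p)^-1 * (- (k2 * S)
     - 2 * \sum_i \sum_j (ax p i j * hx p i j + ay p i j * hy p i j)
     + (\sum_i er i p - 2 * n%:R * k2)).
    rewrite [RHS](eq_bigr (fun p => (l p)^-1 * (\sum_i er i p)
      - (k2 * S + 2 * n%:R * k2) * (l p)^-1
      - 2 * (\sum_i \sum_j (l p)^-1 * (ax p i j * hx p i j)
           + \sum_i \sum_j (l p)^-1 * (ay p i j * hy p i j)))).
      by rewrite !sumrB -!mulr_sumr big_split.
    move=> p _.
    have -> : \sum_i \sum_j (l p)^-1 * (ax p i j * hx p i j) +
       \sum_i \sum_j (l p)^-1 * (ay p i j * hy p i j) =
       (l p)^-1 * \sum_i \sum_j (ax p i j * hx p i j + ay p i j * hy p i j).
      rewrite mulr_sumr -big_split /=; apply: eq_bigr => i _.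
      by rewrite mulr_sumr -big_split /=; apply: eq_bigr => j _; rewrite mulrDr.
    by ring.
  apply: ler_sum => p _; apply: ler_wpM2l => //; rewrite ELS; apply: lerD.
    apply: lerD => //; rewrite /S mulr_sumr -sumrN; apply: ler_sum => i _.
    rewrite -mulNr; apply: ler_wpM2r; first exact: ltW.
    have p1 : 0 <= \sum_j (ax p i j ^+ 2 + ay p i j ^+ 2).
      by apply: sumr_ge0 => j _; rewrite addr_ge0 ?sqr_ge0.
    have p2 : 0 <= \sum_j (ax p j i ^+ 2 + ay p j i ^+ 2).
      by apply: sumr_ge0 => j _; rewrite addr_ge0 ?sqr_ge0.
    have := ck2 p i; rewrite ler_norml => /andP[_ ?]; lra.
  have -> : 2 * n%:R * k2 = \sum_(i < n) 2 * k2.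
    by rewrite sumr_const card_ord -[_ *+ n]mulr_natl; ring.
  rewrite -sumrB; apply: ler_sum => i _.
  have := Her p i; have := ck2 p i; have := ck2 i p; rewrite !ler_norml.
  by move=> /andP[? ?] /andP[? ?]; lra.
move: tx ty HD' HS; lra.
Qed.

End MaximumPrincipleAlgebra.

(** * Evaluation of wedge powers of a fundamental form *)

Section WedgePowers.
Variable (R : realType).
Local Notation C := R[i].

Definition adjmx m n (A : 'M[C]_(m, n)) : 'M[C]_(n, m) := (map_mx (@conjc R) A)^T.

Lemma adjmxM m n p (A : 'M[C]_(m, n)) (B : 'M[C]_(n, p)) :
  adjmx (A *m B) = adjmx B *m adjmx A.
Proof. by rewrite /adjmx map_mxM trmx_mul. Qed.

Definition sesq n (h : 'M[C]_n) (x y : 'rV[C]_n) : C :=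
  \sum_i \sum_j h i j * x ord0 i * (y ord0 j)^*%C.

Lemma sesqE n (h : 'M[C]_n) (x y : 'rV[C]_n) :
  sesq h x y = (x *m h *m adjmx y) ord0 ord0.
Proof.
rewrite /sesq mxE exchange_big /=; apply: eq_bigr => j _.
rewrite !mxE mulr_suml; apply: eq_bigr => i _.
by rewrite [h i j * _]mulrC.
Qed.

Lemma sesq_congr n (Q h : 'M[C]_n) (x y : 'rV[C]_n) :
  sesq (Q *m h *m adjmx Q) x y = sesq h (x *m Q) (y *m Q).
Proof. by rewrite !sesqE adjmxM !mulmxA. Qed.

Lemma conjc_realM (b : R) (z : C) : (b%:C * z)^* = b%:C * z^*.
Proof. by rewrite -[in RHS](conjc_real b); exact: (rmorphM (@conjc R)). Qed.

Lemma adjmx_realZ m n (b : R) (A : 'M[C]_(m, n)) :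
  adjmx (b%:C *: A) = b%:C *: adjmx A.
Proof. by apply/matrixP => i j; rewrite !mxE; exact: conjc_realM. Qed.

Lemma sesqZ n (h : 'M[C]_n) (a b : R) (x y : 'rV[C]_n) :
  sesq h (a%:C *: x) (b%:C *: y) = (a * b)%:C * sesq h x y.
Proof.
rewrite !sesqE adjmx_realZ -scalemxAr -!scalemxAl scalerA mxE [b%:C * _]mulrC.
by congr (_ * _); exact/esym/(rmorphM (real_complex R)).
Qed.

Lemma fundamental_formE n (h : 'M[C]_n) v :
  fundamental_form h v =
  'i%C * (sesq h (v ord0) (v (lift ord0 ord0)) - sesq h (v (lift ord0 ord0)) (v ord0)).
Proof.
rewrite /fundamental_form /sesq -sumrB mulr_sumr; apply: eq_bigr => i _.
rewrite -sumrB mulr_sumr; apply: eq_bigr => j _.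
rewrite -mulrA; congr (_ * _); rewrite -!mulrA -mulrBr; congr (_ * _).
rewrite /wedge /dz_form /dzbar_form.
have S2 (s : 'S_2) : s = 1%g \/ s = tperm ord0 (lift ord0 ord0).
  have two (x : 'I_2) : x = ord0 \/ x = lift ord0 ord0.
    case: x => [[|[|x]] lx]; [left|right|]; by [apply: val_inj|].
  have [s0|s0] := two (s ord0); have [s1|s1] := two (s (lift ord0 ord0)).
  - by have := @perm_inj _ s ord0 (lift ord0 ord0); rewrite s0 s1 => /(_ erefl).
  - by left; apply/permP => x; rewrite perm1; case: (two x) => ->.
  - by right; apply/permP => x; case: (two x) => ->; rewrite ?tpermL ?tpermR.
  - by have := @perm_inj _ s ord0 (lift ord0 ord0); rewrite s0 s1 => /(_ erefl).
have n1 : (1%g : 'S_2) != tperm ord0 (lift ord0 ord0).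
  by apply/eqP => /permP/(_ ord0); rewrite perm1 tpermL.
rewrite (bigD1 1%g) //= (bigD1 (tperm ord0 (lift ord0 ord0))) /=; last first.
  by rewrite eq_sym.
rewrite big1 ?addr0; last first.
  by move=> s /andP[/eqP s1 /eqP s2]; case: (S2 s).
rewrite !perm1 odd_perm1 odd_tperm.
have -> : lshift 1 (@ord0 0) = @ord0 1 by apply: val_inj.
have -> : rshift 1 (@ord0 0) = lift (@ord0 1) ord0 by apply: val_inj.
rewrite tpermL tpermR expr0 expr1 mul1r mulN1r mulNr invr1 mul1r.
by rewrite [X in _ - X = _]mulrC [X in _ = _ - X]mulrC.
Qed.

(** A congruence of h by Q is the pullback of the form along v |-> v Q, and pullback commutes with
    wedge products. *)
Lemma wedge_pow_congr n (Q h : 'M[C]_n) k v :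
  wedge_pow (fundamental_form (Q *m h *m adjmx Q)) k v =
  wedge_pow (fundamental_form h) k (fun i => v i *m Q).
Proof.
elim: k v => [//|k IH] v /=; rewrite /wedge; congr (_ * _).
apply: eq_bigr => s _; rewrite IH; congr (_ * _ * _).
by rewrite !fundamental_formE !sesq_congr.
Qed.

Lemma wedge_pow_scale n (h : 'M[C]_n) k (v : 'I_(k * 2) -> 'rV[C]_n) (r : 'I_(k * 2) -> R) :
  wedge_pow (fundamental_form h) k (fun i => (r i)%:C *: v i) =
  (\prod_i r i)%:C * wedge_pow (fundamental_form h) k v.
Proof.
elim: k v r => [|k IH] v r.
  by rewrite /= big_ord0 mul1r.
rewrite /= /wedge mulrCA; congr (_ * _); rewrite mulr_sumr; apply: eq_bigr => s _.
rewrite (IH (fun j => v (s (rshift 2 j))) (fun j => r (s (rshift 2 j)))).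
rewrite !fundamental_formE !sesqZ.
have -> : \prod_i r i = \prod_i r (s i) by rewrite (reindex_inj (@perm_inj _ s)).
have -> : \prod_i r (s i) = (\prod_(i < 2) r (s (lshift (k * 2) i))) *
    \prod_(j < k * 2) r (s (rshift 2 j)) by exact: big_split_ord.
rewrite !big_ord_recl big_ord0 mulr1.
set r0 := r _; set r1 := r _; set p := \prod_(j < k * 2) _.
have -> : (r0 * r1 * p)%:C = r0%:C * r1%:C * p%:C.
  by rewrite (rmorphM (real_complex R)) (rmorphM (real_complex R)).
have -> : (r0 * r1)%:C = r0%:C * r1%:C by exact: (rmorphM (real_complex R)).
have -> : (r1 * r0)%:C = r0%:C * r1%:C.
  by rewrite mulrC; exact: (rmorphM (real_complex R)).
move: (wedge_pow _ _ _) (r0%:C) (r1%:C) (p%:C) ((-1) ^+ s) => W x0 x1 q e.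
by ring.
Qed.

(* The j-th vector of the real basis e_0, i e_0, e_1, i e_1, ... reindexed by f. *)
Definition real_basis n (f : nat -> 'I_n) (j : nat) : 'rV[C]_n :=
  (if odd j then 'i%C else 1) *: delta_mx ord0 (f j./2).

Lemma sesq1_delta n (a b : C) (i j : 'I_n) :
  sesq 1%:M (a *: delta_mx ord0 i) (b *: delta_mx ord0 j) =
  (i == j)%:R * (a * b^*).
Proof.
rewrite sesqE mulmx1 -scalemxAl mxE mxE (bigD1 i) //= big1 ?addr0.
  rewrite !mxE !eqxx mul1r eq_sym /=; case: eqP => _ /=.
    by rewrite mul1r mulr1.
  by rewrite mulr0 mul0r conjc0 mulr0.
by move=> k ki; rewrite !mxE eqxx (negbTE ki) mul0r.
Qed.

Lemma fundamental_form_real_basis n (f : nat -> 'I_n) a b :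
  'i%C * (sesq 1%:M (real_basis f a) (real_basis f b)
        - sesq 1%:M (real_basis f b) (real_basis f a)) =
  if (f a./2 == f b./2) && (odd a != odd b) then 2 * (-1) ^+ odd a else 0.
Proof.
rewrite !sesq1_delta [f b./2 == _]eq_sym; case: eqP => _ /=; last by rewrite !mul0r subrr mulr0.
case: (odd a) (odd b) => [] [] /=; apply/eqP; rewrite eq_complex /=;
  by apply/andP; split; apply/eqP; simpc => /=; ring.
Qed.

Lemma perm_lift_exists n (t : 'S_n.+1) i : exists s, t = lift_perm i (t i) s.
Proof.
pose u k := odflt k (unlift (t i) (t (lift i k))).
have uK k : lift (t i) (u k) = t (lift i k).
  rewrite /u; have := neq_lift i k.
  by rewrite -(can_eq (permK t)) => /unlift_some[] ? ? ->.
have u_inj : injective u.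
  by move=> x y xy; apply: (@lift_inj _ i); apply: (@perm_inj _ t); rewrite -!uK xy.
exists (perm u_inj); apply/permP => k.
case: (unliftP i k) => [j|] ->; last by rewrite lift_perm_id.
by rewrite lift_perm_lift permE uK.
Qed.

(** Deleting the pair with index m, in either order, leaves the real basis on the remaining indices;
    c tells which member is deleted first. *)
Lemma real_basis_bump n (f : nat -> 'I_n) (m : nat) (c : bool) x :
  real_basis f (bump (c + m.*2) (bump m.*2 x)) = real_basis (f \o bump m) x.
Proof.
have [xm|mx] := ltnP x m.*2.
  have -> : bump (c + m.*2) (bump m.*2 x) = x by rewrite /bump; lia.
  rewrite /real_basis /=; congr (_ *: delta_mx _ (f _)).
  by rewrite /bump; lia.
have -> : bump (c + m.*2) (bump m.*2 x) = x.+2 by rewrite /bump; lia.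
rewrite /real_basis /= negbK; congr (_ *: delta_mx _ (f _)).
by rewrite /bump; lia.
Qed.

(** A term of the wedge sum is nonzero only if its first two vectors are some e_m and i e_m, and it
    is then positive by induction on the basis without this pair. Stating positivity for every s,
    weighted by its sign, carries orientation through the induction without a separate proof that
    the power is alternating. *)
Lemma wedge_pow_real_basis_gt0 n k (f : nat -> 'I_n) (s : 'S_(k * 2)) :
  (forall a b, (a < k)%N -> (b < k)%N -> f a = f b -> a = b) ->
  0 < (-1) ^+ s * wedge_pow (fundamental_form 1%:M) k
        (fun j => real_basis f (s j)).
Proof.
elim: k f s => [|k IH] f s f_inj.
  have -> : s = 1%g by apply/permP => -[].
  by rewrite odd_perm1 expr0 mul1r ltr01.
pose W := wedge_pow (@fundamental_form R n 1%:M) k.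
pose term (t : 'S_(2 + k * 2)) : C := (-1) ^+ t
  * fundamental_form 1%:M (fun i => real_basis f (t (lshift (k * 2) i)))
  * W (fun j => real_basis f (t (rshift 2 j))).
have -> : (-1) ^+ s * wedge_pow (fundamental_form 1%:M) k.+1
        (fun j => real_basis f (s j)) =
   (2`! * (k * 2)`!)%N%:R^-1 * \sum_(t : 'S_(2 + k * 2)) term t.
  rewrite /= /wedge mulrCA; congr (_ * _).
  rewrite [RHS](reindex_inj (@mulIg _ (s : 'S_(2 + k * 2)))) mulr_sumr.
  apply: eq_bigr => t _; rewrite /term odd_permM signr_addb.
  have E1 : (fun i => real_basis f ((t * s)%g (lshift (k * 2) i))) =
            (fun i => real_basis f (s (t (lshift (k * 2) i)))).
    by apply/funext => i; rewrite permM.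
  have E2 : (fun j => real_basis f ((t * s)%g (rshift 2 j))) =
            (fun j => real_basis f (s (t (rshift 2 j)))).
    by apply/funext => i; rewrite permM.
  by rewrite E1 E2 !mulrA [(-1) ^+ s * _]mulrC.
have termE (t : 'S_(2 + k * 2)) : term t =
   if (f (t ord0)./2 == f (t (lift ord0 ord0))./2) &&
      (odd (t ord0) != odd (t (lift ord0 ord0)))
   then 2 * (-1) ^+ t * (-1) ^+ odd (t ord0) * W (fun j => real_basis f (t (rshift 2 j)))
   else 0.
  rewrite /term fundamental_formE.
  have -> : lshift (k * 2) (@ord0 1) = @ord0 (k * 2).+1 by apply: val_inj.
  have -> : lshift (k * 2) (lift (@ord0 1) (@ord0 0)) =
     lift (@ord0 (k * 2).+1) (@ord0 (k * 2)) by apply: val_inj.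
  rewrite fundamental_form_real_basis; case: ifP => _; last by rewrite mulr0 mul0r.
  by rewrite [(-1) ^+ t * _]mulrCA !mulrA.
have term_gt0 (t : 'S_(2 + k * 2)) : (f (t ord0)./2 == f (t (lift ord0 ord0))./2) &&
      (odd (t ord0) != odd (t (lift ord0 ord0))) -> 0 < term t.
  rewrite termE => E; rewrite E; case/andP: E => /eqP Ef Eo.
  (* Strip off the first two values of t. Whichever of 2m and 2m+1 comes first, the other one then
     has the even rank 2m, so the sign of t is that of s' times the parity of t 0. *)
  have [t1 Et] := perm_lift_exists t ord0.
  have [s' Et1] := perm_lift_exists t1 ord0.
  have Eb : t (lift ord0 ord0) = lift (t ord0) (t1 ord0).
    by rewrite {1}Et lift_perm_lift.
  set m := (t ord0)./2 in Ef *.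
  have Em : (t ord0)./2 = (t (lift ord0 ord0))./2.
    by apply: f_inj Ef; have := ltn_ord (t ord0); have := ltn_ord (t (lift ord0 ord0)); lia.
  have Ea : t ord0 = (odd (t ord0) + m.*2)%N :> nat by rewrite odd_double_half.
  have Eb' : t1 ord0 = m.*2 :> nat.
    have : t (lift ord0 ord0) = bump (t ord0) (t1 ord0) :> nat by rewrite Eb.
    by rewrite /bump /m; move: Em Eo; lia.
  have Esgn : odd_perm t = odd (t ord0) (+) odd_perm s'.
    rewrite {1}Et odd_lift_perm /= Et1 odd_lift_perm /=.
    by rewrite Eb' odd_double.
  have EW : (fun j => real_basis f (t (rshift 2 j))) =
            (fun j => real_basis (f \o bump m) (s' j)).
    apply/funext => j; rewrite -(real_basis_bump f m (odd (t ord0))) -Ea -Eb'.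
    have -> : rshift 2 j = lift (@ord0 (k * 2).+1) (lift (@ord0 (k * 2)) j).
      by apply: val_inj.
    by rewrite {1}Et lift_perm_lift {1}Et1 lift_perm_lift.
  rewrite EW Esgn signr_addb -mulrA -mulrA mulr_gt0 // ?ltr0n //.
  rewrite [_ * ((-1) ^+ s')]mulrC -!mulrA mulrA mulrA -[_ * _ * (-1) ^+ odd _]mulrA.
  rewrite -expr2 sqrr_sign mulr1.
  apply: IH => a b ak bk /= fab.
  have : bump m a = bump m b by apply: f_inj fab; rewrite /bump; lia.
  by rewrite /bump; lia.
rewrite mulr_gt0 ?invr_gt0 ?ltr0n ?muln_gt0 ?fact_gt0 //.
(* The identity keeps the first pair together, so at least one term is strictly positive. *)
rewrite (bigD1 1%g) //=; apply: ltr_wpDr.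
  apply: sumr_ge0 => t _.
  case E : ((f (t ord0)./2 == f (t (lift ord0 ord0))./2) &&
      (odd (t ord0) != odd (t (lift ord0 ord0)))); first exact/ltW/term_gt0.
  by rewrite termE E.
by apply: term_gt0; rewrite !perm1 /= eqxx.
Qed.

End WedgePowers.

(** * Positive Hermitian matrices and determinants *)

Section HermitianMatrices.
Variable (R : realType).
Local Notation C := R[i].

Definition positive_hermitian n (h : 'M[C]_n) : Prop :=
  (forall i j, h j i = (h i j)^*) /\ forall u, u != 0 -> 0 < sesq h u u.

Lemma adjmxK m n (A : 'M[C]_(m, n)) : adjmx (adjmx A) = A.
Proof. by apply/matrixP => i j; rewrite !mxE conjcK. Qed.

Lemma adjmx_hermitian n (h : 'M[C]_n) : positive_hermitian h -> adjmx h = h.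
Proof. by move=> [H _]; apply/matrixP => i j; rewrite !mxE -H. Qed.

Lemma positive_hermitian_congr n (Q h : 'M[C]_n) : Q \in unitmx ->
  positive_hermitian h -> positive_hermitian (Q *m h *m adjmx Q).
Proof.
move=> uQ hh; split=> [i j|u u0].
  have : adjmx (Q *m h *m adjmx Q) = Q *m h *m adjmx Q.
    by rewrite !adjmxM adjmxK adjmx_hermitian // mulmxA.
  by move/matrixP/(_ j i); rewrite 2!mxE => <-.
rewrite sesq_congr; apply: (hh.2).
apply: contraNneq u0 => uQ0.
by rewrite -[u](mulmxK uQ) uQ0 mul0mx.
Qed.

Lemma unitary_diagonalization n (h : 'M[C]_n) : positive_hermitian h ->
  exists (Q : 'M[C]_n) (l : 'I_n -> R), [/\ Q *m adjmx Q = 1%:M,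
    forall i, 0 < l i & Q *m h *m adjmx Q = diag_mx (\row_i (l i)%:C)].
Proof.
move=> hh.
have tC m (A : 'M[C]_(m, n)) : map_mx Num.conj A^T = adjmx A.
  by apply/matrixP => i j; rewrite !mxE.
have hn : h \is normalmx.
  apply/normalmxP; rewrite tC.
  by rewrite (adjmx_hermitian hh).
have := orthomx_spectralP hn; have := spectral_unitarymx h.
set Q := spectralmx h; set d := spectral_diag h => Qu Eh.
have QQ : Q *m adjmx Q = 1%:M by rewrite -tC; exact/unitarymxP.
have uQ : Q \in unitmx by exact: unitarymx_unit.
have EQ : Q *m h *m adjmx Q = diag_mx d.
  by rewrite Eh !mulmxA mulmxV // mul1mx -mulmxA QQ mulmx1.
have dpos i : 0 < d ord0 i.
  have := (positive_hermitian_congr uQ hh).2 (delta_mx ord0 i).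
  rewrite EQ sesqE.
  have -> : delta_mx ord0 i *m diag_mx d *m adjmx (delta_mx ord0 i) =
     (d ord0 i)%:M :> 'M[C]_(1, 1).
    apply/matrixP => a b; rewrite !ord1 !mxE (bigD1 i) //= big1 ?addr0.
      rewrite mxE (bigD1 i) //= big1 ?addr0; last first.
        by move=> k ki; rewrite !mxE (negbTE ki) andbF mul0r.
      by rewrite !mxE !eqxx conjc_nat mul1r mulr1n mulr1.
    by move=> k ki; rewrite !mxE (negbTE ki) andbF conjc_nat mulr0.
  rewrite mxE eqxx; apply.
  by apply/eqP => /matrixP/(_ ord0 i); rewrite !mxE !eqxx => /eqP; rewrite oner_eq0.
exists Q, (fun i => complex.Re (d ord0 i)); split => //.
  by move=> i; have := dpos i; rewrite ltcE => /andP[].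
rewrite EQ; congr diag_mx; apply/rowP => i; rewrite mxE.
have := dpos i; rewrite ltcE /= => /andP[/eqP + _].
by case: (d ord0 i) => a b /= ->.
Qed.

(** Rescale a unitary diagonalization of g so that g becomes the identity, then diagonalize the
    transformed h by a unitary matrix, which preserves the identity. The rows of P serve as the
    frame at the maximum point. *)
Lemma simultaneous_diagonalization n (g h : 'M[C]_n) :
  positive_hermitian g -> positive_hermitian h ->
  exists (P : 'M[C]_n) (l : 'I_n -> R), [/\ P \in unitmx, forall i, 0 < l i,
    P *m g *m adjmx P = 1%:M & P *m h *m adjmx P = diag_mx (\row_i (l i)%:C)].
Proof.
move=> hg hh; have [Q [d [QQ d0 EQ]]] := unitary_diagonalization hg.
pose s := diag_mx (\row_i ((Num.sqrt (d i))^-1)%:C) : 'M[C]_n.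
have adjs : adjmx s = s.
  apply/matrixP => i j; rewrite !mxE eq_sym; case: eqP => [->|_]; last first.
    by rewrite !mulr0n conjc0.
  by rewrite !mulr1n conjc_real.
pose P1 := s *m Q.
have sds : s *m diag_mx (\row_i (d i)%:C) *m s = 1%:M.
  rewrite /s !mulmx_diag; apply/matrixP => i j; rewrite !mxE.
  case: eqP => // _; rewrite !mulr1n -!(rmorphM (real_complex R)) /=.
  congr (_ %:C); have sd : 0 < Num.sqrt (d i) by rewrite sqrtr_gt0.
  by rewrite -[X in _ * X * _]sqr_sqrtr ?ltW //; field; rewrite gt_eqF.
have E1 : P1 *m g *m adjmx P1 = 1%:M.
  rewrite /P1 adjmxM adjs -sds -EQ !mulmxA.
  by [].
have uP1 : P1 \in unitmx.
  by have [] := mulmx1_unit (etrans (mulmxA _ _ _) E1).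
have [Q2 [l [QQ2 l0 EQ2]]] := unitary_diagonalization (positive_hermitian_congr uP1 hh).
exists (Q2 *m P1), l; split => //.
- by rewrite unitmx_mul uP1 andbT; case: (mulmx1_unit QQ2).
- have -> : Q2 *m P1 *m g *m adjmx (Q2 *m P1) = Q2 *m (P1 *m g *m adjmx P1) *m adjmx Q2.
    by rewrite adjmxM !mulmxA.
  by rewrite E1 mulmx1.
- rewrite -EQ2 adjmxM !mulmxA.
  by [].
Qed.

Lemma det_adjmx n (A : 'M[C]_n) : \det (adjmx A) = (\det A)^*.
Proof. by rewrite /adjmx det_tr (det_map_mx (@conjc R)). Qed.

Lemma positive_hermitian_unit n (h : 'M[C]_n) : positive_hermitian h -> h \in unitmx.
Proof.
(* Diagonalizing h against itself writes the identity as a congruence of h, so det h cannot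
   vanish. *)
move=> hh; have [P [l [uP l0 E _]]] := simultaneous_diagonalization hh hh.
rewrite unitmxE unitfE; apply/eqP => d0.
have := congr1 determinant E; rewrite !det_mulmx d0 mulr0 mul0r det1 => /eqP.
by rewrite eq_sym oner_eq0.
Qed.

(* Nonvanishing at a real basis turns the proportionality of the n-th wedge
   powers into that of the determinants. *)
Lemma det_of_wedge_pow n (g h : 'M[C]_n) (c : R) :
  positive_hermitian g -> positive_hermitian h ->
  (forall v : 'I_(n * 2) -> 'rV[C]_n,
    wedge_pow (fundamental_form h) n v = c%:C * wedge_pow (fundamental_form g) n v) ->
  \det h = c%:C * \det g.
Proof.
move=> hg hh E; have [P [l [uP l0 Eg Eh]]] := simultaneous_diagonalization hg hh.
suff lc : \prod_i l i = c.
  have dP : \det P * (\det P)^* != 0.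
    by rewrite mulf_neq0 ?conjc_eq0 //; move: uP; rewrite unitmxE unitfE.
  apply: (mulfI dP).
  have dg := congr1 determinant Eg; have dh := congr1 determinant Eh.
  rewrite !det_mulmx det_adjmx det1 in dg; rewrite !det_mulmx det_adjmx det_diag in dh.
  have -> : \det P * (\det P)^* * \det h = c%:C.
    rewrite mulrAC dh -lc (rmorph_prod (real_complex R)).
    by apply: eq_bigr => i _; rewrite mxE.
  by rewrite mulrCA mulrAC dg mulr1.
pose W (A : 'M[C]_n) := wedge_pow (fundamental_form A) n.
have {}E v : W (diag_mx (\row_i (l i)%:C)) v = c%:C * W 1%:M v.
  by rewrite -Eh -Eg /W !wedge_pow_congr E.
pose s := diag_mx (\row_i (Num.sqrt (l i))%:C) : 'M[C]_n.
have adjs : adjmx s = s.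
  apply/matrixP => i j; rewrite !mxE eq_sym; case: eqP => [->|_]; last first.
    by rewrite !mulr0n conjc0.
  by rewrite !mulr1n conjc_real.
have Es : diag_mx (\row_i (l i)%:C) = s *m 1%:M *m adjmx s.
  rewrite adjs mulmx1 mulmx_diag; apply/matrixP => i j; rewrite !mxE.
  case: eqP => // _; rewrite !mulr1n -(rmorphM (real_complex R)) /= -expr2.
  by rewrite sqr_sqrtr // ltW.
(* In dimension 0 both powers are the constant 1, so c = 1 is the empty product. In positive
   dimension [inord] extends the index of the basis to all naturals. *)
case: n => [|m] in g h hg hh P l uP l0 Eg Eh W E s adjs Es *.
  have := E (fun=> 0); rewrite /W /= mulr1 big_ord0 => /(congr1 (@complex.Re R)).
  by move=> /= ->.
pose f (j : nat) : 'I_m.+1 := inord j.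
have W0 : 0 < W 1%:M (fun j => real_basis R f j).
  have := @wedge_pow_real_basis_gt0 R m.+1 m.+1 f 1%g.
  rewrite odd_perm1 expr0 mul1r.
  have -> : (fun j => real_basis R f ((1%g : 'S_(m.+1 * 2)) j)) =
            (fun j : 'I_(m.+1 * 2) => real_basis R f j).
    by apply/funext => j; rewrite perm1.
  apply => a b am bm /(congr1 val); rewrite /f /= !inordK //.
(* The congruence by s multiplies both e_k and i e_k by sqrt (l k), so each eigenvalue appears as
   the square of its root. *)
have := E (fun j => real_basis R f j).
rewrite Es /W wedge_pow_congr.
have -> : (fun j : 'I_(m.+1 * 2) => real_basis R f j *m s) =
   (fun j => (Num.sqrt (l (f j./2)))%:C *: real_basis R f j).
  apply/funext => j; rewrite /real_basis -scalemxAl scalerA mulrC -scalerA; congr (_ *: _).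
  apply/rowP => k; rewrite !mxE (bigD1 (f j./2)) //= big1 ?addr0.
    rewrite !mxE !eqxx mul1r.
    have [_|_] := eqVneq k (f j./2); first by rewrite mulr1n mulr1.
    by rewrite mulr0n mulr0.
  by move=> i ki; rewrite !mxE (negbTE ki) andbF mul0r.
rewrite wedge_pow_scale => H.
have {}H : (\prod_(j < m.+1 * 2) Num.sqrt (l (f j./2)))%:C = c%:C.
  by apply: (mulIf _ H); rewrite gt_eqF.
have {}H : \prod_(j < m.+1 * 2) Num.sqrt (l (f j./2)) = c.
  by move/(congr1 (@complex.Re R)): H.
rewrite -H.
have pairs k (F : nat -> R) : \prod_(j < k * 2) F j./2 = \prod_(j < k) (F j ^+ 2).
  elim: k => [|k IH]; first by rewrite !big_ord0.
  rewrite [RHS]big_ord_recr -IH -!(big_mkord xpredT (fun j => F j./2)).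
  rewrite mulSn addnC addn2 big_nat_recr // big_nat_recr //=.
  by rewrite muln2 doubleK uphalf_double -mulrA expr2.
rewrite (pairs _ (fun j => Num.sqrt (l (f j)))).
apply: eq_bigr => i _; rewrite sqr_sqrtr ?ltW //; congr (l _).
by apply: val_inj; rewrite /= inordK.
Qed.

End HermitianMatrices.

(** * Composition with a map given by its real components *)

Section Composition.
Variables (R : realType) (V W : normedModType R) (U : set V) (O : set W).
Hypotheses (oU : open U) (oO : open O).
Variables (I : finType) (e : I -> V) (tau : I -> W -> R).
Hypotheses (tau_smooth : forall k, smooth O (tau k))
  (tau_U : forall w, O w -> U (\sum_k tau k w *: e k)).
Let T w := \sum_k tau k w *: e k.

Lemma derive_comp_sum (f : V -> R) w v : smooth U f -> O w ->
  derivable (fun x => f (T x)) w v /\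
  'D_v (fun x => f (T x)) w = \sum_k 'D_v (tau k) w * 'D_(e k) f (T w).
Proof.
move=> sf Ow.
have := @is_derive_comp_sum R V U oU I W f e tau (fun k => 'D_v (tau k) w) 0 w v sf.
rewrite addr0 => /(_ (tau_U Ow)).
have -> : (fun x => f (\sum_k tau k x *: e k + 0)) = (fun x => f (T x)).
  by apply/funext => x; rewrite addr0.
case; last by [].
by move=> k; apply: derivableP; exact: smooth_derivable Ow.
Qed.

(** The induction is over all f at once, since differentiating f o T produces the functions 'D_(e k)
    f composed with T. *)
Lemma smooth_comp_sum (f : V -> R) : smooth U f -> smooth O (fun w => f (T w)).
Proof.
move=> sf m; elim: m f sf => [|m IH] f sf.
  split=> // w Ow; apply: continuous_comp; last first.
    by apply: smooth_continuous sf _; exact: tau_U.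
  apply: cvg_big => [|k _]; first exact: add_continuous.
  by apply: cvgZr_tmp; exact: smooth_continuous (tau_smooth k) Ow.
split; first by move: (IH f sf); case: (m) => [|m'] [].
move=> v; split; first by move=> w Ow; case: (@derive_comp_sum f w v sf Ow).
have H : Ck m O (fun w => \sum_k 'D_v (tau k) w * 'D_(e k) f (T w)).
  elim: (index_enum I) => [|k r IHr].
    by apply: Ck_ext (Ck_cst oO m 0) => // w _; rewrite big_nil.
  have H1 := CkM oO (smooth_derive v (tau_smooth k) m) (IH _ (smooth_derive (e k) sf)).
  by apply: Ck_ext (CkD oO H1 IHr) => // w _; rewrite big_cons.
apply: Ck_ext H => // w Ow.
by case: (@derive_comp_sum f w v sf Ow).
Qed.

Lemma csmooth_comp_sum (f : V -> R[i]) : csmooth U f -> csmooth O (fun w => f (T w)).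
Proof. by move=> [fr fi]; split; [exact (smooth_comp_sum fr) | exact (smooth_comp_sum fi)]. Qed.

Lemma cderive_comp_sum (f : V -> R[i]) w v : csmooth U f -> O w ->
  cderive v (fun x => f (T x)) w =
  \sum_k ('D_v (tau k) w)%:C * cderive (e k) f (T w).
Proof.
move=> [fr fi] Ow; rewrite /cderive.
rewrite (@derive_comp_sum _ w v fr Ow).2 (@derive_comp_sum _ w v fi Ow).2.
elim: (index_enum I) => [|k r IHr]; first by rewrite !big_nil.
rewrite !big_cons -IHr; apply/eqP; rewrite eq_complex /=.
by rewrite !mul0r subr0 addr0 !eqxx.
Qed.

End Composition.

(** * Wirtinger derivatives along coordinates and complex vectors *)

Section Wirtinger.
Variables (R : realType) (n : nat).
Local Notation C := R[i].
Local Notation V := (Cn R n).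

Definition real_dir (u : 'rV[C]_n) : V :=
  (map_mx (@complex.Re R) u, map_mx (@complex.Im R) u).

(** The (1,0) derivative along u, equal to the sum of u_k d/dz_k by [dirz_sum]. Built from the real
    directions of u and iu, it is a [cdir] and inherits the derivation and commutation rules. *)
Definition dirz (u : 'rV[C]_n) : (V -> C) -> V -> C :=
  cdir 2^-1 (- (2^-1 * 'i%C)) (real_dir u) (real_dir ('i%C *: u)).

Definition dirzbar (u : 'rV[C]_n) : (V -> C) -> V -> C :=
  cdir 2^-1 (2^-1 * 'i%C) (real_dir u) (real_dir ('i%C *: u)).

Definition ex (k : 'I_n) : V := (delta_mx ord0 k, 0).
Definition ey (k : 'I_n) : V := (0, delta_mx ord0 k).

Lemma dzE k : dz k = cdir 2^-1 (- (2^-1 * 'i%C)) (ex k) (ey k).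
Proof.
apply/funext => f; apply/funext => z; rewrite /dz /cdir -/(ex k) -/(ey k).
move: (cderive _ _ _) (cderive _ _ _) => a b.
by rewrite mulrBr mulNr mulrA.
Qed.

Lemma dzbarE k : dzbar k = cdir 2^-1 (2^-1 * 'i%C) (ex k) (ey k).
Proof.
apply/funext => f; apply/funext => z; rewrite /dzbar /cdir -/(ex k) -/(ey k).
move: (cderive _ _ _) (cderive _ _ _) => a b.
by rewrite mulrDr mulrA.
Qed.

Lemma sum_basis (x y : 'I_n -> R) :
  \sum_(k : 'I_n + 'I_n) (match k with inl i => x i | inr i => y i end) *:
     (match k with inl i => ex i | inr i => ey i end)
  = (\row_i x i, \row_i y i).
Proof.
rewrite big_sumType /=.
have pairE (a b : V) : a.1 = b.1 -> a.2 = b.2 -> a = b.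
  by case: a b => [? ?] [? ?] /= -> ->.
have fstE (I : finType) (F : I -> V) : (\sum_i F i).1 = \sum_i (F i).1.
  by elim/big_rec2: _ => //= i a b _ <-.
have sndE (I : finType) (F : I -> V) : (\sum_i F i).2 = \sum_i (F i).2.
  by elim/big_rec2: _ => //= i a b _ <-.
apply: pairE => /=.
  rewrite fstE fstE [X in _ + X]big1 ?addr0 /=; last by move=> i _; rewrite scaler0.
  rewrite [RHS]row_sum_delta; apply: eq_bigr => i _; by rewrite mxE.
rewrite sndE sndE big1 ?add0r /=; last by move=> i _; rewrite scaler0.
rewrite [RHS]row_sum_delta; apply: eq_bigr => i _; by rewrite mxE.
Qed.

Section OnOpen.
Variable U : set V.
Hypothesis oU : open U.
Implicit Types (f g : V -> C) (z : V).

Lemma dz_derivation k : derivation U (dz k).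
Proof. by rewrite dzE; exact: cdir_derivation. Qed.

Lemma dzbar_derivation k : derivation U (dzbar k).
Proof. by rewrite dzbarE; exact: cdir_derivation. Qed.

Lemma dirz_derivation u : derivation U (dirz u).
Proof. exact: cdir_derivation. Qed.

Lemma dirzbar_derivation u : derivation U (dirzbar u).
Proof. exact: cdir_derivation. Qed.

Lemma cderive_sum_dir f z u : csmooth U f -> U z ->
  cderive (real_dir u) f z =
  \sum_k ((complex.Re (u ord0 k))%:C * cderive (ex k) f z
        + (complex.Im (u ord0 k))%:C * cderive (ey k) f z).
Proof.
move=> [fr fi] Uz.
have E : real_dir u = \sum_(k : 'I_n + 'I_n)
   (match k with inl i => complex.Re (u ord0 i) | inr i => complex.Im (u ord0 i) end) *:
     (match k with inl i => ex i | inr i => ey i end).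
  rewrite (sum_basis (fun i => complex.Re (u ord0 i)) (fun i => complex.Im (u ord0 i))).
  by congr (_, _); apply/rowP => i; rewrite !mxE.
rewrite {1}/cderive E (derive_sum_dir oU _ _ fr Uz) (derive_sum_dir oU _ _ fi Uz).
rewrite !big_sumType /= big_split /=.
have complexD (a b c d : R) : (a + b) +i* (c + d) = (a +i* c) + (b +i* d) :> C by [].
rewrite complexD; congr (_ + _).
  elim: (index_enum _) => [|k r IHr]; first by rewrite !big_nil.
  rewrite !big_cons -IHr; apply/eqP; rewrite eq_complex /=.
  by rewrite !mul0r subr0 addr0 !eqxx.
elim: (index_enum _) => [|k r IHr]; first by rewrite !big_nil.
rewrite !big_cons -IHr; apply/eqP; rewrite eq_complex /=.
by rewrite !mul0r subr0 addr0 !eqxx.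
Qed.

Lemma dirz_sum f z u : csmooth U f -> U z ->
  dirz u f z = \sum_k u ord0 k * dz k f z.
Proof.
move=> sf Uz; rewrite /dirz /cdir !(cderive_sum_dir _ sf Uz) !mulr_sumr -big_split /=.
apply: eq_bigr => k _; rewrite mxE dzE /cdir.
move: (cderive _ _ _) (cderive _ _ _) (u ord0 k) => a b [x y].
have -> : complex.Re ('i%C * (x +i* y)) = - y by rewrite /= mul0r mul1r sub0r.
have -> : complex.Im ('i%C * (x +i* y)) = x by rewrite /= mul0r mul1r add0r.
rewrite [complex.Re (x +i* y)]/= [complex.Im (x +i* y)]/=.
have -> : x +i* y = x%:C + 'i%C * y%:C by rewrite [LHS]complexE.
have -> : (- y)%:C = - y%:C by exact: (rmorphN (real_complex R)).
have := sqr_i R; rewrite expr2; move: 'i%C x%:C y%:C (2^-1) => J X Y h JJ.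
by ring: JJ.
Qed.

Lemma dirzbar_sum f z u : csmooth U f -> U z ->
  dirzbar u f z = \sum_k (u ord0 k)^*%C * dzbar k f z.
Proof.
move=> sf Uz; rewrite /dirzbar /cdir !(cderive_sum_dir _ sf Uz) !mulr_sumr -big_split /=.
apply: eq_bigr => k _; rewrite mxE dzbarE /cdir.
move: (cderive _ _ _) (cderive _ _ _) (u ord0 k) => a b [x y].
have -> : complex.Re ('i%C * (x +i* y)) = - y by rewrite /= mul0r mul1r sub0r.
have -> : complex.Im ('i%C * (x +i* y)) = x by rewrite /= mul0r mul1r add0r.
rewrite [complex.Re (x +i* y)]/= [complex.Im (x +i* y)]/=.
have -> : (x +i* y)^* = x%:C - 'i%C * y%:C.
  by apply/eqP; rewrite eq_complex /=; apply/andP; split; apply/eqP; ring.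
have -> : (- y)%:C = - y%:C by exact: (rmorphN (real_complex R)).
have := sqr_i R; rewrite expr2; move: 'i%C x%:C y%:C (2^-1) => J X Y h JJ.
by ring: JJ.
Qed.

Lemma conj2V : (2^-1 : C)^* = 2^-1.
Proof. by rewrite (fmorphV (@conjc R)) (rmorph_nat (@conjc R)). Qed.

Lemma conj2Vi : (2^-1 * 'i%C : C)^* = - (2^-1 * 'i%C).
Proof.
transitivity ((2^-1 : C)^* * ('i%C : C)^*); first exact: (rmorphM (@conjc R)).
rewrite -mulrN; congr (_ * _); first exact: conj2V.
by apply/eqP; rewrite eq_complex /= oppr0 !eqxx.
Qed.

Lemma dz_conj k f z : csmooth U f -> U z ->
  dz k (fun w => (f w)^*) z = (dzbar k f z)^*.
Proof.
move=> sf Uz; rewrite dzE dzbarE (cdir_conj oU _ _ _ _ sf Uz).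
have -> : (- (2^-1 * 'i%C) : C)^* = 2^-1 * 'i%C.
  by rewrite -conj2Vi conjcK.
by rewrite conj2V.
Qed.

Lemma dirzbar_conj u f z : csmooth U f -> U z ->
  dirzbar u (fun w => (f w)^*) z = (dirz u f z)^*.
Proof.
move=> sf Uz; rewrite /dirzbar (cdir_conj oU _ _ _ _ sf Uz).
by rewrite conj2V conj2Vi.
Qed.

End OnOpen.
End Wirtinger.

(** * Change of coordinates for metrics, ddbar and traces *)

Section Transitions.
Variables (R : realType) (n : nat) (M : topologicalType).
Variable X : complex_manifold R n M.
Local Notation C := R[i].
Implicit Types (c d : chart R n M) (f : M -> R) (g h : tensor11 R n M).

Definition jacobian_mx c d (z : Cn R n) : 'M[C]_n :=
  \matrix_(i, k) dz i (transition c d k) z.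

Definition compatible h : Prop := forall c d, atlas X c -> atlas X d ->
  forall z, overlap c d z -> h c z =
    jacobian_mx c d z *m h d (to_c d (of_c c z)) *m adjmx (jacobian_mx c d z).

Lemma congr_mxE (J A : 'M[C]_n) i j :
  (J *m A *m adjmx J) i j = \sum_k \sum_l J i k * (J j l)^*%C * A k l.
Proof.
rewrite mxE exchange_big /=; apply: eq_bigr => l _; rewrite !mxE mulr_suml.
by apply: eq_bigr => k _; rewrite mulrAC.
Qed.

Lemma hermitian_metric_compatible g : hermitian_metric X g -> compatible g.
Proof.
move=> hg c d Xc Xd z Oz; apply/matrixP => i j.
rewrite (metric_compatible hg Xc Xd Oz) congr_mxE.
by apply: eq_bigr => k _; apply: eq_bigr => l _; rewrite !mxE.
Qed.

Lemma hermitian_metric_positive g c z : hermitian_metric X g -> atlas X c ->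
  img c z -> positive_hermitian (g c z).
Proof.
move=> hg Xc cz; split; first exact: (metric_hermitian hg Xc cz).
by move=> u u0; exact: (metric_positive hg Xc cz u0).
Qed.

Lemma overlap_open c d : open (overlap c d).
Proof.
rewrite openE => z [cz dz]; rewrite /interior.
apply: filterI; first by apply: open_nbhs_nbhs; split => //; exact: img_open.
apply: (of_c_continuous cz); apply: open_nbhs_nbhs; split => //; exact: dom_open.
Qed.

Definition transition_re c d (k : 'I_n + 'I_n) (z : Cn R n) : R :=
  match k with
  | inl i => complex.Re (transition c d i z)
  | inr i => complex.Im (transition c d i z)
  end.

Definition real_frame (k : 'I_n + 'I_n) : Cn R n :=
  match k with inl i => ex R i | inr i => ey R i end.

Lemma transition_sum c d z :
  \sum_k transition_re c d k z *: real_frame k = to_c d (of_c c z).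
Proof.
have := sum_basis (fun i => complex.Re (transition c d i z))
  (fun i => complex.Im (transition c d i z)).
rewrite /transition_re /real_frame => ->.
rewrite /transition /zcoord /=; case: (to_c d (of_c c z)) => a b /=.
by congr (_, _); apply/rowP => i; rewrite mxE.
Qed.

Lemma transition_re_smooth c d k : atlas X c -> atlas X d ->
  smooth (overlap c d) (transition_re c d k).
Proof.
by move=> Xc Xd; case: k => i; have [[]] := atlas_holomorphic Xc Xd i.
Qed.

Lemma transition_img c d z : overlap c d z -> img d (to_c d (of_c c z)).
Proof. by move=> [_ dz]; exact: to_c_img. Qed.

Section Pair.
Variables (c d : chart R n M) (Xc : atlas X c) (Xd : atlas X d).
Let O := overlap c d.
Let T z := to_c d (of_c c z).
Let oO : open O := @overlap_open c d.
Let oU : open (img d) := @img_open _ _ _ d.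
Let tau := transition c d.

Let tau_smooth k : csmooth O (tau k).
Proof. by have [] := atlas_holomorphic Xc Xd k. Qed.

Let tau_holo i k z : O z -> dzbar i (tau k) z = 0.
Proof. by move=> Oz; have [_] := atlas_holomorphic Xc Xd k; apply. Qed.

Lemma csmooth_transition (f : Cn R n -> C) : csmooth (img d) f ->
  csmooth O (fun z => f (T z)).
Proof.
move=> sf; have := @csmooth_comp_sum R _ _ (img d) O oU oO _ real_frame
  (transition_re c d) (fun k => transition_re_smooth k Xc Xd) _ f sf.
have -> : (fun w => f (\sum_k transition_re c d k w *: real_frame k)) =
   (fun z => f (T z)) by apply/funext => w; rewrite transition_sum.
by apply=> w Ow; rewrite transition_sum; exact: transition_img.
Qed.

(** The real chain rule regrouped by Wirtinger derivatives of f. Holomorphy of tau then removes one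
    of the two families of terms in [dzbar_transition] and [dz_transition]. *)
Lemma cderive_transition (f : Cn R n -> C) z v : csmooth (img d) f -> O z ->
  cderive v (fun w => f (T w)) z =
  \sum_k (cderive v (tau k) z * dz k f (T z)
          + (cderive v (tau k) z)^*%C * dzbar k f (T z)).
Proof.
move=> sf Oz; have := @cderive_comp_sum R _ _ (img d) O oU _ real_frame
  (transition_re c d) (fun k => transition_re_smooth k Xc Xd) _ f z v sf Oz.
have -> : (fun w => f (\sum_k transition_re c d k w *: real_frame k)) =
   (fun z => f (T z)) by apply/funext => w; rewrite transition_sum.
rewrite transition_sum -/(T z) => -> //; last first.
  by move=> w Ow; rewrite transition_sum; exact: transition_img.
transitivity (\sum_k ((complex.Re (cderive v (tau k) z))%:C * cderive (ex R k) f (T z)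
   + (complex.Im (cderive v (tau k) z))%:C * cderive (ey R k) f (T z))).
  by rewrite big_sumType /= -big_split.
apply: eq_bigr => k _; rewrite dzE dzbarE /cdir.
move: (cderive (ex R k) f _) (cderive (ey R k) f _) (cderive v _ z) => fx fy [a b].
rewrite [complex.Re (a +i* b)]/= [complex.Im (a +i* b)]/=.
have -> : (a +i* b)^*%C = a%:C - 'i%C * b%:C.
  by apply/eqP; rewrite eq_complex /=; apply/andP; split; apply/eqP; ring.
have -> : a +i* b = a%:C + 'i%C * b%:C by rewrite [LHS]complexE.
have h2 : (2^-1 + 2^-1 : C) = 1 by rewrite -mulr2n -[_ *+ 2]mulr_natl divff // pnatr_eq0.
have := sqr_i R; rewrite expr2; move: h2; move: 'i%C a%:C b%:C (2^-1) => J x y h h2 JJ.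
have -> : x * fx + y * fy = (h + h) * (x * fx) + (h + h) * (y * fy) by rewrite h2 !mul1r.
by ring: JJ.
Qed.

Lemma conj_half_lin (a b : C) (s : C) : s^*%C = - s ->
  (2^-1 * a + s * b)^*%C = 2^-1 * a^*%C - s * b^*%C.
Proof.
move=> Es; transitivity ((2^-1 * a)^*%C + (s * b)^*%C); first exact: (rmorphD (@conjc R)).
congr (_ + _).
  transitivity ((2^-1)^*%C * a^*%C); first exact: (rmorphM (@conjc R)).
  by congr (_ * _); exact: conj2V.
transitivity (s^*%C * b^*%C); first exact: (rmorphM (@conjc R)).
by rewrite Es mulNr.
Qed.

Lemma dzbar_transition (f : Cn R n -> C) z j : csmooth (img d) f -> O z ->
  dzbar j (fun w => f (T w)) z = \sum_k (dz j (tau k) z)^*%C * dzbar k f (T z).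
Proof.
move=> sf Oz.
transitivity (\sum_k (dzbar j (tau k) z * dz k f (T z)
    + (dz j (tau k) z)^*%C * dzbar k f (T z))); last first.
  by apply: eq_bigr => k _; rewrite tau_holo // mul0r add0r.
rewrite {1}dzbarE /cdir !(cderive_transition _ sf Oz) !mulr_sumr -big_split.
apply: eq_bigr => k _.
have -> : (dz j (tau k) z)^*%C = 2^-1 * (cderive (ex R j) (tau k) z)^*%C
    + 2^-1 * 'i%C * (cderive (ey R j) (tau k) z)^*%C.
  rewrite dzE /cdir conj_half_lin ?mulNr ?opprK //.
  by rewrite -conj2Vi conjcK.
have -> : dzbar j (tau k) z = 2^-1 * cderive (ex R j) (tau k) z
    + 2^-1 * 'i%C * cderive (ey R j) (tau k) z by rewrite dzbarE.
move: (cderive (ex R j) (tau k) z) (cderive (ey R j) (tau k) z).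
move: (dz k f (T z)) (dzbar k f (T z)) => u v a b.
move: (a^*%C) (b^*%C) => a' b' /=; ring.
Qed.

Lemma dz_transition (f : Cn R n -> C) z i : csmooth (img d) f -> O z ->
  dz i (fun w => f (T w)) z = \sum_k dz i (tau k) z * dz k f (T z).
Proof.
move=> sf Oz.
transitivity (\sum_k (dz i (tau k) z * dz k f (T z)
    + (dzbar i (tau k) z)^*%C * dzbar k f (T z))); last first.
  by apply: eq_bigr => k _; rewrite tau_holo // conjc0 mul0r addr0.
rewrite {1}dzE /cdir !(cderive_transition _ sf Oz) !mulr_sumr -big_split.
apply: eq_bigr => k _.
have -> : (dzbar i (tau k) z)^*%C = 2^-1 * (cderive (ex R i) (tau k) z)^*%C
    - 2^-1 * 'i%C * (cderive (ey R i) (tau k) z)^*%C.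
  by rewrite dzbarE /cdir conj_half_lin // conj2Vi.
have -> : dz i (tau k) z = 2^-1 * cderive (ex R i) (tau k) z
    - 2^-1 * 'i%C * cderive (ey R i) (tau k) z by rewrite dzE /cdir mulNr.
move: (cderive (ex R i) (tau k) z) (cderive (ey R i) (tau k) z).
move: (dz k f (T z)) (dzbar k f (T z)) => u v a b.
move: (a^*%C) (b^*%C) => a' b' /=; ring.
Qed.

(** Second derivatives of the change of coordinates drop out: d_i of the conjugate of d_j tau_l is
    the conjugate of d_j dbar_i tau_l, which vanishes by holomorphy. *)
Lemma ddbar_transition f z : smooth_fun X f -> O z ->
  @ddbar R n M f c z = jacobian_mx c d z *m @ddbar R n M f d (T z) *m adjmx (jacobian_mx c d z).
Proof.
move=> sf Oz; apply/matrixP => i j; rewrite [RHS]congr_mxE [LHS]mxE.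
pose F (w : Cn R n) : C := (f (of_c d w))%:C.
have sF : csmooth (img d) F by exact (csmooth_real oU (sf d Xd)).
have E1 w : O w -> dzbar j (fun w => (f (of_c c w))%:C) w =
    \sum_l (dz j (tau l) w)^*%C * dzbar l F (T w).
  move=> Ow; rewrite -(dzbar_transition j sF Ow).
  apply: (der_ext (dzbar_derivation oO j) Ow) => x [_ dx].
  by rewrite /F /T to_cK.
rewrite (der_ext (dz_derivation oO i) Oz E1).
have s1 l : csmooth O (dz j (tau l)) := der_csmooth (dz_derivation oO j) (tau_smooth l).
have s2 l : csmooth O (fun w => (dz j (tau l) w)^*%C) := csmooth_conj oO (s1 l).
have s3 l : csmooth (img d) (dzbar l F) := der_csmooth (dzbar_derivation oU l) sF.
have s4 l : csmooth O (fun w => dzbar l F (T w)) := csmooth_transition (s3 l).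
rewrite (der_sum oO (dz_derivation oO i) _ _ (fun l => csmoothM oO (s2 l) (s4 l)) Oz).
rewrite exchange_big /=; apply: eq_bigr => l _.
rewrite (derM (dz_derivation oO i) (s2 l) (s4 l) Oz).
have -> : dz i (fun w => (dz j (tau l) w)^*%C) z = 0.
  rewrite (dz_conj oO i (s1 l) Oz) -[RHS]conjc0; congr (_^*%C).
  transitivity (dz j (dzbar i (tau l)) z).
    by rewrite dzE dzbarE (cdirC oO _ _ _ _ _ _ _ _ (tau_smooth l) Oz).
  rewrite -(der_cst (dz_derivation oO j) 0 z).
  by apply: (der_ext (dz_derivation oO j) Oz) => w Ow; exact: tau_holo.
rewrite mul0r add0r (dz_transition i (s3 l) Oz) mulr_sumr.
by apply: eq_bigr => k _; rewrite !mxE mulrCA mulrA.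
Qed.

End Pair.

Lemma ddbar_compatible f : smooth_fun X f -> compatible (@ddbar R n M f).
Proof. by move=> sf c d Xc Xd z Oz; exact: ddbar_transition. Qed.

Lemma chart_atP x : atlas X (chart_at X x) /\ Defs.dom (chart_at X x) x.
Proof. by rewrite /chart_at; case: cid2. Qed.

Lemma congr_chart_at g c x : compatible g -> atlas X c -> Defs.dom c x ->
  g c (to_c c x) = jacobian_mx c (chart_at X x) (to_c c x) *m at_point X g x
    *m adjmx (jacobian_mx c (chart_at X x) (to_c c x)).
Proof.
move=> hg Xc cx; have [Xd dx] := chart_atP x.
have Ox : overlap c (chart_at X x) (to_c c x).
  by split; [exact: to_c_img | rewrite to_cK].
by rewrite {1}(hg c _ Xc Xd _ Ox) /at_point to_cK.
Qed.

(** Invertibility is read off from the transformation law of g, whose left side is positive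
    definite, rather than from the inverse change of coordinates. *)
Lemma jacobian_mx_unit g c x : hermitian_metric X g -> atlas X c -> Defs.dom c x ->
  jacobian_mx c (chart_at X x) (to_c c x) \in unitmx.
Proof.
move=> hg Xc cx.
have := positive_hermitian_unit (hermitian_metric_positive hg Xc (to_c_img cx)).
rewrite (congr_chart_at (hermitian_metric_compatible hg) Xc cx).
by rewrite !unitmx_mul => /andP[/andP[]].
Qed.

Lemma mxtrace_congr (J G H : 'M[C]_n) : J \in unitmx -> G \in unitmx ->
  \tr (invmx (J *m G *m adjmx J) *m (J *m H *m adjmx J)) = \tr (invmx G *m H).
Proof.
move=> uJ uG.
have uJ' : adjmx J \in unitmx.
  by rewrite unitmxE det_adjmx unitfE conjc_eq0 -unitfE -unitmxE.
have u1 : J *m G *m adjmx J \in unitmx by rewrite !unitmx_mul uJ uG uJ'.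
have E : invmx (J *m G *m adjmx J) *m (J *m H *m adjmx J) =
    invmx (adjmx J) *m (invmx G *m H) *m adjmx J.
  apply: (can_inj (mulKmx u1)); rewrite (mulKVmx u1).
  by rewrite !mulmxA (mulmxK uJ') (mulmxK uG).
by rewrite E mxtrace_mulC (mulKVmx uJ').
Qed.

(** [metric_trace] is computed in a chart chosen separately at each point. Only after this
    identification with one fixed chart can it be shown continuous and differentiated. *)
Lemma metric_trace_chart g h c x : hermitian_metric X g -> compatible h ->
  atlas X c -> Defs.dom c x ->
  metric_trace X g h x =
  complex.Re (\tr (invmx (g c (to_c c x)) *m h c (to_c c x))).
Proof.
move=> hg hh Xc cx; have uJ := jacobian_mx_unit hg Xc cx.
rewrite (congr_chart_at hh Xc cx).
rewrite (congr_chart_at (hermitian_metric_compatible hg) Xc cx).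
have uG : at_point X g x \in unitmx.
  have [Xd dx] := chart_atP x.
  exact: positive_hermitian_unit (hermitian_metric_positive hg Xd (to_c_img dx)).
rewrite (mxtrace_congr _ uJ uG) /metric_trace.
move: (at_point X g x) (at_point X h x) => G H.
congr complex.Re; rewrite exchange_big /mxtrace; apply: eq_bigr => j _; rewrite mxE.
by apply: eq_bigr => i _.
Qed.

Lemma det_chart g g' c x (r : R) : hermitian_metric X g -> hermitian_metric X g' ->
  atlas X c -> Defs.dom c x ->
  \det (at_point X g' x) = r%:C * \det (at_point X g x) ->
  \det (g' c (to_c c x)) = r%:C * \det (g c (to_c c x)).
Proof.
move=> hg hg' Xc cx E.
rewrite (congr_chart_at (hermitian_metric_compatible hg) Xc cx).
rewrite (congr_chart_at (hermitian_metric_compatible hg') Xc cx).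
by rewrite !det_mulmx E mulrCA !mulrA.
Qed.

End Transitions.

(** * Derivative tests for Q along a real direction *)

Section LogMaximum.
Variables (R : realType) (V : normedModType R) (U : set V).
Hypothesis oU : open U.
Implicit Types (f g : V -> R) (z v : V).

Lemma smooth_deriveD f g z v : smooth U f -> smooth U g -> U z ->
  'D_v (fun w => f w + g w) z = 'D_v f z + 'D_v g z.
Proof.
move=> sf sg Uz.
exact (deriveD (smooth_derivable (v := v) sf Uz) (smooth_derivable (v := v) sg Uz)).
Qed.

Lemma smooth_deriveM f g z v : smooth U f -> smooth U g -> U z ->
  'D_v (fun w => f w * g w) z = f z * 'D_v g z + g z * 'D_v f z.
Proof.
move=> sf sg Uz.
exact (deriveM (smooth_derivable (v := v) sf Uz) (smooth_derivable (v := v) sg Uz)).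
Qed.

Lemma smooth_deriveV f z v : smooth U f -> U z -> f z != 0 ->
  'D_v (fun w => (f w)^-1) z = - ((f z)^-1 * ((f z)^-1 * 'D_v f z)).
Proof.
move=> sf Uz f0; rewrite (deriveV f0 (smooth_derivable (v := v) sf Uz)).
by rewrite expr2 invfM scaleNr mulrA.
Qed.

Lemma smooth_deriveZ (a : R) f z v : smooth U f -> U z ->
  'D_v (fun w => a * f w) z = a * 'D_v f z.
Proof.
move=> sf Uz; rewrite (smooth_deriveM v (smooth_cst oU a) sf Uz).
by rewrite (derive_cst a z v) mulr0 addr0.
Qed.

(** The term 1 / y contributes - y^-2 times each derivative of phi, which joins the coefficient A,
    and to second order also 2 y^-3 times the squared derivative of phi, the gradient term exploited
    later. *)
Lemma log_max_direction (S phi : V -> R) (A m : R) z v :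
  smooth U S -> smooth U phi -> (forall w, U w -> 0 < S w) ->
  (forall w, U w -> 0 < phi w - m + 1) -> U z ->
  (forall w, U w -> ln (S w) - A * phi w + (phi w - m + 1)^-1 <=
                    ln (S z) - A * phi z + (phi z - m + 1)^-1) ->
  let y := phi z - m + 1 in
  'D_v S z = S z * ((A + y ^- 2) * 'D_v phi z) /\
  'D_v ('D_v S) z / S z - ('D_v S z) ^+ 2 / S z ^+ 2
    - (A + y ^- 2) * 'D_v ('D_v phi) z + 2 * ('D_v phi z) ^+ 2 / y ^+ 3 <= 0.
Proof.
move=> sS sp S0 y0 Uz Qmax y.
pose Y w := phi w - m + 1.
have sY : smooth U Y := smoothD oU (smoothB oU sp (smooth_cst oU m)) (smooth_cst oU 1).
have Yn w : U w -> Y w != 0 by move=> Uw; rewrite gt_eqF // y0.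
have Sn w : U w -> S w != 0 by move=> Uw; rewrite gt_eqF // S0.
have DY w : U w -> 'D_v Y w = 'D_v phi w.
  move=> Uw; rewrite (smooth_deriveD v (smoothB oU sp (smooth_cst oU m)) (smooth_cst oU 1) Uw).
  rewrite (smooth_deriveD v sp (smoothN oU (smooth_cst oU m)) Uw).
  by rewrite (derive_cst (1 : R) w v) (derive_cst (- m) w v) !addr0.
have sYi := smoothV oU Yn sY; have sSi := smoothV oU Sn sS.
have slS := smooth_ln oU S0 sS.
have sAp := smoothM oU (smooth_cst oU (- A)) sp.
pose Q w := ln (S w) + - A * phi w + (Y w)^-1.
have sQ : smooth U Q := smoothD oU (smoothD oU slS sAp) sYi.
have QQ w : U w -> Q w <= Q z by move=> Uw; rewrite /Q !mulNr; exact: Qmax.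
have dS := smooth_derive v sS; have dp := smooth_derive v sp.
have DQ w : U w -> 'D_v Q w = (S w)^-1 * 'D_v S w + - A * 'D_v phi w
     + - ((Y w)^-1 * ((Y w)^-1 * 'D_v phi w)).
  move=> Uw; rewrite (smooth_deriveD v (smoothD oU slS sAp) sYi Uw).
  rewrite (smooth_deriveD v slS sAp Uw) (smooth_deriveZ (- A) v sp Uw).
  by rewrite (derive_comp_ln v sS Uw (S0 w Uw)) (smooth_deriveV v sY Uw (Yn w Uw)) DY.
have DDQ : 'D_v ('D_v Q) z = (S z)^-1 * 'D_v ('D_v S) z
     + 'D_v S z * - ((S z)^-1 * ((S z)^-1 * 'D_v S z))
     + - A * 'D_v ('D_v phi) z
     + - 1 * ((Y z)^-1 * ((Y z)^-1 * 'D_v ('D_v phi) z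
            + 'D_v phi z * - ((Y z)^-1 * ((Y z)^-1 * 'D_v phi z)))
          + ((Y z)^-1 * 'D_v phi z) * - ((Y z)^-1 * ((Y z)^-1 * 'D_v phi z))).
  have s1 := smoothM oU sSi dS.
  have s2 := smoothM oU (smooth_cst oU (- A)) dp.
  have s3 := smoothM oU sYi dp.
  have s4 := smoothM oU sYi s3.
  have s5 := smoothN oU s4.
  transitivity ('D_v (fun w => (S w)^-1 * 'D_v S w + - A * 'D_v phi w
     + - 1 * ((Y w)^-1 * ((Y w)^-1 * 'D_v phi w))) z).
    by apply: (derive_ext oU _ Uz) => w Uw; rewrite DQ // mulN1r.
  have s6 := smoothM oU (smooth_cst oU (- 1)) s4.
  rewrite (smooth_deriveD v (smoothD oU s1 s2) s6 Uz) (smooth_deriveD v s1 s2 Uz).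
  rewrite (smooth_deriveZ (-1) v s4 Uz) (smooth_deriveZ (- A) v dp Uz).
  rewrite (smooth_deriveM v sSi dS Uz) (smooth_deriveM v sYi s3 Uz).
  rewrite (smooth_deriveM v sYi dp Uz).
  by rewrite (smooth_deriveV v sS Uz (Sn z Uz)) (smooth_deriveV v sY Uz (Yn z Uz)) DY.
have := derive_at_max oU v sQ Uz QQ; rewrite DQ //.
have := derive2_at_max oU v sQ Uz QQ; rewrite DDQ.
have SzN := Sn z Uz; have YzN := Yn z Uz.
move: ('D_v ('D_v S) z) ('D_v ('D_v phi) z) => d2S d2p.
move: ('D_v S z) ('D_v phi z) => d1S d1p H2 H1.
have -> : y = Y z by [].
split.
  have E : (S z)^-1 * d1S = (A + Y z ^- 2) * d1p.
    by apply/eqP; rewrite -subr_eq0; apply/eqP; rewrite -[RHS]H1; field; rewrite ?SzN ?YzN.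
  by rewrite -E mulrA mulfV // mul1r.
move: H2; apply: le_trans; rewrite le_eqVlt; apply/orP; left; apply/eqP.
by field; rewrite SzN YzN.
Qed.

End LogMaximum.

(** * The estimate in a frame at the maximum point *)

Section RealWirtinger.
Variables (R : realType) (n : nat) (U : set (Cn R n)).
Hypothesis oU : open U.
Local Notation C := R[i].
Implicit Types (f : Cn R n -> R) (u : 'rV[C]_n).

Lemma cderive_real f z v : cderive v (fun w => (f w)%:C) z = ('D_v f z)%:C.
Proof. by rewrite /cderive /= derive_cst. Qed.

Lemma dirz_real f z u : dirz u (fun w => (f w)%:C) z =
  (2^-1 * 'D_(real_dir u) f z) +i* (- 2^-1 * 'D_(real_dir ('i%C *: u)) f z).
Proof.
rewrite /dirz /cdir !cderive_real.
move: ('D_ _ f z) ('D_ _ f z) => a b.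
have -> : (2^-1 : C) = (2^-1 : R)%:C by rewrite (fmorphV (real_complex R)) (rmorph_nat (real_complex R)).
by apply/eqP; rewrite eq_complex /=; apply/andP; split; apply/eqP; ring.
Qed.

Lemma dirzbar_real f z u : dirzbar u (fun w => (f w)%:C) z =
  (2^-1 * 'D_(real_dir u) f z) +i* (2^-1 * 'D_(real_dir ('i%C *: u)) f z).
Proof.
rewrite /dirzbar /cdir !cderive_real.
move: ('D_ _ f z) ('D_ _ f z) => a b.
have -> : (2^-1 : C) = (2^-1 : R)%:C by rewrite (fmorphV (real_complex R)) (rmorph_nat (real_complex R)).
by apply/eqP; rewrite eq_complex /=; apply/andP; split; apply/eqP; ring.
Qed.

Lemma Re_dirz_dirzbar f z u : smooth U f -> U z ->
  complex.Re (dirz u (dirzbar u (fun w => (f w)%:C)) z) =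
  4^-1 * ('D_(real_dir u) ('D_(real_dir u) f) z
     + 'D_(real_dir ('i%C *: u)) ('D_(real_dir ('i%C *: u)) f) z).
Proof.
move=> sf Uz; set v := real_dir u; set w := real_dir ('i%C *: u).
have -> : dirzbar u (fun w => (f w)%:C) =
    (fun z => (2^-1 * 'D_v f z) +i* (2^-1 * 'D_w f z)).
  by apply/funext => x; rewrite dirzbar_real.
have sv := smooth_derive v sf; have sw := smooth_derive w sf.
have cd x : cderive x (fun z => (2^-1 * 'D_v f z) +i* (2^-1 * 'D_w f z)) z =
    (2^-1 * 'D_x ('D_v f) z) +i* (2^-1 * 'D_x ('D_w f) z).
  have E1 := smooth_deriveZ oU 2^-1 x sv Uz; have E2 := smooth_deriveZ oU 2^-1 x sw Uz.
  exact (f_equal2 (@Complex R) E1 E2).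
rewrite /dirz /cdir -/v -/w !cd.
have key (a b c d : R) : complex.Re (2^-1 * ((2^-1 * a) +i* (2^-1 * c))
    + - (2^-1 * 'i%C) * ((2^-1 * d) +i* (2^-1 * b))) = 4^-1 * (a + b).
  have -> : (2^-1 : C) = (2^-1 : R)%:C.
    by rewrite (fmorphV (real_complex R)) (rmorph_nat (real_complex R)).
  by rewrite /=; field.
exact (key _ _ _ _).
Qed.

Lemma positive_trace (g h : 'M[C]_n) : positive_hermitian g -> positive_hermitian h ->
  exists l : 'I_n -> R, (forall i, 0 < l i) /\ \tr (invmx g *m h) = (\sum_i l i)%:C.
Proof.
move=> hg hh; have [P [l [uP l0 Eg Eh]]] := simultaneous_diagonalization hg hh.
exists l; split => //.
rewrite -(mxtrace_congr h uP (positive_hermitian_unit hg)) Eg Eh invmx1 mul1mx mxtrace_diag.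
rewrite (rmorph_sum (real_complex R)); apply: eq_bigr => i _; by rewrite mxE.
Qed.

Lemma dirz_dirzbar_sum (P : 'M[C]_n) (f : Cn R n -> C) z i j : csmooth U f -> U z ->
  dirz (row i P) (dirzbar (row j P) f) z =
  \sum_k \sum_l P i k * (P j l)^*%C * dz k (dzbar l f) z.
Proof.
move=> sf Uz.
have s1 l : csmooth U (dzbar l f) := der_csmooth (dzbar_derivation oU l) sf.
have s2 : csmooth U (dirzbar (row j P) f) :=
  der_csmooth (dirzbar_derivation oU (row j P)) sf.
rewrite (dirz_sum oU (row i P) s2 Uz); apply: eq_bigr => k _; rewrite mxE.
transitivity (P i k * dz k (fun w => \sum_l (P j l)^*%C * dzbar l f w) z).
  congr (_ * _); apply: (der_ext (dz_derivation oU k) Uz) => w Uw.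
  by rewrite (dirzbar_sum oU (row j P) sf Uw); apply: eq_bigr => l _; rewrite mxE.
rewrite (der_sum oU (dz_derivation oU k) _ _ (fun l => csmoothM oU (csmooth_cst oU _) (s1 l)) Uz).
rewrite mulr_sumr; apply: eq_bigr => l _.
by rewrite (derZ oU (dz_derivation oU k) _ (s1 l) Uz) mulrA.
Qed.

Lemma Re_sum (I : Type) (r : seq I) (F : I -> C) :
  complex.Re (\sum_(i <- r) F i) = \sum_(i <- r) complex.Re (F i).
Proof. by elim/big_rec2: _ => // i a b _ <-; rewrite ReD. Qed.

Lemma Im_sum (I : Type) (r : seq I) (F : I -> C) :
  complex.Im (\sum_(i <- r) F i) = \sum_(i <- r) complex.Im (F i).
Proof. by elim/big_rec2: _ => // i a b _ <-; rewrite ImD. Qed.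

Lemma Re_mulconj (x y : C) : complex.Re (x * y^*%C) =
  complex.Re x * complex.Re y + complex.Im x * complex.Im y.
Proof. by case: x y => [a b] [c d] /=; rewrite mulrN opprK. Qed.

Lemma Re_tr_mul_adj (A B : 'M[C]_n) : complex.Re (\tr (A *m adjmx B)) =
  \sum_i \sum_j (complex.Re (A i j) * complex.Re (B i j)
               + complex.Im (A i j) * complex.Im (B i j)).
Proof.
rewrite /mxtrace Re_sum; apply: eq_bigr => i _; rewrite mxE Re_sum.
by apply: eq_bigr => j _; rewrite !mxE Re_mulconj.
Qed.

Lemma Re_realM (x : R) (z : C) : complex.Re (x%:C * z) = x * complex.Re z.
Proof. by case: z => a b /=; rewrite mul0r subr0. Qed.

Lemma Im_realM (x : R) (z : C) : complex.Im (x%:C * z) = x * complex.Im z.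
Proof. by case: z => a b /=; rewrite mul0r addr0. Qed.

Lemma Re_tr_diag_mul (d : 'I_n -> R) (A : 'M[C]_n) :
  complex.Re (\tr (diag_mx (\row_i (d i)%:C) *m A)) = \sum_i d i * complex.Re (A i i).
Proof.
rewrite /mxtrace Re_sum; apply: eq_bigr => i _.
by rewrite mul_diag_mx !mxE Re_realM.
Qed.

Lemma Re_tr_diag2 (d : 'I_n -> R) (A : 'M[C]_n) :
  complex.Re (\tr (diag_mx (\row_i (d i)%:C) *m A *m diag_mx (\row_i (d i)%:C) *m adjmx A)) =
  \sum_p \sum_q (complex.Re (A p q) ^+ 2 + complex.Im (A p q) ^+ 2) * (d p * d q).
Proof.
rewrite Re_tr_mul_adj; apply: eq_bigr => p _; apply: eq_bigr => q _.
have -> : (diag_mx (\row_i (d i)%:C) *m A *m diag_mx (\row_i (d i)%:C)) p q =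
    (d p)%:C * ((d q)%:C * A p q).
  rewrite mul_mx_diag mxE mul_diag_mx !mxE -mulrA; congr (_ * _); exact: mulrC.
by rewrite 2!Re_realM 2!Im_realM; ring.
Qed.

Lemma Re_mul_adj_diag (A : 'M[C]_n) i : complex.Re ((A *m adjmx A) i i) =
  \sum_j (complex.Re (A i j) ^+ 2 + complex.Im (A i j) ^+ 2).
Proof.
by rewrite mxE Re_sum; apply: eq_bigr => j _; rewrite !mxE Re_mulconj !expr2.
Qed.

Lemma Re_adj_mul_diag (A : 'M[C]_n) i : complex.Re ((adjmx A *m A) i i) =
  \sum_j (complex.Re (A j i) ^+ 2 + complex.Im (A j i) ^+ 2).
Proof.
rewrite mxE Re_sum; apply: eq_bigr => j _.
by rewrite !mxE mulrC Re_mulconj !expr2.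
Qed.

Lemma ReN (x : C) : complex.Re (- x) = - complex.Re x. Proof. by case: x. Qed.
Lemma ImN (x : C) : complex.Im (- x) = - complex.Im x. Proof. by case: x. Qed.

Lemma ReB (x y : C) : complex.Re (x - y) = complex.Re x - complex.Re y.
Proof. by rewrite ReD ReN. Qed.

Lemma ImB (x y : C) : complex.Im (x - y) = complex.Im x - complex.Im y.
Proof. by rewrite ImD ImN. Qed.

Lemma normc_le_sqr (x : C) (k : R) : `|x| <= k%:C ->
  complex.Re x ^+ 2 + complex.Im x ^+ 2 <= k ^+ 2.
Proof.
rewrite normc_def lecR => H; rewrite -[leLHS]sqr_sqrtr ?addr_ge0 ?sqr_ge0 //.
by rewrite lerXn2r ?nnegrE ?sqrtr_ge0 //; apply: le_trans H; exact: sqrtr_ge0.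
Qed.

Lemma mx_add_subE (A B D : 'M[C]_n) i j : (A + B - D) i j = A i j + B i j - D i j.
Proof. by rewrite 3!mxE. Qed.

(** For real functions the frame operator D_p D_pbar is a quarter of the sum of the second
    derivatives along v and iv, and |D_p f|^2 is a quarter of the sum of the squared first ones. The
    conclusion is thus a quarter of the sum of two instances of [log_max_direction]. *)
Lemma average_le0 (s Y B d1 d2 d3 d4 d5 d6 d7 d8 : R) : s != 0 -> Y != 0 ->
  d7 / s - d1 ^+ 2 / s ^+ 2 - B * d5 + 2 * d3 ^+ 2 / Y ^+ 3 <= 0 ->
  d8 / s - d2 ^+ 2 / s ^+ 2 - B * d6 + 2 * d4 ^+ 2 / Y ^+ 3 <= 0 ->
  4^-1 * (d7 + d8) / s - ((2^-1 * d1) ^+ 2 + (- 2^-1 * d2) ^+ 2) / s ^+ 2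
     - B * (4^-1 * (d5 + d6))
     + 2 * ((2^-1 * d3) ^+ 2 + (- 2^-1 * d4) ^+ 2) / Y ^+ 3 <= 0.
Proof.
move=> s0 Y0 H1 H2.
have -> : 4^-1 * (d7 + d8) / s - ((2^-1 * d1) ^+ 2 + (- 2^-1 * d2) ^+ 2) / s ^+ 2
     - B * (4^-1 * (d5 + d6))
     + 2 * ((2^-1 * d3) ^+ 2 + (- 2^-1 * d4) ^+ 2) / Y ^+ 3 =
   4^-1 * ((d7 / s - d1 ^+ 2 / s ^+ 2 - B * d5 + 2 * d3 ^+ 2 / Y ^+ 3)
     + (d8 / s - d2 ^+ 2 / s ^+ 2 - B * d6 + 2 * d4 ^+ 2 / Y ^+ 3)).
  by field; rewrite ?s0 ?Y0.
by rewrite pmulr_rle0 ?invr_gt0 // -[X in _ <= X]addr0 lerD.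
Qed.

Lemma sub_shift (x1 x2 y1 y2 s1 s2 : C) :
  x1 = y1 + s1 -> x2 = y2 + s2 -> s1 = s2 -> x1 - x2 = y1 - y2.
Proof. by move=> -> -> ->; rewrite opprD addrACA subrr addr0. Qed.

(** Transfers the analysis to [maximum_principle_bound]. The matrix P stays constant over U, so the
    transformed metrics are the identity and diagonal at z0 only, and their derivatives there are
    those of g and h contracted with P. *)
Lemma frame_estimate (g h : Cn R n -> 'M[C]_n) (phi F : Cn R n -> R) z0
    (P : 'M[C]_n) (l : 'I_n -> R) (k1 k2 A m Dlow : R)
    (S := fun z => complex.Re (\tr (invmx (g z) *m h z)))
    (y := phi z0 - m + 1)
    (tau := \sum_i (l i)^-1)
    (N0 := n%:R * (n%:R * k2 + n%:R ^+ 2 * k1 ^+ 2)) :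
  U z0 -> msmooth U g -> msmooth U h ->
  (forall z, U z -> positive_hermitian (g z)) ->
  (forall z, U z -> positive_hermitian (h z)) ->
  smooth U phi -> smooth U F ->
  (forall z, U z -> h z = g z +
     \matrix_(i, j) dz i (dzbar j (fun w => (phi w)%:C)) z) ->
  (forall z, U z -> \det (h z) = (expR (F z))%:C * \det (g z)) ->
  P \in unitmx -> (forall i, 0 < l i) ->
  P *m g z0 *m adjmx P = 1%:M ->
  P *m h z0 *m adjmx P = diag_mx (\row_i (l i)%:C) ->
  0 <= k1 -> 0 <= k2 ->
  (forall p i j, `|dirz (row p P) (fun z => (P *m g z *m adjmx P) i j) z0| <= k1%:C) ->
  (forall p i, `|dirz (row p P) (dirzbar (row p P)
      (fun z => (P *m g z *m adjmx P) i i)) z0| <= k2%:C) ->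
  Dlow <= complex.Re (\tr (invmx (g z0) *m
     \matrix_(i, j) dz i (dzbar j (fun w => (F w)%:C)) z0)) ->
  A = (2 * n%:R * k2 + 8 * k1 ^+ 2 * n%:R ^+ 2) + (k2 + 2 * n%:R * k1 ^+ 2) + 2 ->
  (forall w, U w -> 1 <= phi w - m + 1) ->
  (forall w, U w -> ln (S w) - A * phi w + (phi w - m + 1)^-1 <=
                    ln (S z0) - A * phi z0 + (phi z0 - m + 1)^-1) ->
  1 <= S z0 -> (A + 1) ^+ 2 * (2 * n%:R * k1) ^+ 2 * y ^+ 3 <= S z0 ^+ 2 ->
  [/\ S z0 = \sum_i l i, \prod_i l i = expR (F z0) &
    tau <= `|Dlow| + N0 + (A + 1) * n%:R].
Proof.
move=> Uz sg sh hg hh sphi sF Ehg Edet uP l0 Eg Eh k10 k20 bk1 bk2 HD EA y1 Qmax S1 Hbig.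
pose D p := dirz (row p P); pose Db p := dirzbar (row p P).
have hD p : derivation U (D p) := dirz_derivation oU (row p P).
have hDb p : derivation U (Db p) := dirzbar_derivation oU (row p P).
pose v p := real_dir (row p P); pose vi p := real_dir ('i%C *: row p P).
have C1 p q (f : Cn R n -> C) z : csmooth U f -> U z -> D p (D q f) z = D q (D p f) z.
  by move=> sf Uz'; exact (cdirC oU _ _ _ _ _ _ _ _ sf Uz').
have C2 p q (f : Cn R n -> C) z : csmooth U f -> U z -> Db p (D q f) z = D q (Db p f) z.
  by move=> sf Uz'; exact (cdirC oU _ _ _ _ _ _ _ _ sf Uz').
have C3 p q (f : Cn R n -> C) z : csmooth U f -> U z -> Db p (Db q f) z = Db q (Db p f) z.
  by move=> sf Uz'; exact (cdirC oU _ _ _ _ _ _ _ _ sf Uz').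
have conjD p (f : Cn R n -> C) z : csmooth U f -> U z ->
    Db p (fun x => (f x)^*%C) z = (D p f z)^*%C.
  by move=> sf Uz'; exact (dirzbar_conj oU (row p P) sf Uz').
have DDb i j (f : Cn R n -> C) z : csmooth U f -> U z ->
    D i (Db j f) z = \sum_k \sum_l P i k * (P j l)^*%C * dz k (dzbar l f) z.
  by move=> sf Uz'; exact (dirz_dirzbar_sum P i j sf Uz').
have Dreal p (f : Cn R n -> R) z : D p (fun x => (f x)%:C) z =
    (2^-1 * 'D_(v p) f z) +i* (- 2^-1 * 'D_(vi p) f z).
  exact: dirz_real.
have DDbreal p (f : Cn R n -> R) z : smooth U f -> U z ->
    complex.Re (D p (Db p (fun x => (f x)%:C)) z) =
    4^-1 * ('D_(v p) ('D_(v p) f) z + 'D_(vi p) ('D_(vi p) f) z).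
  by move=> sf Uz'; exact (Re_dirz_dirzbar (row p P) sf Uz').
have {}bk1 p i j : `|D p (fun z => (P *m g z *m adjmx P) i j) z0| <= k1%:C by exact (bk1 p i j).
have {}bk2 p i : `|D p (Db p (fun z => (P *m g z *m adjmx P) i i)) z0| <= k2%:C.
  by exact (bk2 p i).
(* From here on only these properties of the operators matter; unfolding them
   would make unification compute in R[i]. *)
clearbody D Db v vi.
pose gt z := P *m g z *m adjmx P; pose ht z := P *m h z *m adjmx P.
have sgt : msmooth U gt := msmoothM oU (msmoothM oU (msmooth_cst oU P) sg) (msmooth_cst oU (adjmx P)).
have sht : msmooth U ht := msmoothM oU (msmoothM oU (msmooth_cst oU P) sh) (msmooth_cst oU (adjmx P)).
have hgt z : U z -> positive_hermitian (gt z) by move=> /hg; exact: positive_hermitian_congr.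
have hht z : U z -> positive_hermitian (ht z) by move=> /hh; exact: positive_hermitian_congr.
have ugt z : U z -> gt z \in unitmx by move=> /hgt /positive_hermitian_unit.
have uht z : U z -> ht z \in unitmx by move=> /hht /positive_hermitian_unit.
pose phiC w : C := (phi w)%:C.
have sphiC : csmooth U phiC by exact (csmooth_real oU sphi).
have Eht z : U z -> forall i j, ht z i j = gt z i j + D i (Db j phiC) z.
  move=> Uz' i j; rewrite /ht (Ehg z Uz') mulmxDr mulmxDl [LHS]mxE; congr (_ + _).
  rewrite congr_mxE (DDb i j _ _ sphiC Uz').
  by apply: eq_bigr => k _; apply: eq_bigr => k' _; rewrite mxE.
have Edett z : U z -> \det (ht z) = (expR (F z))%:C * \det (gt z).
  by move=> /Edet E; rewrite /ht /gt !det_mulmx E mulrCA !mulrA.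
have Etr z : U z -> \tr (invmx (gt z) *m ht z) = (S z)%:C /\ 0 < S z.
  move=> Uz'; rewrite /gt /ht (mxtrace_congr _ uP (positive_hermitian_unit (hg z Uz'))).
  have [l' [l'0 E]] := positive_trace (hg z Uz') (hh z Uz').
  rewrite /S E; split => //=.
  (* In dimension 0 the trace at z0 would be 0, against [S1]. *)
  have n0 : (0 < n)%N.
    case: (posnP n) => // n0; move: S1; rewrite /S.
    rewrite /mxtrace big1 /=; first by rewrite ler10.
    by move=> i _; have := ltn_ord i; rewrite {2}n0.
  rewrite (bigD1 (Ordinal n0)) //=; apply: ltr_wpDr => //.
  by apply: sumr_ge0 => i _; exact: ltW.
pose SC w : C := (S w)%:C.
have sT : csmooth U (fun z => \tr (invmx (gt z) *m ht z)).
  exact (csmooth_tr oU (msmoothM oU (msmooth_inv oU ugt sgt) sht)).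
have sS : smooth U S.
  have [sr _] := sT; apply: (smooth_ext oU _ sr) => z Uz'.
  by rewrite (Etr z Uz').1.
(* Hermitian symmetry makes the (0,1) derivatives adjoints of the (1,0) ones, so H and a describe
   all first derivatives. *)
have hermD (B : Cn R n -> 'M[C]_n) p : msmooth U B ->
    (forall w, U w -> positive_hermitian (B w)) ->
    mder (Db p) B z0 = adjmx (mder (D p) B z0).
  move=> sB hB; apply/matrixP => i j; rewrite mderE.
  have E1 := conjD p _ _ (sB j i) Uz.
  have E2 := der_ext (hDb p) Uz (fun w Uw => (hB w Uw).1 j i).
  by rewrite E2; apply: (etrans E1); rewrite !mxE.
pose H p := mder (D p) ht z0; pose a p := mder (D p) gt z0.
pose c p := mder (D p) (mder (Db p) gt) z0.
pose E p := mder (D p) (mder (Db p) ht) z0.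
have EH p : mder (Db p) ht z0 = adjmx (H p) := hermD ht p sht hht.
have Ea p : mder (Db p) gt z0 = adjmx (a p) := hermD gt p sgt hgt.
have sDb q (f : Cn R n -> C) : csmooth U f -> csmooth U (Db q f) by exact: der_csmooth (hDb q) _.
have sDD q (f : Cn R n -> C) : csmooth U f -> csmooth U (D q f) by exact: der_csmooth (hD q) _.
(* T1 and T2: the first and second derivatives of g' - g = ddbar phi are
   symmetric. *)
have T1 p i j : H p i j - H i p j = a p i j - a i p j.
  have E1 q r : H q r j = a q r j + D q (D r (Db j phiC)) z0.
    have E2 := derD (hD q) (sgt r j) (sDD r _ (sDb j _ sphiC)) Uz.
    have E3 := der_ext (hD q) Uz (fun w Uw => Eht w Uw r j).
    refine (etrans (mderE (D q) ht z0 r j) (etrans E3 (etrans E2 _))).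
    exact (f_equal (fun x => x + D q (D r (Db j phiC)) z0) (esym (mderE (D q) gt z0 r j))).
  have E2 : D p (D i (Db j phiC)) z0 = D i (D p (Db j phiC)) z0.
    exact (C1 _ _ _ _ (sDb j _ sphiC) Uz).
  exact (sub_shift (E1 p i) (E1 i p) E2).
have T2 p i : E p i i - E i p p = c p i i - c i p p.
  have E1 q r : E q r r = c q r r + D q (Db q (D r (Db r phiC))) z0.
    have s1 := sDD r _ (sDb r _ sphiC).
    have E2 : D q (fun w => mder (Db q) ht w r r) z0 =
        D q (fun w => mder (Db q) gt w r r + Db q (D r (Db r phiC)) w) z0.
      apply: (der_ext (hD q) Uz) => w Uw.
      have E3 := der_ext (hDb q) Uw (fun x Ux => Eht x Ux r r).
      have E4 := derD (hDb q) (sgt r r) s1 Uw.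
      refine (etrans (mderE (Db q) ht w r r) (etrans E3 (etrans E4 _))).
      exact (f_equal (fun x => x + Db q (D r (Db r phiC)) w) (esym (mderE (Db q) gt w r r))).
    have s2 := msmooth_mder oU (hDb q) sgt.
    have E3 := derD (hD q) (s2 r r) (sDb q _ s1) Uz.
    refine (etrans (mderE (D q) (mder (Db q) ht) z0 r r) (etrans E2 (etrans E3 _))).
    exact (f_equal (fun x => x + D q (Db q (D r (Db r phiC))) z0)
      (esym (mderE (D q) (mder (Db q) gt) z0 r r))).
  suff E2 : D p (Db p (D i (Db i phiC))) z0 = D i (Db i (D p (Db p phiC))) z0.
    exact (sub_shift (E1 p i) (E1 i p) E2).
  refine (etrans (y := D p (D i (Db p (Db i phiC))) z0) _ _).
    apply: (der_ext (hD p) Uz) => x Ux.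
    exact (C2 _ _ _ _ (sDb i _ sphiC) Ux).
  refine (etrans (y := D i (D p (Db p (Db i phiC))) z0) _ _).
    exact (C1 _ _ _ _ (sDb p _ (sDb i _ sphiC)) Uz).
  refine (etrans (y := D i (D p (Db i (Db p phiC))) z0) _ _).
    apply: (der_ext (hD i) Uz) => x Ux; apply: (der_ext (hD p) Ux) => x' Ux'.
    exact (C3 _ _ _ _ sphiC Ux').
  apply: (der_ext (hD i) Uz) => x Ux.
  exact (esym (C2 _ _ _ _ (sDb p _ sphiC) Ux)).
have gt1 : gt z0 = 1%:M by [].
have ht1 : ht z0 = diag_mx (\row_i (l i)%:C) by [].
have hti : invmx (ht z0) = diag_mx (\row_i ((l i)^-1)%:C).
  have E1 : diag_mx (\row_i ((l i)^-1)%:C) *m ht z0 = 1%:M.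
    rewrite ht1 mulmx_diag; apply/matrixP => i j; rewrite !mxE.
    case: eqP => // _; rewrite !mulr1n.
    transitivity (((l i)^-1 * l i)%:C); first exact/esym/(rmorphM (real_complex R)).
    by rewrite mulVf // gt_eqF.
  by rewrite -[LHS]mul1mx -E1 mulmxK // uht.
have S0E : S z0 = \sum_i l i.
  have := (Etr z0 Uz).1; rewrite gt1 ht1 invmx1 mul1mx mxtrace_diag => /(congr1 (@complex.Re R)).
  by rewrite /= => <-; rewrite Re_sum; apply: eq_bigr => i _; rewrite mxE.
have prodE : \prod_i l i = expR (F z0).
  have := Edett z0 Uz; rewrite gt1 ht1 det1 mulr1 det_diag => /(congr1 (@complex.Re R)) /= <-.
  transitivity (complex.Re (\prod_i l i)%:C); first by [].
  by rewrite (rmorph_prod (real_complex R)); congr complex.Re; apply: eq_bigr => i _; rewrite mxE.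
have DSp p : D p SC z0 = \tr (H p) - \tr (a p *m ht z0).
  refine (etrans _ (der_trace_inv oU (hD p) ugt sht sgt Uz gt1)).
  by apply: (der_ext (hD p) Uz) => x Ux; exact (esym (Etr x Ux).1).
have LSp p : D p (Db p SC) z0 =
    \tr ((a p *m adjmx (a p) + adjmx (a p) *m a p - c p) *m ht z0)
    - \tr (adjmx (a p) *m H p) - \tr (a p *m adjmx (H p)) + \tr (E p).
  have L := der2_trace_inv oU (hD p) (hDb p) ugt sht sgt Uz gt1.
  rewrite -(Ea p) -(EH p); refine (etrans _ L).
  apply: (der_ext (hD p) Uz) => x Ux; apply: (der_ext (hDb p) Ux) => x' Ux'.
  exact (esym (Etr x' Ux').1).
pose FC w : C := (F w)%:C.
have sFC : csmooth U FC by exact (csmooth_real oU sF).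
have LFi i : D i (Db i FC) z0 =
    \tr (invmx (ht z0) *m E i) - \tr (invmx (ht z0) *m H i *m invmx (ht z0) *m adjmx (H i))
    - (\tr (c i) - \tr (a i *m adjmx (a i))).
  rewrite -(EH i) -(Ea i).
  refine (etrans (der2_log_det oU (hD i) (hDb i) uht ugt sht sgt sF Edett Uz) _).
  by rewrite gt1 invmx1 !mul1mx mulmx1.
(* As g is the identity in the frame at z0, the Laplacian of F there is the sum of the D_i Db_i
   F. *)
have HD' : Dlow <= \sum_i complex.Re (D i (Db i FC) z0).
  apply: (le_trans HD); rewrite le_eqVlt; apply/orP; left; apply/eqP.
  rewrite -(mxtrace_congr _ uP (positive_hermitian_unit (hg z0 Uz))) -/(gt z0) gt1.
  rewrite invmx1 mul1mx /mxtrace Re_sum; apply: eq_bigr => i _; congr complex.Re.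
  rewrite congr_mxE (DDb i i _ _ sFC Uz).
  by apply: eq_bigr => k _; apply: eq_bigr => k' _; rewrite mxE.
split => //.
have bka p i j : complex.Re (a p i j) ^+ 2 + complex.Im (a p i j) ^+ 2 <= k1 ^+ 2.
  by apply: normc_le_sqr; rewrite mderE; exact: bk1.
have bkc p i : `|complex.Re (c p i i)| <= k2.
  rewrite -lecR; apply: (le_trans (normc_ge_Re _)); rewrite mderE.
  have -> : D p (fun x => mder (Db p) gt x i i) z0 =
      D p (Db p (fun x => (P *m g x *m adjmx P) i i)) z0; last exact: bk2.
  by apply: (der_ext (hD p) Uz) => x Ux; rewrite mderE.
clearbody H a c E.
have Sl0 : 0 < \sum_i l i by rewrite -S0E; exact: (lt_le_trans ltr01 S1).
have T1x p i j : complex.Re (H p i j) - complex.Re (H i p j) =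
    complex.Re (a p i j) - complex.Re (a i p j) by rewrite -2!ReB (T1 p i j).
have T1y p i j : complex.Im (H p i j) - complex.Im (H i p j) =
    complex.Im (a p i j) - complex.Im (a i p j) by rewrite -2!ImB (T1 p i j).
have T2x p i : complex.Re (E p i i) - complex.Re (E i p p) =
    complex.Re (c p i i) - complex.Re (c i p p) by rewrite -2!ReB (T2 p i).
have HD2 : Dlow <= \sum_i (\sum_p (l p)^-1 * complex.Re (E i p p)
    - \sum_p \sum_q (complex.Re (H i p q) ^+ 2 + complex.Im (H i p q) ^+ 2) / (l p * l q)
    - (\sum_p complex.Re (c i p p) -
       \sum_p \sum_q (complex.Re (a i p q) ^+ 2 + complex.Im (a i p q) ^+ 2))).
  apply: (le_trans HD'); rewrite le_eqVlt; apply/orP; left; apply/eqP.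
  apply: eq_bigr => i _.
  refine (etrans (f_equal (@complex.Re R) (LFi i)) _).
  rewrite hti; refine (etrans (ReB _ _) _); rewrite (ReB (\tr (c i))).
  rewrite [complex.Re (\tr _ - \tr _)]ReB Re_tr_diag_mul Re_tr_diag2.
  congr (_ - _ - (_ - _)).
  - by apply: eq_bigr => p _; apply: eq_bigr => q _; rewrite invfM.
  - by rewrite /mxtrace Re_sum.
  - rewrite Re_tr_mul_adj; apply: eq_bigr => p _; apply: eq_bigr => q _.
    by rewrite -!expr2.
have LSre p : complex.Re (D p (Db p SC) z0) =
    \sum_i (\sum_j (complex.Re (a p i j) ^+ 2 + complex.Im (a p i j) ^+ 2)
        + \sum_j (complex.Re (a p j i) ^+ 2 + complex.Im (a p j i) ^+ 2)
        - complex.Re (c p i i)) * l i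
     - 2 * \sum_i \sum_j (complex.Re (a p i j) * complex.Re (H p i j)
        + complex.Im (a p i j) * complex.Im (H p i j))
     + \sum_i complex.Re (E p i i).
  rewrite (LSp p) ReD 2!ReB; congr (_ + _); last by rewrite /mxtrace Re_sum.
  rewrite ht1 mxtrace_mulC Re_tr_diag_mul [\tr (adjmx _ *m _)]mxtrace_mulC.
  rewrite 2!Re_tr_mul_adj mulr2n mulrDl mul1r opprD addrA; congr (_ - _ - _).
  - apply: eq_bigr => i _; rewrite mulrC; congr (_ * _).
    by rewrite mx_add_subE ReB ReD Re_mul_adj_diag Re_adj_mul_diag.
  - apply: eq_bigr => i _; apply: eq_bigr => j _.
    by rewrite [_ * complex.Re (a p i j)]mulrC [_ * complex.Im (a p i j)]mulrC.
have HLmain := laplacian_trace_bound l0 Sl0 bka k10 bkc T1x T1y T2x HD2 LSre.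
have Tbound (f : 'I_n -> 'I_n -> 'I_n -> R) p : (forall p i j, `|f p i j| <= k1) ->
    `|\sum_i (f p i i - f i p i)| <= 2 * n%:R * k1.
  move=> fk; apply: (le_trans (ler_norm_sum _ _ _)).
  have -> : 2 * n%:R * k1 = \sum_(i < n) (k1 + k1).
    by rewrite sumr_const card_ord -[_ *+ n]mulr_natl; ring.
  by apply: ler_sum => i _; apply: (le_trans (ler_normB _ _)); exact: lerD.
have abs_le (r s : R) : r ^+ 2 + s ^+ 2 <= k1 ^+ 2 -> `|r| <= k1.
  move=> rs; rewrite -(ler_pXn2r (n := 2)) ?nnegrE // real_normK ?num_real //.
  by apply: le_trans rs; rewrite lerDl sqr_ge0.
have axk p i j : `|complex.Re (a p i j)| <= k1 by exact: abs_le (bka p i j).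
have ayk p i j : `|complex.Im (a p i j)| <= k1.
  by apply: (abs_le _ (complex.Re (a p i j))); rewrite addrC.
have LM q := @log_max_direction R _ U oU S phi A m z0 q sS sphi
  (fun x Ux => (Etr x Ux).2) (fun x Ux => lt_le_trans ltr01 (y1 x Ux)) Uz Qmax.
have sxE p : complex.Re (D p SC z0) = 2^-1 * 'D_(v p) S z0 by rewrite /SC Dreal.
have syE p : complex.Im (D p SC z0) = - 2^-1 * 'D_(vi p) S z0 by rewrite /SC Dreal.
have sxE' p : complex.Re (D p SC z0) =
    \sum_i (complex.Re (H p i i) - complex.Re (a p i i) * l i).
  rewrite (DSp p) ReB ht1 mxtrace_mulC Re_tr_diag_mul /mxtrace Re_sum -sumrB.
  by apply: eq_bigr => i _; rewrite [l i * _]mulrC.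
have syE' p : complex.Im (D p SC z0) =
    \sum_i (complex.Im (H p i i) - complex.Im (a p i i) * l i).
  rewrite (DSp p) ImB ht1 mxtrace_mulC /mxtrace 2!Im_sum -sumrB.
  apply: eq_bigr => i _; rewrite mul_diag_mx; congr (_ - _).
  by rewrite [in LHS]mxE [in LHS]mxE Im_realM mulrC.
(* Diagonal entry p of g' = g + ddbar phi in the frame, where g has entry 1 and g' has entry l p. *)
have lapphi p : 4^-1 * ('D_(v p) ('D_(v p) phi) z0 + 'D_(vi p) ('D_(vi p) phi) z0) = l p - 1.
  rewrite -(DDbreal p phi z0 sphi Uz).
  have := Eht z0 Uz p p; rewrite gt1 ht1 => /(congr1 (@complex.Re R)).
  have e1 : complex.Re ((diag_mx (\row_i (l i)%:C) : 'M[C]_n) p p) = l p.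
    by rewrite !mxE eqxx mulr1n.
  have e2 : complex.Re ((1%:M : 'M[C]_n) p p) = 1 by rewrite mxE eqxx.
  by rewrite ReD e1 e2 => ->; rewrite addrAC subrr add0r.
have N1p : 0 <= 2 * n%:R * k2 + 8 * k1 ^+ 2 * n%:R ^+ 2.
  by rewrite addr_ge0 // !mulr_ge0 // ?sqr_ge0.
have N2p : 0 <= k2 + 2 * n%:R * k1 ^+ 2 by rewrite addr_ge0 // !mulr_ge0 // sqr_ge0.
have N0p : 0 <= N0 by rewrite /N0 mulr_ge0 // addr_ge0 // mulr_ge0 // sqr_ge0.
apply: (@maximum_principle_bound R n l (fun p => complex.Re (D p (Db p SC) z0))
  (fun p => complex.Re (D p SC z0)) (fun p => complex.Im (D p SC z0))
  (fun p => 2^-1 * 'D_(v p) phi z0) (fun p => - 2^-1 * 'D_(vi p) phi z0)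
  (fun p => \sum_i (complex.Re (a p i i) - complex.Re (a i p i)))
  (fun p => \sum_i (complex.Im (a p i i) - complex.Im (a i p i)))
  (2 * n%:R * k1) A Dlow y N0 _ _ l0 _ (y1 z0 Uz) N0p N1p N2p EA).
- by rewrite -S0E.
- by move=> p; rewrite sxE (LM (v p)).1 -S0E -/y 2!(mulrCA 2^-1).
- by move=> p; rewrite syE (LM (vi p)).1 -S0E -/y 2!(mulrCA (- 2^-1)).
- move=> p; rewrite -S0E (DDbreal p S z0 sS Uz) sxE syE -(lapphi p).
  have y0 : y != 0 by rewrite gt_eqF //; exact: (lt_le_trans ltr01 (y1 z0 Uz)).
  have S0 : S z0 != 0 by rewrite gt_eqF //; exact: (lt_le_trans ltr01 S1).
  exact (average_le0 S0 y0 (LM (v p)).2 (LM (vi p)).2).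
- apply: le_trans HLmain; rewrite le_eqVlt; apply/orP; left; apply/eqP.
  by congr (_ + _ + _); apply: eq_bigr => p _; rewrite ?sxE' ?syE'.
- by move=> p; exact (Tbound (fun p i j => complex.Re (a p i j)) p axk).
- by move=> p; exact (Tbound (fun p i j => complex.Im (a p i j)) p ayk).
- by rewrite -S0E.
Qed.

End RealWirtinger.

(** * Bounds on the frame and on derivatives of g in it *)

Section FrameBounds.
Variables (R : realType) (n : nat) (U : set (Cn R n)).
Hypothesis oU : open U.
Local Notation C := R[i].

(** The normalization of g says that g^-1 is the adjoint of P times P, so its diagonal entries are
    the squared norms of the columns of P. From K >= 1 comes K <= K^2. *)
Lemma frame_norm_le (P g : 'M[C]_n) (K : R) i j : 1 <= K -> P \in unitmx ->
  P *m g *m adjmx P = 1%:M -> (forall i, `|invmx g i i| <= K%:C) -> `|P i j| <= K%:C.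
Proof.
move=> K1 uP Eg Kg.
have uP' : adjmx P \in unitmx.
  by rewrite unitmxE det_adjmx unitfE conjc_eq0 -unitfE -unitmxE.
have Eg' : g = invmx P *m invmx (adjmx P).
  by rewrite -[LHS](mulKmx uP) -[X in _ *m X](mulmxK uP') Eg mul1mx.
have ug : g \in unitmx by rewrite Eg' unitmx_mul !unitmx_inv uP.
have inv_g : invmx g = adjmx P *m P.
  by apply: (can_inj (mulKmx ug)); rewrite mulmxV // Eg' -mulmxA (mulKmx uP') mulVmx.
have K0 : 0 <= K%:C :> C by rewrite ler0c (le_trans ler01).
rewrite -(ler_pXn2r (n := 2)) ?nnegrE //.
have inv_jj : invmx g j j = \sum_k `|P k j| ^+ 2.
  rewrite inv_g mxE; apply: eq_bigr => k _.
  by rewrite !mxE sqr_normc mulrC.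
apply: (@le_trans _ _ `|invmx g j j|).
  rewrite inv_jj [leRHS]ger0_norm; last by apply: sumr_ge0 => k _; rewrite exprn_ge0.
  by rewrite (bigD1 i) //= lerDl; apply: sumr_ge0 => k _; rewrite exprn_ge0.
apply: (le_trans (Kg j)).
have -> : K%:C ^+ 2 = (K ^+ 2)%:C by rewrite (rmorphXn (real_complex R)).
by rewrite lecR expr2 ler_peMl // (le_trans ler01).
Qed.

Lemma congr_norm_le (P A : 'M[C]_n) (K : R) i j :
  (forall i j, `|P i j| <= K%:C) -> (forall i j, `|A i j| <= K%:C) ->
  `|(P *m A *m adjmx P) i j| <= (n%:R ^+ 2 * K ^+ 3)%:C.
Proof.
move=> PK AK; rewrite congr_mxE.
have -> : (n%:R ^+ 2 * K ^+ 3)%:C = \sum_(k < n) \sum_(l < n) (K ^+ 3)%:C.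
  rewrite !sumr_const !card_ord -mulrnA -[_ *+ (n * n)]mulr_natl natrM -expr2.
  rewrite (rmorphM (real_complex R)) (rmorphXn (real_complex R)).
  by rewrite (rmorph_nat (real_complex R)).
apply: (le_trans (ler_norm_sum _ _ _)); apply: ler_sum => k _.
apply: (le_trans (ler_norm_sum _ _ _)); apply: ler_sum => l _.
rewrite !normrM normcJ.
have -> : (K ^+ 3)%:C = K%:C * K%:C * K%:C.
  by rewrite (rmorphXn (real_complex R)) exprSr expr2.
by rewrite !ler_pM // mulr_ge0.
Qed.

Lemma mder_congr D (P : 'M[C]_n) (g : Cn R n -> 'M[C]_n) z : derivation U D ->
  msmooth U g -> U z ->
  mder D (fun w => P *m g w *m adjmx P) z = P *m mder D g z *m adjmx P.
Proof.
move=> hD sg Uz.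
have s1 := msmooth_cst oU P; have s2 := msmooth_cst oU (adjmx P).
have s3 := msmoothM oU s1 sg.
rewrite (mderM oU hD s3 s2 Uz) (mderM oU hD s1 sg Uz) (mder_cst hD P z).
by rewrite (mder_cst hD (adjmx P) z) mul0mx add0r mulmx0 addr0.
Qed.

(** One factor n for each summed index and one K for each entry: three entries of P and a first
    derivative of g. [frame_der2_le] has one more index and one more entry of P. *)
Lemma frame_der1_le (P : 'M[C]_n) (g : Cn R n -> 'M[C]_n) z (K : R) p i j :
  1 <= K -> msmooth U g -> U z -> (forall i j, `|P i j| <= K%:C) ->
  (forall m k l, `|dz m (fun w => g w k l) z| <= K%:C) ->
  `|dirz (row p P) (fun w => (P *m g w *m adjmx P) i j) z| <=
    (n%:R ^+ 3 * K ^+ 4)%:C.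
Proof.
move=> K1 sg Uz PK gK.
have sgt : msmooth U (fun w => P *m g w *m adjmx P).
  exact (msmoothM oU (msmoothM oU (msmooth_cst oU P) sg) (msmooth_cst oU (adjmx P))).
rewrite (dirz_sum oU (row p P) (sgt i j) Uz).
have -> : (n%:R ^+ 3 * K ^+ 4)%:C = \sum_(m < n) K%:C * (n%:R ^+ 2 * K ^+ 3)%:C.
  rewrite sumr_const card_ord -(rmorphM (real_complex R)) -(rmorphMn (real_complex R)) -mulr_natl.
  by congr (_%:C); ring.
apply: (le_trans (ler_norm_sum _ _ _)); apply: ler_sum => m _.
rewrite normrM mxE; apply: ler_pM => //.
rewrite -(mderE (dz m) (fun w => P *m g w *m adjmx P) z i j).
rewrite (mder_congr P (dz_derivation oU m) sg Uz).
by apply: congr_norm_le => // k l; rewrite mderE; exact: gK.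
Qed.

Lemma frame_der2_le (P : 'M[C]_n) (g : Cn R n -> 'M[C]_n) z (K : R) p i j :
  1 <= K -> msmooth U g -> U z -> (forall i j, `|P i j| <= K%:C) ->
  (forall m m' k l, `|dz m (dzbar m' (fun w => g w k l)) z| <= K%:C) ->
  `|dirz (row p P) (dirzbar (row p P) (fun w => (P *m g w *m adjmx P) i j)) z| <=
    (n%:R ^+ 4 * K ^+ 5)%:C.
Proof.
move=> K1 sg Uz PK gK.
have sgt : msmooth U (fun w => P *m g w *m adjmx P).
  exact (msmoothM oU (msmoothM oU (msmooth_cst oU P) sg) (msmooth_cst oU (adjmx P))).
rewrite (dirz_dirzbar_sum oU P p p (sgt i j) Uz).
have -> : (n%:R ^+ 4 * K ^+ 5)%:C =
    \sum_(m < n) \sum_(m' < n) K%:C * K%:C * (n%:R ^+ 2 * K ^+ 3)%:C.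
  rewrite !sumr_const !card_ord -mulrnA -!(rmorphM (real_complex R)) -(rmorphMn (real_complex R)).
  rewrite -[_ *+ (n * n)]mulr_natl natrM.
  by congr (_%:C); ring.
apply: (le_trans (ler_norm_sum _ _ _)); apply: ler_sum => m _.
apply: (le_trans (ler_norm_sum _ _ _)); apply: ler_sum => m' _.
rewrite normrM [X in X * _ <= _]normrM normcJ; apply: ler_pM; [by rewrite mulr_ge0|by []| |].
  exact: ler_pM.
have -> : dz m (dzbar m' (fun w => (P *m g w *m adjmx P) i j)) z =
    (P *m mder (dz m) (mder (dzbar m') g) z *m adjmx P) i j.
  rewrite -(mder_congr P (dz_derivation oU m) (msmooth_mder oU (dzbar_derivation oU m') sg) Uz).
  rewrite mderE; apply: (der_ext (dz_derivation oU m) Uz) => w Uw.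
  by rewrite -(mder_congr P (dzbar_derivation oU m') sg Uw) mderE.
apply: congr_norm_le => // k l; rewrite mderE.
have -> : dz m (fun w => mder (dzbar m') g w k l) z = dz m (dzbar m' (fun w => g w k l)) z.
  by apply: (der_ext (dz_derivation oU m) Uz) => w Uw; rewrite mderE.
exact: gK.
Qed.

Lemma local_bound (T : finType) (f : T -> Cn R n -> C) z :
  (forall t, csmooth U (f t)) -> U z ->
  exists2 B : R, 0 <= B & \forall w \near z, forall t, `|f t w| <= B%:C.
Proof.
move=> sf Uz.
(* Near z the real and imaginary parts move by less than 1 each, hence the 2; the sum over t then
   serves every t at once. *)
pose b t := `|complex.Re (f t z)| + `|complex.Im (f t z)| + 2.
have b0 t : 0 <= b t by rewrite !addr_ge0.
exists (\sum_t b t); first exact: sumr_ge0.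
apply: (@filter_forall _ T (fun t w => `|f t w| <= (\sum_t b t)%:C) (nbhs z)) => t.
have /cvgrPdist_lt/(_ _ ltr01) c1 := smooth_continuous (sf t).1 Uz.
have /cvgrPdist_lt/(_ _ ltr01) c2 := smooth_continuous (sf t).2 Uz.
apply: filterS2 c1 c2 => w H1 H2.
apply: (@le_trans _ _ (b t)%:C); last first.
  rewrite lecR (bigD1 t) //= lerDl; exact: sumr_ge0.
have le1 (x y : R) : `|x - y| < 1 -> `|y| <= `|x| + 1.
  move=> xy; rewrite -[y](subKr x) (le_trans (ler_normB _ _)) // lerD2l ltW //.
have normc_le (x : C) : `|x| <= (`|complex.Re x| + `|complex.Im x|)%:C.
  rewrite [X in `|X| <= _]complexE (le_trans (ler_normD _ _)) // normrM.
  rewrite !normc_def /= !expr0n /= !addr0 add0r expr1n sqrtr1 !sqrtr_sqr mul1r.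
  by rewrite -(rmorphD (real_complex R)).
apply: (le_trans (normc_le _)); rewrite lecR /b.
have := le1 _ _ H1; have := le1 _ _ H2; lra.
Qed.

End FrameBounds.

(** * Uniform bounds and continuity from compactness *)

Section Compactness.
Variables (R : realType) (n : nat) (M : topologicalType).
Variable X : complex_manifold R n M.
Local Notation C := R[i].
Implicit Types (c : chart R n M) (f : M -> R) (g h : tensor11 R n M).

(** Compactness in its near-covering form, with B tending to +oo as the parameter: a local bound and
    monotonicity make P B x' hold for all x' near x and all large B. *)
Lemma compact_uniform_bound (P : R -> M -> Prop) : compact [set: M] ->
  (forall B B' x, B <= B' -> P B x -> P B' x) ->
  (forall x, exists B, \forall x' \near (x : M), P B x') -> exists B, forall x, P B x.
Proof.
move=> cM mono loc; have nc := proj1 (compact_near_coveringP [set: M]) cM.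
have /filter_ex[B PB] : \forall B \near +oo, [set: M] `<=` P B.
  refine (nc R _ P _ _) => x _; have [B PB] := loc x.
  exists ([set x' | P B x'], [set B' | B <= B']).
    by split => //=; apply: nbhs_pinfty_ge; rewrite num_real.
  by case=> x' B' /= [H1 H2]; exact: mono H2 H1.
by exists B => x; exact: PB.
Qed.

Lemma chart_continuous c f (psi : Cn R n -> R) x : Defs.dom c x ->
  {for to_c c x, continuous psi} ->
  (forall x', Defs.dom c x' -> f x' = psi (to_c c x')) -> {for x, continuous f}.
Proof.
move=> cx cpsi Ef.
have cc : {for x, continuous (psi \o to_c c)}.
  by apply: continuous_comp => //; exact: to_c_continuous.
rewrite /prop_for /continuous_at (Ef x cx); apply: cvg_trans cc.
apply: near_eq_cvg; apply: filterS (open_nbhs_nbhs (conj (@dom_open _ _ _ c) cx)).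
by move=> x' /Ef ->.
Qed.

Lemma smooth_fun_continuous f : smooth_fun X f -> continuous f.
Proof.
move=> sf x; have [c Xc cx] := atlas_cover X x.
apply: (chart_continuous cx (psi := fun z => f (of_c c z))) => [|x' cx'].
  exact (smooth_continuous (sf c Xc) (to_c_img cx)).
by rewrite to_cK.
Qed.

Lemma msmooth_invmx_metric g c : hermitian_metric X g -> atlas X c ->
  msmooth (img c) (fun z => invmx (g c z)).
Proof.
move=> hg Xc; apply: (msmooth_inv (@img_open _ _ _ c)); last exact (metric_smooth hg Xc).
by move=> z cz; exact (positive_hermitian_unit (hermitian_metric_positive hg Xc cz)).
Qed.

Lemma metric_trace_continuous g h : hermitian_metric X g -> compatible X h ->
  (forall c, atlas X c -> msmooth (img c) (h c)) -> continuous (metric_trace X g h).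
Proof.
move=> hg hh sh x; have [c Xc cx] := atlas_cover X x.
apply: (chart_continuous cx
  (psi := fun z => complex.Re (\tr (invmx (g c z) *m h c z)))) => [|x' cx'].
  have oc := @img_open _ _ _ c.
  have [s _] := csmooth_tr oc (msmoothM oc (msmooth_invmx_metric hg Xc) (sh c Xc)).
  exact (smooth_continuous s (to_c_img cx)).
exact: metric_trace_chart.
Qed.

Lemma msmooth_ddbar f c : smooth_fun X f -> atlas X c ->
  msmooth (img c) (@ddbar R n M f c).
Proof.
move=> sf Xc i j; have oc := @img_open _ _ _ c.
have s : csmooth (img c) (fun z => (f (of_c c z))%:C) := csmooth_real oc (sf c Xc).
have s1 := der_csmooth (dz_derivation oc i) (der_csmooth (dzbar_derivation oc j) s).
by apply: (csmooth_ext oc _ s1) => z _; rewrite mxE.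
Qed.

(** The chart must be allowed to vary with x. Around each point one fixed chart gives a local bound,
    whereas the arbitrary choice in [chart_at] offers no control at neighbouring points. *)
Lemma metric_uniform_bound g : compact [set: M] -> hermitian_metric X g ->
  exists2 K : R, 1 <= K & forall x, exists c, [/\ atlas X c, Defs.dom c x,
    forall i, `|invmx (g c (to_c c x)) i i| <= K%:C,
    forall m k l, `|dz m (fun w => g c w k l) (to_c c x)| <= K%:C &
    forall m m' k l, `|dz m (dzbar m' (fun w => g c w k l)) (to_c c x)| <= K%:C].
Proof.
move=> cM hg.
pose P K x := exists c, [/\ atlas X c, Defs.dom c x,
    forall i, `|invmx (g c (to_c c x)) i i| <= K%:C,
    forall m k l, `|dz m (fun w => g c w k l) (to_c c x)| <= K%:C &
    forall m m' k l, `|dz m (dzbar m' (fun w => g c w k l)) (to_c c x)| <= K%:C].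
have mono B B' x : B <= B' -> P B x -> P B' x.
  move=> BB [c [Xc cx H1 H2 H3]]; exists c; split => //.
  - by move=> i; apply: le_trans (H1 i) _; rewrite lecR.
  - by move=> m k l; apply: le_trans (H2 m k l) _; rewrite lecR.
  - by move=> m m' k l; apply: le_trans (H3 m m' k l) _; rewrite lecR.
have loc (x : M) : exists B, \forall x' \near x, P B x'.
  have [c Xc cx] := atlas_cover X x.
  have oc := @img_open _ _ _ c; have cz := to_c_img cx.
  have sg : msmooth (img c) (g c) := metric_smooth hg Xc.
  have s1 i : csmooth (img c) (fun z => invmx (g c z) i i) :=
    msmooth_invmx_metric hg Xc i i.
  have s2 (t : 'I_n * 'I_n * 'I_n) :
      csmooth (img c) (dz t.1.1 (fun w => g c w t.1.2 t.2)) :=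
    der_csmooth (dz_derivation oc t.1.1) (sg t.1.2 t.2).
  have s3 (t : 'I_n * 'I_n * 'I_n * 'I_n) :
      csmooth (img c) (dz t.1.1.1 (dzbar t.1.1.2 (fun w => g c w t.1.2 t.2))) :=
    der_csmooth (dz_derivation oc t.1.1.1)
     (der_csmooth (dzbar_derivation oc t.1.1.2) (sg t.1.2 t.2)).
  have [B1 B10 N1] := local_bound s1 cz.
  have [B2 B20 N2] := local_bound s2 cz.
  have [B3 B30 N3] := local_bound s3 cz.
  exists (B1 + B2 + B3).
  have near_dom : nbhs x (Defs.dom c) := open_nbhs_nbhs (conj (@dom_open _ _ _ c) cx).
  have near_to_c (Q : Cn R n -> Prop) : (\forall w \near to_c c x, Q w) ->
    \forall x' \near x, Q (to_c c x') := fun NQ => to_c_continuous cx NQ.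
  refine (filterS _ (filterI (near_to_c _ N1) (filterI (near_to_c _ N2)
    (filterI (near_to_c _ N3) near_dom)))) => x' [H1 [H2 [H3 cx']]].
  exists c; split => //.
  - by move=> i; apply: le_trans (H1 i) _; rewrite lecR; lra.
  - by move=> m k l; apply: le_trans (H2 (m, k, l)) _; rewrite lecR; lra.
  - by move=> m m' k l; apply: le_trans (H3 (m, m', k, l)) _; rewrite lecR; lra.
have [B PB] := compact_uniform_bound cM mono loc.
(* [frame_norm_le] asks for K >= 1. *)
exists (Num.max 1 B); first by rewrite le_max lexx.
by move=> x; apply: mono (PB x); rewrite le_max lexx orbT.
Qed.

End Compactness.

(** * The trace at the maximum point *)

Section MaximumPoint.
Variables (R : realType) (n : nat) (M : topologicalType).
Variable X : complex_manifold R n M.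
Local Notation C := R[i].
Implicit Types (c : chart R n M) (g h : tensor11 R n M).

Lemma metric_trace_gt0 g h x : (0 < n)%N -> hermitian_metric X g ->
  hermitian_metric X h -> 0 < metric_trace X g h x.
Proof.
move=> n0 hg hh; have [Xc cx] := chart_atP X x.
rewrite (metric_trace_chart hg (hermitian_metric_compatible hh) Xc cx).
have cz := to_c_img cx.
have [l [l0 ->]] := positive_trace (hermitian_metric_positive hg Xc cz)
  (hermitian_metric_positive hh Xc cz).
rewrite /= (bigD1 (Ordinal n0)) //= ltr_pwDl // sumr_ge0 // => i _; exact: ltW.
Qed.

(** The three summands of the constant answer three cases: S0 < 1, S0^2 below the threshold
    proportional to y^3, and the remaining one, in which [frame_estimate] bounds tau by B. *)
Lemma trace_at_max g (F phi : M -> R) c x0 (K A m Dlow Fsup : R)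
    (g' := add_tensor g (@ddbar R n M phi))
    (k1 := n%:R ^+ 3 * K ^+ 4) (k2 := n%:R ^+ 4 * K ^+ 5) (y := phi x0 - m + 1)
    (B := `|Dlow| + n%:R * (n%:R * k2 + n%:R ^+ 2 * k1 ^+ 2) + (A + 1) * n%:R) :
  hermitian_metric X g -> hermitian_metric X g' ->
  smooth_fun X F -> smooth_fun X phi ->
  (forall (x : M) (v : 'I_(n * 2) -> 'rV[R[i]]_n),
      wedge_pow (fundamental_form (at_point X g' x)) n v =
      (expR (F x))%:C * wedge_pow (fundamental_form (at_point X g x)) n v) ->
  1 <= K -> atlas X c -> Defs.dom c x0 ->
  (forall i, `|invmx (g c (to_c c x0)) i i| <= K%:C) ->
  (forall m k l, `|dz m (fun w => g c w k l) (to_c c x0)| <= K%:C) ->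
  (forall m m' k l, `|dz m (dzbar m' (fun w => g c w k l)) (to_c c x0)| <= K%:C) ->
  A = (2 * n%:R * k2 + 8 * k1 ^+ 2 * n%:R ^+ 2) + (k2 + 2 * n%:R * k1 ^+ 2) + 2 ->
  (forall x, m <= phi x) -> Dlow <= laplacian X g F x0 -> F x0 <= Fsup ->
  (forall x, ln (metric_trace X g g' x) - A * phi x + (phi x - m + 1)^-1 <=
     ln (metric_trace X g g' x0) - A * phi x0 + (phi x0 - m + 1)^-1) ->
  metric_trace X g g' x0 <=
    (1 + (A + 1) * (2 * n%:R * k1) + n%:R * (expR Fsup * B ^+ n.-1)) * y ^+ 2.
Proof.
move=> hg hg' sF sphi Ew K1 Xc cx b0 b1 b2 EA hm HD HF Qmax.
have Eg' z : g' c z = g c z +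
    \matrix_(i, j) dz i (dzbar j (fun w => (phi (of_c c w))%:C)) z := erefl.
clearbody g'.
have K0 : 0 <= K := le_trans ler01 K1.
have k10 : 0 <= k1 by rewrite /k1 mulr_ge0 ?exprn_ge0.
have k20 : 0 <= k2 by rewrite /k2 mulr_ge0 ?exprn_ge0.
have A2 : 2 <= A.
  rewrite EA lerDr addr_ge0 // addr_ge0 // !mulr_ge0 ?exprn_ge0 //.
have y1 : 1 <= y by rewrite /y lerDr subr_ge0.
have B0 : 0 <= B by rewrite /B !addr_ge0 ?mulr_ge0 ?addr_ge0 ?mulr_ge0 ?exprn_ge0 //; lra.
have c1 : 0 <= (A + 1) * (2 * n%:R * k1) by rewrite !mulr_ge0 //; lra.
have c2 : 0 <= n%:R * (expR Fsup * B ^+ n.-1) by rewrite !mulr_ge0 ?exprn_ge0 ?expR_ge0.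
have yy1 : 1 <= y ^+ 2 by rewrite exprn_ege1.
set S0 := metric_trace X g g' x0.
have bound t : 0 <= t -> t <= 1 + (A + 1) * (2 * n%:R * k1) + n%:R * (expR Fsup * B ^+ n.-1) ->
    S0 <= t * y ^+ 2 ->
    S0 <= (1 + (A + 1) * (2 * n%:R * k1) + n%:R * (expR Fsup * B ^+ n.-1)) * y ^+ 2.
  move=> t0 tle St; apply: (le_trans St); apply: ler_wpM2r => //.
  exact: le_trans ler01 yy1.
have [S1|S1] := ltP S0 1.
  apply: (bound 1) => //; first by rewrite -addrA lerDl addr_ge0.
  by rewrite mul1r (le_trans (ltW S1)).
(* Since y >= 1, y^3 <= y^4, and taking square roots bounds S0 by a multiple of y^2. *)
have [Sy|Sy] := ltP (S0 ^+ 2) ((A + 1) ^+ 2 * (2 * n%:R * k1) ^+ 2 * y ^+ 3).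
  apply: (bound ((A + 1) * (2 * n%:R * k1))) => //.
    by rewrite addrAC lerDr addr_ge0.
  have y0 : 0 <= y := le_trans ler01 y1.
  rewrite -(ler_pXn2r (n := 2)) ?nnegrE //; first last.
  - by rewrite mulr_ge0 // exprn_ge0.
  - exact: le_trans ler01 S1.
  apply: (le_trans (ltW Sy)); rewrite -exprMn [leRHS]exprMn -exprM.
  by apply: ler_wpM2l; [exact: sqr_ge0 | exact: ler_weXn2l].
have cz := to_c_img cx; have oc := @img_open _ _ _ c.
set z0 := to_c c x0 in b0 b1 b2 cz.
have sg : msmooth (img c) (g c) := metric_smooth hg Xc.
have sg' : msmooth (img c) (g' c) := metric_smooth hg' Xc.
have pg z (z_in : img c z) := hermitian_metric_positive hg Xc z_in.
have pg' z (z_in : img c z) := hermitian_metric_positive hg' Xc z_in.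
have ES z : img c z -> metric_trace X g g' (of_c c z) =
    complex.Re (\tr (invmx (g c z) *m g' c z)).
  move=> z_in; rewrite (metric_trace_chart hg (hermitian_metric_compatible hg') Xc (of_c_dom z_in)).
  by rewrite of_cK.
have ofz0 : of_c c z0 = x0 := to_cK cx.
have Edet z : img c z -> \det (g' c z) = (expR (F (of_c c z)))%:C * \det (g c z).
  move=> z_in; have := @det_chart _ _ _ _ _ _ _ _ (expR (F (of_c c z))) hg hg' Xc (of_c_dom z_in).
  rewrite of_cK //; apply.
  have [Xd dx] := chart_atP X (of_c c z); have dz := to_c_img dx.
  exact (det_of_wedge_pow (hermitian_metric_positive hg Xd dz)
    (hermitian_metric_positive hg' Xd dz) (Ew (of_c c z))).
have [P [l [uP l0 EP EP']]] := simultaneous_diagonalization (pg _ cz) (pg' _ cz).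
have PK i j : `|P i j| <= K%:C := frame_norm_le i j K1 uP EP b0.
have HD' : Dlow <= complex.Re (\tr (invmx (g c z0) *m
    \matrix_(i, j) dz i (dzbar j (fun w => (F (of_c c w))%:C)) z0)).
  by rewrite (le_trans HD) // /laplacian (metric_trace_chart hg (ddbar_compatible sF) Xc cx).
have ES0 := ES z0 cz; rewrite ofz0 -/S0 in ES0.
have Hy w : img c w -> 1 <= phi (of_c c w) - m + 1.
  by move=> _; rewrite lerDr subr_ge0.
have HQ w : img c w ->
    ln (complex.Re (\tr (invmx (g c w) *m g' c w))) - A * phi (of_c c w) + (phi (of_c c w) - m + 1)^-1
    <= ln (complex.Re (\tr (invmx (g c z0) *m g' c z0))) - A * phi (of_c c z0) + (phi (of_c c z0) - m + 1)^-1.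
  by move=> w_in; rewrite -(ES w w_in) -ES0 ofz0; exact: Qmax.
have HS1 : 1 <= complex.Re (\tr (invmx (g c z0) *m g' c z0)) by rewrite -ES0.
have HSy : (A + 1) ^+ 2 * (2 * n%:R * k1) ^+ 2 * (phi (of_c c z0) - m + 1) ^+ 3 <=
    complex.Re (\tr (invmx (g c z0) *m g' c z0)) ^+ 2 by rewrite -ES0 ofz0.
have [El Eprod tauB] := frame_estimate oc cz sg sg' pg pg' (sphi c Xc) (sF c Xc)
  (fun z _ => Eg' z) Edet uP l0 EP EP' k10 k20
  (fun p i j => frame_der1_le oc p i j K1 sg cz PK b1)
  (fun p i => frame_der2_le oc p i i K1 sg cz PK b2) HD' EA Hy HQ HS1 HSy.
apply: (bound (n%:R * (expR Fsup * B ^+ n.-1))) => //; first by rewrite lerDr addr_ge0.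
apply: (@le_trans _ _ (n%:R * (expR Fsup * B ^+ n.-1))); last by rewrite ler_peMr.
rewrite ES0 El (le_trans (trace_le_inverse_trace l0 (_ : _ <= expR Fsup))) //.
  by rewrite Eprod ler_expR ofz0.
apply: ler_wpM2l => //; apply: ler_wpM2l; first exact: expR_ge0.
apply: lerXn2r; rewrite ?nnegrE //; apply: sumr_ge0 => i _; rewrite invr_ge0; exact: ltW.
Qed.

End MaximumPoint.

(** * Extrema on M and the global estimate *)

Lemma compact_max (R : realType) (M : topologicalType) (f : M -> R) (x : M) :
  compact [set: M] -> continuous f -> exists a, forall t, f t <= f a.
Proof.
move=> cM cf; have [] := @compact_EVT_max M R f [set: M] _ cM.
- by exists x.
- exact: continuous_subspaceT.
by move=> a _ fa; exists a => t; apply: fa; rewrite inE.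
Qed.

Lemma le_sup_range (R : realType) (M : topologicalType) (f : M -> R) (x : M) :
  compact [set: M] -> continuous f -> f x <= sup (range f).
Proof.
move=> cM cf; have [a fa] := compact_max x cM cf.
by apply: sup_ubound; [exists (f a) => _ [t _ <-] | exists x].
Qed.

Lemma inf_range_le (R : realType) (M : topologicalType) (f : M -> R) (x : M) :
  compact [set: M] -> continuous f -> inf (range f) <= f x.
Proof.
move=> cM cf; have [a fa] := compact_max x cM (fun t => continuousN (cf t)).
by apply: inf_lbound; [exists (f a) => _ [t _ <-]; rewrite -lerN2 | exists x].
Qed.

Theorem mainTheorem9 (R : realType) (n : nat) (M : topologicalType)
    (X : complex_manifold R n M) (g : tensor11 R n M)
    (M_compact : compact [set: M]) (g_metric : hermitian_metric X g) :
  exists C A : R -> R -> R,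
  forall F phi : M -> R,
    smooth_fun X F ->
    smooth_fun X phi ->
    sup (range phi) = 0 ->
    let g' := add_tensor g (@ddbar R n M phi) in
    hermitian_metric X g' ->
    (forall (x : M) (v : 'I_(n * 2) -> 'rV[R[i]]_n),
      wedge_pow (fundamental_form (at_point X g' x)) n v =
      (expR (F x))%:C * wedge_pow (fundamental_form (at_point X g x)) n v) ->
    let supF := sup (range F) in
    let infDF := inf (range (laplacian X g F)) in
    forall x : M,
      metric_trace X g g' x <=
      C supF infDF * expR (A supF infDF * (phi x - inf (range phi))).
Proof.
case: (posnP n) => [n0|n0].
  (* In dimension 0 the trace is an empty sum. *)
  exists (fun _ _ => 0), (fun _ _ => 0) => F phi _ _ _ g' _ _ supF infDF x.
  rewrite mul0r /metric_trace big1 // => i; by have := ltn_ord i; rewrite {2}n0.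
have [K K1 HK] := metric_uniform_bound M_compact g_metric.
pose k1 : R := n%:R ^+ 3 * K ^+ 4; pose k2 : R := n%:R ^+ 4 * K ^+ 5.
pose A : R := (2 * n%:R * k2 + 8 * k1 ^+ 2 * n%:R ^+ 2) + (k2 + 2 * n%:R * k1 ^+ 2) + 2.
pose B (D : R) : R := `|D| + n%:R * (n%:R * k2 + n%:R ^+ 2 * k1 ^+ 2) + (A + 1) * n%:R.
pose C3 (S D : R) : R := 1 + (A + 1) * (2 * n%:R * k1) + n%:R * (expR S * B D ^+ n.-1).
have K0 : 0 <= K by exact: le_trans ler01 K1.
have k10 : 0 <= k1 by rewrite /k1 mulr_ge0 ?exprn_ge0.
have k20 : 0 <= k2 by rewrite /k2 mulr_ge0 ?exprn_ge0.
have A2 : 2 <= A by rewrite /A lerDr addr_ge0 // addr_ge0 // !mulr_ge0 ?exprn_ge0.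
have C30 S D : 0 < C3 S D.
  rewrite /C3 -addrA ltr_pwDl // addr_ge0 // !mulr_ge0 ?expR_ge0 //; first lra.
  by rewrite exprn_ge0 // /B !addr_ge0 ?mulr_ge0 ?addr_ge0 ?mulr_ge0 ?exprn_ge0 //; lra.
(* The factor e pays for 1 / y0 <= 1 in Q(x0). A comes from bounds on g alone, while sup F and inf
   of the Laplacian enter through C3. *)
exists (fun S D => C3 S D * expR 1), (fun _ _ => A).
move=> F phi sF sphi _ g' g'_metric Ew supF infDF x.
set m := inf (range phi).
have cF := smooth_fun_continuous sF; have cphi := smooth_fun_continuous sphi.
have hm y : m <= phi y := inf_range_le y M_compact cphi.
pose S := metric_trace X g g'.
have S0 y : 0 < S y := metric_trace_gt0 y n0 g_metric g'_metric.
have cS : continuous S.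
  by apply: (metric_trace_continuous g_metric (hermitian_metric_compatible g'_metric)) => c Xc;
  exact (metric_smooth g'_metric Xc).
have cDF : continuous (laplacian X g F).
  by apply: (metric_trace_continuous g_metric (ddbar_compatible sF)) => c Xc;
  exact (msmooth_ddbar sF Xc).
pose Q y := ln (S y) - A * phi y + (phi y - m + 1)^-1.
have y1 y : 1 <= phi y - m + 1 by rewrite lerDr subr_ge0.
have cQ : continuous Q.
  move=> y; have clnS : {for y, continuous (fun t => ln (S t))}.
    by apply: continuous_comp; [exact: cS | exact: continuous_ln].
  have cy : {for y, continuous (fun t => phi t - m + 1)}.
    by apply: cvgD; [apply: cvgB; [exact: cphi | exact: cvg_cst] | exact: cvg_cst].
  apply: cvgD; last by apply: cvgV => //; rewrite gt_eqF // (lt_le_trans ltr01 (y1 y)).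
  by apply: cvgB => //; apply: cvgM; [exact: cvg_cst | exact: cphi].
have [x0 Qmax] := compact_max x M_compact cQ.
have [c [Xc cx0 b0 b1 b2]] := HK x0.
have key : S x0 <= C3 supF infDF * (phi x0 - m + 1) ^+ 2.
  exact (trace_at_max g_metric g'_metric sF sphi Ew K1 Xc cx0 b0 b1 b2 (erefl A) hm
    (inf_range_le x0 M_compact cDF) (le_sup_range x0 M_compact cF) Qmax).
set y0 := phi x0 - m + 1 in key.
have y00 : 0 < y0 := lt_le_trans ltr01 (y1 x0).
(* ln y0 <= y0 - 1 makes the power y0^2 linear in phi(x0), ready to be absorbed by A phi(x0). *)
have lnS0 : ln (S x0) <= ln (C3 supF infDF) + 2 * (y0 - 1).
  apply: (@le_trans _ _ (ln (C3 supF infDF * y0 ^+ 2))).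
    by rewrite ler_ln ?posrE // mulr_gt0 ?exprn_gt0.
  rewrite lnM ?posrE ?exprn_gt0 // lerD2l lnXn // -[ln y0 *+ 2]mulr_natl.
  have lny : ln y0 <= y0 - 1.
    by rewrite -[X in ln X](subrK 1) addrC le_ln1Dx // ltrBDr addrC subrr.
  by apply: ler_wpM2l.
(* As A >= 2, 2 (y0 - 1) <= A (phi(x0) - m), so phi(x0) cancels in Q(x) <= Q(x0) and the bound no
   longer depends on x0. *)
have lnS : ln (S x) <= ln (C3 supF infDF) + 1 + A * (phi x - m).
  have := Qmax x; rewrite /Q -/y0.
  have iy : (y0)^-1 <= 1 by rewrite invf_le1 //; exact: y1.
  have ix : 0 <= (phi x - m + 1)^-1 by rewrite invr_ge0 (le_trans ler01 (y1 x)).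
  have Ay : 2 * (y0 - 1) <= A * (y0 - 1) by apply: ler_wpM2r => //; rewrite subr_ge0; exact: y1.
  have Ey : A * (y0 - 1) = A * phi x0 - A * m by rewrite /y0; ring.
  rewrite Ey in Ay; rewrite mulrBr.
  clear -iy ix Ay lnS0; clearbody y0 S C3 A.
  move: (A * phi x) (A * phi x0) (A * m) (ln (C3 supF infDF)) (ln (S x)) (ln (S x0))
    (y0^-1) ((phi x - m + 1)^-1) iy ix Ay lnS0 => t1 t2 t3 t4 t5 t6 t7 t8.
  clear; lra.
rewrite -[leLHS]lnK ?posrE; last exact: S0.
apply: (@le_trans _ _ (expR (ln (C3 supF infDF) + 1 + A * (phi x - m)))).
  by rewrite ler_expR.
by rewrite !expRD lnK ?posrE.
Qed.
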